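(* Let $A$ satisfy the assumptions (A1)--(A5) and let $B$ satisfy the assumptions (B1)--(B4), all listed in the context. Then there exist $m\le k$ in $\mathbb Z_+$ such that the following holds with $$B_0=(I+\Gamma_mB)^{-1}\big(B\,\Gamma_mB-(\Gamma_mB)J_mB\big),\qquad Q=J_mB+B_0,$$ $$\Phi(X)=Q\,\Gamma_kX-(\Gamma_kX)(J_kQ)-(\Gamma_kX)J_k(Q\,\Gamma_kX)+Q,\qquad X\in\mathfrak S_2(H).$$ The simple iterations $X_0=0$, $X_1=\Phi(X_0)=Q$, etc. have a limit $X_*\in\mathfrak S_2(H)$, and with $$U=\Gamma_mB+\Gamma_kX_*+(\Gamma_mB)(\Gamma_kX_* ),$$ $$V=J_kX_*=J_kQ+J_k(Q\,\Gamma_kX_* )=J_mB+J_k\big(B_0(I+\Gamma_kX_* )\big):$$ (1) $U,V\in\mathfrak S_2(H)$, the operator $A-B$ is similar to the operator $A-V$, and the similarity transform is given by $I+U$: $$(A-B)(I+U)=(I+U)(A-V).$$ (2) The matrix of $V$ with respect to $\mathcal P_{(k)}=\{P_{(k)}\}\cup\{P_n:|n|>k\}$ is diagonal, and the spectral projections $(I+U)E(I+U)^{-1}$, $E\in\mathcal P_{(k)}$, of the operator $A-B$ form a resolution of the identity. (3) $V=J_0B+J_0(B\,\Gamma_0B)+C$ for some $C\in\mathfrak S_1(H)$. (4) Where $Q\neq P_{(l)}QP_{(l)}$ for all $l\in\mathbb Z_+$ (so that all $\alpha_n(Q)\ne0$), $$\sigma(A-B)=\bigcup_{n\in\mathbb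 Z}\{\lambda_n-b_n\}$$ for some sequence $b=(b_n)\in\ell^2_w(\mathbb Z)$ with the weight $w(\ell)=(\alpha_\ell(Q))^{-2}$, i.e. $\sum_{\ell\in\mathbb Z}|b_\ell|^2(\alpha_\ell(Q))^{-2}<\infty$.
   Context: $H$ is a separable complex Hilbert space, $B(H)$ the algebra of bounded linear operators on $H$, $\mathfrak S_2(H)$ the Hilbert--Schmidt operators with norm $\|\cdot\|_2$, $\mathfrak S_1(H)$ the nuclear (trace class) operators. $B(H)$ is viewed as a space of operators on $D(A)$ by restriction, and operators are identified with their matrices. Resolution of the identity: a finite or countable family $\{E_n\}$ of idempotents in $B(H)$ such that each $E_n$ is an orthogonal projection, $E_mE_n=0$ for $m\neq n$, and for each $x\in H$ the series $\sum_nE_nx$ converges unconditionally to $x$. Assumptions on the densely defined operator $A:D(A)\subseteq H\to H$: (A1) $A$ is a closed normal linear operator, i.e. $D(A^* )=D(A)$ and $\|A^*x\|=\|Ax\|$ for $x\in D(A)$; (A2) $\sigma(A)=\bigcup_{n\in\mathbb Z}\{\lambda_n\}$, where each $\lambda_n$ is a semisimple eigenvalue of $A$ of finite multiplicity; (A3) the Riesz projections $P_n=P(\{\lambda_n\},A)$ (so $AP_n=\lambda_nP_n$) form a resolution of the identity; (A4) $\sup_{j\in\mathbb Z}\sum_{n\ne j}|\lambda_n-\lambda_j|^{-2}<\infty$; (A5) for every $\varepsilon>0$ there is $\lambda_\varepsilon\in\rho(A)$ with $\|(A-\lambda_\varepsilon I)^{-1}\|<\varepsilon$. Assumptions on $B$,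 with $B_{mn}=P_mBP_n$: (B1) $B$ is a linear operator with domain $D(A)$ that is $A$-bounded, i.e. $\|Bx\|\le c(\|x\|+\|Ax\|)$ on $D(A)$ for some $c>0$. (B2) $\sum_{m\in\mathbb Z}\sum_{n\ne m}\frac{\|B_{mn}\|_2^2}{|\lambda_m-\lambda_n|^2}<\infty$ and $\sum_{m,n\in\mathbb Z}\Big\|\sum_{\ell\ne n}\frac{B_{m\ell}B_{\ell n}}{\lambda_\ell-\lambda_n}\Big\|_2^2<\infty$. (B3) For every $\varepsilon>0$ there is $\lambda_\varepsilon\in\rho(A)$ such that the matrix with $Y_{mn}=\frac{1}{\lambda_n-\lambda_\varepsilon}B_{mn}$ for $m\ne n$ and $Y_{nn}=0$ defines an operator $Y\in B(H)$ with $\|Y\|<\varepsilon$. (B4) $\sum_{n\in\mathbb Z}\|B_{nn}\|_2^2<\infty$. Transforms, defined via the matrices $X_{ij}=P_iXP_j$: with $P_{(m)}=\sum_{|n|\le m}P_n$, $J_mX=P_{(m)}XP_{(m)}+\sum_{|n|>m}P_nXP_n$; $\Gamma X$ has entries $\frac{X_{ij}}{\lambda_i-\lambda_j}$ for $i\ne j$ and $0$ for $i=j$; $\Gamma_mX=\Gamma(X-J_mX)$. In particular $J_0X$ is the main diagonal of $X$ and $\Gamma_0=\Gamma$. For $X\in B(H)$ let $\|X\|_{2,\mathcal P}^2=\sum_{i,j}\|P_iXP_j\|^2$ (operator norms), and for $X\ne0$ with this finite, $$\alpha_n(X)=\|X\|_{2,\mathcal P}^{-1/2}\max\Big\{\Big(\sum_{|j|\ge|n|}\|P_jX\|_{2,\mathcal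 P}^2\Big)^{1/4},\Big(\sum_{|j|\ge|n|}\|XP_j\|_{2,\mathcal P}^2\Big)^{1/4}\Big\}.$$ Similarity: operators $A_1,A_2$ are similar, with similarity transform $W$ of $A_1$ into $A_2$, if $W\in B(H)$ is continuously invertible, $WD(A_2)=D(A_1)$ and $A_1Wx=WA_2x$ for $x\in D(A_2)$. The operators $A-B$ and $A-V$ have domain $D(A)$.
   Formalization: In (2) the projections form a resolution of the identity that is orthogonal for an equivalent scalar product (they are oblique in general); in (4) a multiple eigenvalue λ_n gets one shift b_{n,i} for each i up to its multiplicity, and max_i |b_{n,i}| replaces |b_n| in the weighted sum. *)

(* Defs.v *)
From HB Require Import structures.
From mathcomp Require Import all_boot all_order all_algebra.
From mathcomp Require Import all_classical all_reals all_analysis.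
From mathcomp Require Import complex.
From mathcomp Require showcase.summability.

Set Implicit Arguments.
Unset Strict Implicit.
Unset Printing Implicit Defensive.

Import Order.TTheory GRing.Theory Num.Theory.
Import numFieldNormedType.Exports.

Local Open Scope classical_set_scope.
Local Open Scope complex_scope.
Local Open Scope ring_scope.

(* The norm of a normed module over R[i] takes its values in R[i]; nm is the
   same norm (or modulus) read in R. *)
Definition nm {R : realType} {V : normedZmodType R[i]} (x : V) : R :=
  complex.Re `|x|.

(* A Hilbert space is a complete normed module over R[i] whose norm comes from a
   scalar product; {dot _ for Num.conj} is linear in its first argument. *)
Definition scalar_product_norm {R : realType} {H : completeNormedModType R[i]}
  (ip : {dot H for Num.conj}) := forall x : H, `|x| ^+ 2 = ip x x.

Definition separable_space (T : topologicalType) :=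
  exists S : set T, countable S /\ dense S.

Section BoundedOperators.
Context {R : realType} {H : completeNormedModType R[i]}.
Implicit Types (ip : {dot H for Num.conj}) (X Y W E : H -> H).

Definition bounded_op X :=
  linear X /\ exists c : R, forall x, nm (X x) <= c * nm x.

Definition opnorm X : R := sup [set nm (X x) | x in [set x | nm x <= 1]].

Definition is_inverse W Y :=
  [/\ bounded_op Y, cancel W Y & cancel Y W].

Definition cont_invertible W := bounded_op W /\ exists Y, is_inverse W Y.

Definition inv_op W : H -> H := xget 0 [set Y | is_inverse W Y].

Definition orthonormal_basis ip (E : set H) :=
  [/\ forall e, E e -> ip e e = 1,
      forall e f, E e -> E f -> e <> f -> ip e f = 0 &
      forall x, (forall e, E e -> ip x e = 0) -> x = 0].

(* The square of the Hilbert-Schmidt norm. The sum does not depend on the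
   orthonormal basis, so the supremum only spares the choice of one. *)
Definition hsnorm2 ip X : \bar R :=
  ereal_sup [set \esum_(e in E) ((nm (X e)) ^+ 2)%:E
            | E in orthonormal_basis ip].

Definition hilbert_schmidt ip X := bounded_op X /\ (hsnorm2 ip X < +oo)%E.

Definition nuclear ip X := exists a b : nat -> H,
  (\esum_(n in setT) (nm (a n) * nm (b n))%:E < +oo)%E /\
  forall x, series (fun n => ip x (b n) *: a n) @ \oo --> X x.

(* Sum of a family of operators in the strong sense, unconditionally: the limit
   is taken along the net of the finite subsets of the index type. *)
Definition opsum (I : choiceType) (F : I -> H -> H) : H -> H :=
  fun x => summability.sum (fun i => F i x).

Definition disjoint_resolution (I : countType) (E : I -> H -> H) :=
  [/\ forall i, bounded_op (E i),
      forall i, E i \o E i = E i,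
      forall i j, i <> j -> E i \o E j = 0 &
      forall x, summability.partial_sum (fun i => E i x)
                  @ summability.totally --> x].

Definition orthogonal_projection ip E :=
  E \o E = E /\ forall x y, ip (E x) y = ip x (E y).

Definition resolution_of_identity ip (I : countType) (E : I -> H -> H) :=
  disjoint_resolution E /\ forall i, orthogonal_projection ip (E i).

Definition equivalent_scalar_products ip ip' := exists2 c : R, 0 < c &
  forall x, c%:C * ip x x <= ip' x x /\ ip' x x <= c^-1%:C * ip x x.

End BoundedOperators.

(* An operator T with domain D is given by a total function together with the
   set D; its values outside D are irrelevant. *)
Section UnboundedOperators.
Context {R : realType} {H : completeNormedModType R[i]}.
Implicit Types (ip : {dot H for Num.conj}) (D : set H) (T S W E : H -> H).
Implicit Type z : R[i].

Definition linear_on D T :=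
  [/\ D 0,
      forall a x y, D x -> D y -> D (a *: x + y) &
      forall a x y, D x -> D y -> T (a *: x + y) = a *: T x + T y].

Definition closed_op D T := closed [set p : H * H | D p.1 /\ p.2 = T p.1].

(* y belongs to the domain of the adjoint and the adjoint maps y to z. *)
Definition adjoint_at ip D T (y z : H) := forall x, D x -> ip (T x) y = ip x z.

Definition normal_op ip D T :=
  (forall x, D x <-> exists y, adjoint_at ip D T x y) /\
  (forall x y, D x -> adjoint_at ip D T x y -> nm y = nm (T x)).

(* S = (T - z)^-1 *)
Definition is_resolvent D T z S :=
  [/\ bounded_op S,
      forall x, D (S x) /\ T (S x) - z *: S x = x &
      forall x, D x -> S (T x - z *: x) = x].

Definition resolvent_set D T : set R[i] :=
  [set z | exists S, is_resolvent D T z S].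

Definition spectrum D T : set R[i] := ~` resolvent_set D T.

(* z is an eigenvalue of finite multiplicity d without generalized eigenvectors
   other than eigenvectors. *)
Definition semisimple_eigenvalue D T z (d : nat) :=
  [/\ (0 < d)%N,
      (exists v : 'I_d -> H, forall x, (D x /\ T x = z *: x) <->
         exists! c : 'I_d -> R[i], x = \sum_(i < d) c i *: v i) &
      forall x, D x -> D (T x - z *: x) ->
        T (T x - z *: x) = z *: (T x - z *: x) -> T x = z *: x].

(* Riemann sums over n.+1 equal arcs of (2 i pi)^-1 times the integral of
   (z - T)^-1 x over the circle z = z0 + r exp(i t), dz = i r exp(i t) dt. *)
Definition contour_sum (S : R[i] -> H -> H) z0 (r : R) (n : nat) (x : H) : H :=
  \sum_(k < n.+1)
     let t : R := 2 * pi * k%:R / n.+1%:R in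
     let w : R[i] := r%:C * (cos t +i* sin t) in
     (w / n.+1%:R) *: (- S (z0 + w) x).

(* E = P({z0}, T) for a point z0 isolated from the rest of the spectrum *)
Definition riesz_projection D T z0 E := exists2 r : R, 0 < r &
  (forall z, 0 < nm (z - z0) <= r -> resolvent_set D T z) /\
  exists S : R[i] -> H -> H,
    (forall z, nm (z - z0) = r -> is_resolvent D T z (S z)) /\
    forall x, (fun n => contour_sum S z0 r n x) @ \oo --> E x.

(* E is the Riesz projection P(s, T) of a finite set s of isolated points of
   the spectrum: the contour consists of small circles around these points. *)
Definition spectral_projection D T E := exists (s : seq R[i]) (F : R[i] -> H -> H),
  [/\ uniq s,
      forall z, z \in s -> spectrum D T z /\ riesz_projection D T z (F z) &
      E = \sum_(z <- s) F z].

Definition similar_via D1 T1 D2 T2 W :=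
  [/\ cont_invertible W, W @` D2 = D1 &
      forall x, D2 x -> T1 (W x) = W (T2 x)].

(* The bounded operator whose restriction to the dense subspace D is that of X;
   meaningful when X is bounded on D. *)
Definition bounded_extension D X : H -> H :=
  xget 0 [set Y | bounded_op Y /\ forall x, D x -> Y x = X x].

End UnboundedOperators.

Section Transforms.
Context {R : realType} {H : completeNormedModType R[i]}.
Variables (P : int -> H -> H) (lam : int -> R[i]).
Implicit Types (X : H -> H) (k m : nat).

Definition entry X (i j : int) : H -> H := P i \o X \o P j.

(* The bounded operator with matrix M, if there is one. *)
Definition of_matrix (M : int -> int -> H -> H) : H -> H :=
  xget 0 [set X | bounded_op X /\ forall i j, entry X i j = M i j].

(* The sum of P n over |n| <= m, with n = i - m. *)
Definition Pblock m : H -> H := \sum_(i < (2 * m).+1) P (i%:Z - m%:Z).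

Definition Jt m X : H -> H :=
  (Pblock m \o X \o Pblock m)
  + opsum (fun n : int => if (m < `|n|)%N then entry X n n else 0).

Definition Gamma X : H -> H := of_matrix (fun i j =>
  if i == j then 0 else (lam i - lam j)^-1 *: entry X i j).

(* The entry (i, j) of the matrix product of X and Gamma X. *)
Definition mulGamma_entry X (i j : int) : H -> H := opsum (fun l : int =>
  if l == j then 0 else
  (lam l - lam j)^-1 *: (entry X i l \o entry X l j)).

Definition Gammat m X : H -> H := Gamma (X - Jt m X).

Definition Phi (Q : H -> H) k X : H -> H :=
  (Q \o Gammat k X) - (Gammat k X \o Jt k Q)
  - (Gammat k X \o Jt k (Q \o Gammat k X)) + Q.

(* The family consisting of Pblock k (index None) and of P n for |n| > k. *)
Definition coarse k (o : option {n : int | (k < `|n|)%N}) : H -> H :=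
  if o is Some n then P (val n) else Pblock k.

(* Squared norm: the sum of the squared operator norms of the entries. *)
Definition normP2 X : \bar R :=
  \esum_(ij in [set: int * int]) ((opnorm (entry X ij.1 ij.2)) ^+ 2)%:E.

(* Meaningful when X is nonzero and normP2 X is finite. *)
Definition alpha X (n : int) : R :=
  let rows := fine (\esum_(j in [set j : int | (`|n| <= `|j|)%N])
                      normP2 (P j \o X)) in
  let cols := fine (\esum_(j in [set j : int | (`|n| <= `|j|)%N])
                      normP2 (X \o P j)) in
  Num.sqrt (fine (normP2 X)) `^ (- 2^-1) * Num.max (rows `^ 4^-1) (cols `^ 4^-1).

End Transforms.

Arguments coarse {R H} P k o.

Section Assumptions.
Context {R : realType} {H : completeNormedModType R[i]}.
Variables (ip : {dot H for Num.conj}) (DA : set H) (A B : H -> H).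
Variables (lam : int -> R[i]) (mult : int -> nat) (P : int -> H -> H).

Record unperturbed : Prop := {
  unp_linear : linear_on DA A;
  unp_dense : dense DA;
  unp_closed : closed_op DA A;
  unp_normal : normal_op ip DA A;
  unp_spectrum : spectrum DA A = range lam;
  unp_semisimple : forall n, semisimple_eigenvalue DA A (lam n) (mult n);
  unp_riesz : forall n, riesz_projection DA A (lam n) (P n);
  unp_eigen : forall n x, DA (P n x) /\ A (P n x) = lam n *: P n x;
  unp_resolution : resolution_of_identity ip P;
  (* implicit in the divisions below, since 0^-1 = 0 here *)
  unp_distinct : injective lam;
  unp_separated :
    (ereal_sup (range (fun j =>
       \esum_(n in [set n | n != j]) ((nm (lam n - lam j)) ^- 2)%:E)) < +oo)%E;
  unp_resolvent : forall eps : R, 0 < eps -> exists z S,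
    is_resolvent DA A z S /\ opnorm S < eps }.

Record perturbation : Prop := {
  per_linear : linear_on DA B;
  per_bounded : exists2 c : R, 0 < c &
    forall x, DA x -> nm (B x) <= c * (nm x + nm (A x));
  per_summable1 :
    (\esum_(mn in [set mn : int * int | mn.1 != mn.2])
       (hsnorm2 ip (entry P B mn.1 mn.2)
        * ((nm (lam mn.1 - lam mn.2)) ^- 2)%:E) < +oo)%E;
  per_summable2 :
    (\esum_(mn in [set: int * int])
       hsnorm2 ip (mulGamma_entry P lam B mn.1 mn.2) < +oo)%E;
  per_small : forall eps : R, 0 < eps -> exists z Y,
    [/\ resolvent_set DA A z, bounded_op Y,
        forall m n, entry P Y m n =
          (if m == n then 0 else (lam n - z)^-1 *: entry P B m n) &
        opnorm Y < eps];
  per_diagonal :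
    (\esum_(n in setT) hsnorm2 ip (entry P B n n) < +oo)%E }.

End Assumptions.

(* Main.v *)
Require Import Defs.
From HB Require Import structures.
From mathcomp Require Import all_boot all_order all_algebra.
From mathcomp Require Import all_classical all_reals all_analysis.
From mathcomp Require Import complex ring lra zify finmap.
From mathcomp Require showcase.summability.

Import Order.TTheory GRing.Theory Num.Theory.
Import numFieldNormedType.Exports.

Set Implicit Arguments.
Unset Strict Implicit.
Unset Printing Implicit Defensive.

Local Open Scope classical_set_scope.
Local Open Scope complex_scope.
Local Open Scope ring_scope.

(** Formally, if an operator G satisfies A G - G A = M on the domain of A, then
    (A - B)(1 + G) = (1 + G)(A - Q) amounts to an equation between B, G, M and Q
    that does not mention A. Dividing the entries of M by the differences of
    eigenvalues produces such a G, and this is what Gamma does. The theorem is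
    obtained by using this device twice.

    The first step (first_similarity) takes M = B - J_m B, so G = Gamma_m B. The
    summability assumptions on B make G and the extension of B G
    Hilbert-Schmidt, and for large m the norm of G is small, so that 1 + G is
    invertible and Q = J_m B + B_0 is Hilbert-Schmidt. The unbounded B has been
    traded for the Hilbert-Schmidt Q. That 1 + G maps the domain of A onto itself
    is not a consequence of the smallness of G alone: domain_bijection uses that
    B - J_m B has relative bound zero.

    The second step (second_similarity) takes M = X - J_k X for a
    Hilbert-Schmidt X. The requirement that Q be carried to the block-diagonal
    V = J_k X is the equation X = Phi(X). For large k the maps
    X |-> Q Gamma_k X and X |-> (Gamma_k X) J_k Q have small norms, since rows
    and columns with small index are divided by large differences of
    eigenvalues and the rest of Q is small (Gamma_small). Hence Phi is a
    contraction near Q and its iterations converge (fixed_point).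

    The operator A - V is a direct sum of finite-dimensional blocks. For each
    block linear algebra gives root projections and reduced resolvents; the
    remaining blocks are resolvent operators at the point in question, provided
    that distinct blocks have disjoint spectra, which holds for large k
    (blocks_disjoint). A reduced resolvent at an isolated point determines the
    contour integral (riesz_projection_of_reduced): over equal arcs of a circle
    the Riemann sums are finite geometric sums up to an exponentially small
    error. Similarity transports the
    projections, which become orthogonal for the scalar product pulled back by
    the inverse of the transform.

    The difference between V and its principal part J_0 B + J_0 (B Gamma_0 B) consists
    of central blocks, which have finite rank, and of diagonals of products of
    two Hilbert-Schmidt operators, which are nuclear since compressing a nuclear
    expansion by every P n preserves the two square sums
    (diagonal_HS_product_trace_class).

    An eigenvalue of the block n is within |P_n V| of lam n, and
    |P_n V| <= 2 |P_n Q|. The squares a_n of |P_n Q|, or rather of the larger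
    quantity |P_n Q|_{2,P}, have the tails T_n which enter alpha_n; as
    alpha_n^2 is at least a multiple of the square root of T_n, the weighted sum
    is controlled by the sum of the a_n / sqrt T_n, which telescopes
    (sum_div_sqrt_tail).

    Hilbert-Schmidt norms are computed in one orthonormal system e adapted to
    the projections P n, in which the operators P n are diagonal; most estimates
    are then entrywise (schur_dom, hs_tail). *)

(** * The real-valued norm *)

Section Norms.
Context {R : realType} {V : normedZmodType R[i]}.
Implicit Types x y : V.

Lemma nmE x : (nm x)%:C = `|x|.
Proof. by rewrite /nm RRe_real// normr_real. Qed.

Lemma nm_ge0 x : 0 <= nm x.
Proof. by rewrite -lecR nmE normr_ge0. Qed.

Lemma nm0 : nm (0 : V) = 0.
Proof. by rewrite /nm normr0. Qed.

Lemma nm_eq0 x : (nm x == 0) = (x == 0).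
Proof. by rewrite -[RHS]normr_eq0 -nmE eq_complex /= eqxx andbT. Qed.

Lemma nm0_eq0 x : nm x = 0 -> x = 0.
Proof. by move/eqP; rewrite nm_eq0 => /eqP. Qed.

Lemma nmN x : nm (- x) = nm x.
Proof. by rewrite /nm normrN. Qed.

Lemma nmB x y : nm (x - y) = nm (y - x).
Proof. by rewrite /nm distrC. Qed.

Lemma nmD x y : nm (x + y) <= nm x + nm y.
Proof. by rewrite -lecR rmorphD/= !nmE ler_normD. Qed.

Lemma nmBD x y : nm (x - y) <= nm x + nm y.
Proof. by rewrite (le_trans (nmD _ _))// nmN. Qed.

Lemma nm_dist z x y : nm (x - y) <= nm (x - z) + nm (z - y).
Proof. by rewrite (le_trans _ (nmD _ _))// addrA subrK. Qed.

Lemma nm_sum (I : Type) (r : seq I) (Q : pred I) (F : I -> V) :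
  nm (\sum_(i <- r | Q i) F i) <= \sum_(i <- r | Q i) nm (F i).
Proof.
elim/big_ind2 : _ => [|x1 x2 y1 y2 h1 h2|//]; first by rewrite nm0.
by rewrite (le_trans (nmD _ _))// lerD.
Qed.

End Norms.

Section ScalarNorms.
Context {R : realType}.
Implicit Types z w : R[i].

Lemma nmM z w : nm (z * w) = nm z * nm w.
Proof. by apply: complexI; rewrite rmorphM/= !nmE normrM. Qed.

Lemma nm1 : nm (1 : R[i]) = 1.
Proof. by rewrite /nm normr1. Qed.

Lemma nmV z : nm z^-1 = (nm z)^-1.
Proof.
by apply: complexI; rewrite fmorphV/= !nmE normfV.
Qed.

Lemma nmX z n : nm (z ^+ n) = nm z ^+ n.
Proof. by apply: complexI; rewrite rmorphXn/= !nmE normrX. Qed.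

Lemma nm_conj z : nm (Num.conj z) = nm z.
Proof. by rewrite /nm norm_conjC. Qed.

Lemma nmC (r : R) : nm (r%:C) = `|r|.
Proof. by rewrite /nm normc_def /= expr0n /= addr0 sqrtr_sqr. Qed.

Lemma sqr_nm z : (nm z ^+ 2)%:C = z * Num.conj z.
Proof. by rewrite rmorphXn/= nmE normCK. Qed.

End ScalarNorms.

Section NormedModules.
Context {R : realType} {V : normedModType R[i]}.
Implicit Types x y : V.

Lemma nmZ (a : R[i]) x : nm (a *: x) = nm a * nm x.
Proof. by apply: complexI; rewrite rmorphM/= !nmE normrZ. Qed.

Lemma cvg_nmP (T : Type) (F : set_system T) (FF : Filter F) (f : T -> V) (l : V) :
  f @ F --> l <-> forall e : R, 0 < e -> \forall t \near F, nm (f t - l) < e.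
Proof.
split => [/cvgrPdist_lt h e e0|h].
  have e0' : 0 < e%:C by rewrite ltcR.
  by move: (h _ e0'); apply: filterS => t; rewrite -nmE ltcR nmB.
apply/cvgrPdist_lt => e e0.
have ee : (complex.Re e)%:C = e by rewrite RRe_real// gtr0_real.
have : 0 < complex.Re e by rewrite -ltcR ee.
by move=> /h; apply: filterS => t; rewrite -nmE -[in X in _ -> _ < X]ee ltcR nmB.
Qed.

Lemma lim_unique (T : Type) (F : set_system T) (FF : ProperFilter F)
  (f : T -> V) (l l' : V) : f @ F --> l -> f @ F --> l' -> l = l'.
Proof. exact: (cvg_unique (@norm_hausdorff _ V)). Qed.

Lemma nm_lim_le (T : Type) (F : set_system T) (FF : ProperFilter F)
  (f : T -> V) (l : V) (c : R) : f @ F --> l ->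
  (\forall t \near F, nm (f t) <= c) -> nm l <= c.
Proof.
move=> /cvg_nmP h hc; apply/ler_addgt0Pr => e e0.
have [t [t1 t2]] := filter_ex (filterI (h _ e0) hc).
rewrite -(subrK (f t) l) addrC (le_trans (nmD _ _))// lerD//.
by rewrite nmB ltW.
Qed.

Lemma nm_cvg (T : Type) (F : set_system T) (FF : Filter F) (f : T -> V) (l : V) :
  f @ F --> l -> (fun t => nm (f t)) @ F --> nm l.
Proof.
move=> /cvg_nmP h; apply/cvgrPdist_lt => e /h; apply: filterS => t.
apply: le_lt_trans; rewrite ler_norml; apply/andP; split.
  by rewrite lerBrDl lerBlDr addrC -{1}(subrK l (f t)) nmD.
by rewrite lerBlDr nmB -{1}(subrK (f t) l) nmD.
Qed.

End NormedModules.

Section Completeness.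
Context {R : realType} {H : completeNormedModType R[i]}.

(** Completeness for arbitrary filters, in the form needed for the net of finite
    subsets. *)
Lemma cauchy_lim (T : Type) (F : set_system T) (FF : ProperFilter F)
    (f : T -> H) :
  (forall e : R, 0 < e -> exists y : H, \forall t \near F, nm (f t - y) < e) ->
  exists l : H, f @ F --> l.
Proof.
move=> h; suff : cvg (f @ F) by move=> cf; exists (lim (f @ F)).
apply/cauchy_cvgP/cauchy_exP => e e0.
have ee : (complex.Re e)%:C = e by rewrite RRe_real// gtr0_real.
have : 0 < complex.Re e by rewrite -ltcR ee.
move=> /h[y hy]; exists y.
change (\forall t \near F, ball y e (f t)).
apply: filterS hy => t.
by rewrite -ball_normE /ball_ /= -nmE -ee ltcR nmB.
Qed.

End Completeness.

(** * Scalar products and unconditional sums *)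

Section Inner.
Context {R : realType} {H : completeNormedModType R[i]}.
Variables (ip : {dot H for Num.conj}) (ip_norm : scalar_product_norm ip).
Implicit Types x y z : H.

Lemma ipC x y : ip x y = Num.conj (ip y x).
Proof. by rewrite hermC /= expr0 mul1r. Qed.
Lemma ipDl x y z : ip (x + y) z = ip x z + ip y z.
Proof. by rewrite linearDl. Qed.
Lemma ipDr x y z : ip x (y + z) = ip x y + ip x z.
Proof. by rewrite linearDr. Qed.
Lemma ipZl a x y : ip (a *: x) y = a * ip x y.
Proof. by rewrite linearZl_LR. Qed.
Lemma ipZr a x y : ip x (a *: y) = Num.conj a * ip x y.
Proof. by rewrite linearZr_LR. Qed.
Lemma ip0l y : ip 0 y = 0.
Proof. by rewrite linear0l. Qed.
Lemma ip0r y : ip y 0 = 0.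
Proof. by rewrite linear0r. Qed.
Lemma ipNl x y : ip (- x) y = - ip x y.
Proof. by rewrite linearNl. Qed.
Lemma ipBl x y z : ip (x - y) z = ip x z - ip y z.
Proof. by rewrite ipDl ipNl. Qed.
Lemma ip_suml (I : Type) (r : seq I) (Q : pred I) (F : I -> H) y :
  ip (\sum_(i <- r | Q i) F i) y = \sum_(i <- r | Q i) ip (F i) y.
Proof. by elim/big_rec2 : _ => [|i a b _ <-]; rewrite ?ip0l ?ipDl. Qed.
Lemma ip_sumr (I : Type) (r : seq I) (Q : pred I) (F : I -> H) y :
  ip y (\sum_(i <- r | Q i) F i) = \sum_(i <- r | Q i) ip y (F i).
Proof. by elim/big_rec2 : _ => [|i a b _ <-]; rewrite ?ip0r ?ipDr. Qed.
Lemma ip_eq0C x y : ip x y = 0 -> ip y x = 0.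
Proof. by move=> h; rewrite ipC h rmorph0. Qed.

Lemma ip_nm x : ip x x = (nm x ^+ 2)%:C.
Proof. by rewrite -ip_norm rmorphXn/= nmE. Qed.

Lemma nm2D x y : nm (x + y) ^+ 2 = nm x ^+ 2 + nm y ^+ 2 + 2 * complex.Re (ip x y).
Proof.
apply: complexI; rewrite -ip_nm ipDl !ipDr !ip_nm (ipC y x).
case: (ip x y) => a b; apply/eqP; rewrite eq_complex /=; apply/andP; split; apply/eqP; ring.
Qed.

Lemma nm2D_orth x y : ip x y = 0 -> nm (x + y) ^+ 2 = nm x ^+ 2 + nm y ^+ 2.
Proof. by move=> h; rewrite nm2D h /= mulr0 addr0. Qed.

(** The Cauchy-Schwarz inequality. *)
Lemma nm_ip x y : nm (ip x y) <= nm x * nm y.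
Proof.
have [->|y0] := eqVneq y 0; first by rewrite ip0r !nm0 mulr0.
have ny : 0 < nm y by rewrite lt_def nm_eq0 y0 nm_ge0.
pose c := ip x y / (nm y ^+ 2)%:C.
have n2 : (nm y ^+ 2)%:C != 0 :> R[i] by rewrite -[0]/((0:R)%:C) (inj_eq (@complexI _)) sqrf_eq0 gt_eqF.
have o : ip (x - c *: y) (c *: y) = 0.
  by rewrite ipZr ipBl ipZl ip_nm /c divfK// subrr mulr0.
have := nm2D_orth o; rewrite subrK => e.
have : nm (c *: y) ^+ 2 <= nm x ^+ 2 by rewrite e lerDr sqr_ge0.
rewrite ler_sqr ?nnegrE ?nm_ge0// nmZ /c nmM nmV nmC ger0_norm ?sqr_ge0//.
rewrite expr2 invfM mulrA -mulrA mulVf ?mulr1 ?gt_eqF// -ler_pdivlMr ?invr_gt0//.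
by rewrite invrK.
Qed.

Lemma nm2_sum_orth (I : eqType) (r : seq I) (F : I -> H) : uniq r ->
  (forall i j, i != j -> ip (F i) (F j) = 0) ->
  nm (\sum_(i <- r) F i) ^+ 2 = \sum_(i <- r) nm (F i) ^+ 2.
Proof.
move=> ur o; elim: r ur => [|a r IH] /=; first by rewrite !big_nil nm0 expr0n.
move=> /andP[ar ur]; rewrite !big_cons nm2D_orth ?IH//.
rewrite ip_sumr big_seq big1// => i ir; apply: o.
by apply: contraNneq ar => ->.
Qed.

End Inner.

Lemma big_fset_sub (V : zmodType) (I : choiceType) (f : I -> V) (A B : {fset I}) :
  (A `<=` B)%fset ->
  \sum_(i <- B) f i = \sum_(i <- A) f i + \sum_(i <- (B `\` A)%fset) f i.
Proof.
move=> AB; rewrite (big_fsetID _ (mem A)); congr (_ + _); apply: eq_fbigl => i.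
  rewrite !inE /=; apply: andb_idl => iA; exact: (fsubsetP AB).
by rewrite !inE /= andbC.
Qed.

Section HasSum.
Context {R : realType} {V : normedModType R[i]}.

(** A one-constructor type rather than an abbreviation, so that statements about
    it are not seen through to the universally quantified convergence. *)
Variant hassum {I : choiceType} (f : I -> V) (s : V) : Prop :=
  Hassum of summability.partial_sum f @ summability.totally --> s.

#[local] Existing Instance summability.totally_filter.

Lemma partial_sumE (I : choiceType) (f : I -> V) (A : {fset I}) :
  summability.partial_sum f A = \sum_(i <- A) f i.
Proof. by rewrite big_seq_fsetE. Qed.

Lemma hassum_nmP (I : choiceType) (f : I -> V) s : hassum f s <->
  forall e : R, 0 < e -> exists A : {fset I}, forall B : {fset I},
    (A `<=` B)%fset -> nm (\sum_(i <- B) f i - s) < e.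
Proof.
split => [[/cvg_nmP h] e /h|h].
  by move=> -[A _ hA]; exists A => B /hA; rewrite /= partial_sumE.
constructor; apply/cvg_nmP => e /h.
by move=> [A hA]; exists A => // B /hA; rewrite /= partial_sumE.
Qed.

Lemma hassum_unique (I : choiceType) (f : I -> V) s s' :
  hassum f s -> hassum f s' -> s = s'.
Proof. by move=> [h] [h']; exact: (lim_unique _ h h'). Qed.

Lemma hassum_lim (I : choiceType) (f : I -> V) s :
  hassum f s -> summability.sum f = s.
Proof. by move=> [h]; apply: (cvg_lim (@norm_hausdorff _ V)). Qed.

Lemma hassum_le (I : choiceType) (f : I -> V) s (c : R) : hassum f s ->
  (forall A : {fset I}, nm (\sum_(i <- A) f i) <= c) -> nm s <= c.
Proof.
move=> [hs] hc; apply: nm_lim_le hs _.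
apply: filterE => A; by rewrite partial_sumE.
Qed.

Lemma hassum_fin (I : choiceType) (f : I -> V) (A : {fset I}) :
  (forall i, i \notin A -> f i = 0) -> hassum f (\sum_(i <- A) f i).
Proof.
move=> h; apply/hassum_nmP => e e0; exists A => B AB.
rewrite (big_fset_incl _ AB); last by move=> i _; exact: h.
by rewrite subrr nm0.
Qed.

Lemma hassumD (I : choiceType) (f g : I -> V) s t :
  hassum f s -> hassum g t -> hassum (fun i => f i + g i) (s + t).
Proof.
move=> [hf] [hg]; constructor.
suff -> : summability.partial_sum (fun i => f i + g i) =
    summability.partial_sum f \+ summability.partial_sum g by exact: cvgD.
by apply/funext => A; rewrite /= /summability.partial_sum big_split.
Qed.

End HasSum.

Lemma hassum_map {R : realType} {V W : normedModType R[i]} (I : choiceType)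
    (f : I -> V) (s : V) (L : V -> W) (c : R) :
  (forall x y, L (x - y) = L x - L y) -> (forall x, nm (L x) <= c * nm x) ->
  hassum f s -> hassum (L \o f) (L s).
Proof.
move=> LB Lc /hassum_nmP h; apply/hassum_nmP => e e0.
have p : 0 < `|c| + 1 by rewrite ltr_wpDl.
have /h[A hA] : 0 < e / (`|c| + 1) by rewrite divr_gt0.
exists A => B /hA; rewrite ltr_pdivlMr// => ht.
have L0 : L 0 = 0 by rewrite -(subrr 0) LB subrr.
have LD x y : L (x + y) = L x + L y.
  by rewrite -{1}(opprK y) LB -[- y]sub0r LB L0 sub0r opprK.
rewrite (_ : \sum_(i <- B) _ = L (\sum_(i <- B) f i)).
  rewrite -LB (le_lt_trans (Lc _))// (le_lt_trans _ ht)//.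
  by rewrite mulrC ler_wpM2l ?nm_ge0// ler_wpDr// ler_norm.
by elim/big_rec2 : _ => [|i a b _ ->]; rewrite ?L0 ?LD.
Qed.

Section OrthoSum.
Context {R : realType} {H : completeNormedModType R[i]}.
Variables (ip : {dot H for Num.conj}) (ip_norm : scalar_product_norm ip).
#[local] Existing Instance summability.totally_filter.

Lemma cauchy_hassum (I : choiceType) (f : I -> H) :
  (forall e : R, 0 < e -> exists A : {fset I}, forall B : {fset I},
    [disjoint A & B]%fset -> nm (\sum_(i <- B) f i) < e) ->
  exists s, hassum f s.
Proof.
move=> h; suff [s ?] : exists s : H,
    summability.partial_sum f @ summability.totally --> s by exists s.
apply: cauchy_lim => e /h[A hA].
exists (\sum_(i <- A) f i); exists A => // B AB /=.
rewrite partial_sumE.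
rewrite (big_fset_sub _ AB) addrAC subrr add0r; apply: hA.
by apply/fdisjointP => i iA; rewrite !inE /= iA.
Qed.

(** Passes between the extended-real sums of the statement and bounds on finite
    sums, in which all estimates are made. *)
Lemma esum_le_fset (I : choiceType) (a : I -> R) (c : R) :
  (forall i, 0 <= a i) ->
  ((\esum_(i in [set: I]) (a i)%:E <= c%:E)%E <->
   forall A : {fset I}, \sum_(i <- A) a i <= c).
Proof.
move=> a0; split => [h A|h].
  rewrite -lee_fin (le_trans _ h)//; apply: esum_ge.
  exists [set` A] => //; rewrite fsbig_finite//= set_fsetK sumEFin//.
apply: ge_ereal_sup => _ [X [finX _] <-].
by rewrite fsbig_finite//= sumEFin lee_fin.
Qed.

Lemma esum_tail (I : choiceType) (a : I -> R) (e : R) :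
  (forall i, 0 <= a i) -> (\esum_(i in [set: I]) (a i)%:E < +oo)%E -> 0 < e ->
  exists A : {fset I}, forall B : {fset I},
    [disjoint A & B]%fset -> \sum_(i <- B) a i < e.
Proof.
move=> a0 fin e0.
have ge0 : (0 <= \esum_(i in [set: I]) (a i)%:E)%E by apply: esum_ge0 => i _; rewrite lee_fin.
pose S := fine (\esum_(i in [set: I]) (a i)%:E).
have SE : (\esum_(i in [set: I]) (a i)%:E)%E = S%:E by rewrite fineK// ge0_fin_numE.
have hS : forall A : {fset I}, \sum_(i <- A) a i <= S.
  by apply/(esum_le_fset _ a0); rewrite SE.
have : ((S - e)%:E < \esum_(i in [set: I]) (a i)%:E)%E by rewrite SE lte_fin ltrBlDr ltrDl.
move=> /ereal_sup_gt[_ [X [finX _] <-]].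
rewrite fsbig_finite//= sumEFin lte_fin => hX.
exists (fset_set X) => B dis.
have := hS (fset_set X `|` B)%fset.
rewrite (big_fset_sub _ (fsubsetUl _ B)).
have -> : ((fset_set X `|` B) `\` fset_set X = B)%fset.
  apply/fsetP => i; rewrite !inE; case: (boolP (i \in B)) => iB; last first.
    by rewrite orbF andNb.
  by rewrite orbT andbT (fdisjointP_sym dis).
by move=> h; rewrite -(ltrD2l (\sum_(i <- fset_set X) a i)) (le_lt_trans h)// -ltrBlDr.
Qed.

(** Cauchy's criterion and the theorem of Pythagoras. *)
Lemma ortho_hassum (I : choiceType) (v : I -> H) :
  (forall i j, i != j -> ip (v i) (v j) = 0) ->
  (\esum_(i in [set: I]) (nm (v i) ^+ 2)%:E < +oo)%E ->
  exists s, hassum v s.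
Proof.
move=> o fin; apply: cauchy_hassum => e e0.
have e20 : 0 < e ^+ 2 by rewrite exprn_gt0.
have [A hA] := esum_tail (fun i => sqr_ge0 (nm (v i))) fin e20.
exists A => B /hA; rewrite -(nm2_sum_orth ip_norm) ?fset_uniq//.
by rewrite ltr_sqr// nnegrE ?nm_ge0// ltW.
Qed.

Lemma ortho_hassum_nm (I : choiceType) (v : I -> H) s :
  (forall i j, i != j -> ip (v i) (v j) = 0) -> hassum v s ->
  (\esum_(i in [set: I]) (nm (v i) ^+ 2)%:E = (nm s ^+ 2)%:E)%E.
Proof.
move=> o hs; apply/eqP; rewrite eq_le; apply/andP; split.
  apply/esum_le_fset => [i|A]; first exact: sqr_ge0.
  rewrite -(nm2_sum_orth ip_norm) ?fset_uniq// ler_sqr ?nnegrE ?nm_ge0//.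
  apply/ler_addgt0Pr => e e0.
  have /hassum_nmP/(_ e e0)[A0 hA0] := hs.
  have {}hA0 := hA0 _ (fsubsetUr A A0).
  have le1 : nm (\sum_(i <- A) v i) <= nm (\sum_(i <- (A `|` A0)%fset) v i).
    rewrite -(@ler_sqr R) ?nnegrE ?nm_ge0// !(nm2_sum_orth ip_norm) ?fset_uniq//.
    rewrite (big_fset_sub _ (fsubsetUl A A0)) lerDl sumr_ge0// => i _.
    exact: sqr_ge0.
  rewrite (le_trans le1)// -[leLHS](_ : nm (s + (\sum_(i <- (A `|` A0)%fset) v i - s)) = _).
    by rewrite (le_trans (nmD _ _))// lerD2l ltW.
  by rewrite addrC subrK.
case E : (\esum_(i in [set: I]) (nm (v i) ^+ 2)%:E)%E => [c||]; last 2 first.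
- by rewrite leey.
- have : (0 <= \esum_(i in [set: I]) (nm (v i) ^+ 2)%:E)%E.
    by apply: esum_ge0 => i _; rewrite lee_fin sqr_ge0.
  by rewrite E.
have hc : forall A : {fset I}, \sum_(i <- A) nm (v i) ^+ 2 <= c.
  by apply/esum_le_fset => [i|]; [exact: sqr_ge0|rewrite E].
have c0 : 0 <= c by have := hc fset0; rewrite big_seq_fset0.
rewrite lee_fin -(sqr_sqrtr c0) ler_sqr ?nnegrE ?nm_ge0 ?sqrtr_ge0//.
apply: hassum_le hs _ => A.
rewrite -[leLHS]ger0_norm ?nm_ge0// -sqrtr_sqr ler_wsqrtr//.
by rewrite (nm2_sum_orth ip_norm) ?fset_uniq.
Qed.

End OrthoSum.

(** * Bounded operators *)

Section Geometric.
Context {R : realType} {H : completeNormedModType R[i]}.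

Lemma geometric_small (c q e : R) : 0 <= q < 1 -> 0 < e ->
  exists N, forall n, (N <= n)%N -> c * q ^+ n < e.
Proof.
move=> /andP[q0 q1] e0.
have : geometric c q @ \oo --> (0 : R) by apply: cvg_geometric; rewrite ger0_norm.
move=> /cvgrPdist_lt/(_ _ e0)[N _ hN]; exists N => n /hN /=.
by rewrite sub0r normrN; apply: le_lt_trans; exact: ler_norm.
Qed.

(** The limit comes with the rate, which is reused for Hilbert-Schmidt norms. *)
Lemma geometric_cvg (u : nat -> H) (c q : R) : 0 <= q < 1 ->
  (forall n, nm (u n.+1 - u n) <= c * q ^+ n) ->
  exists l : H, u @ \oo --> l /\ forall n, nm (u n - l) <= c * q ^+ n / (1 - q).
Proof.
move=> q01 hu; have /andP[q0 q1] := q01.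
have p : 0 < 1 - q by rewrite subr_gt0.
have c0 : 0 <= c by have := hu 0%N; rewrite expr0 mulr1; apply: le_trans; exact: nm_ge0.
have key n m : nm (u (n + m)%N - u n) <= c * q ^+ n / (1 - q).
  suff h : nm (u (n + m)%N - u n) <= c * q ^+ n / (1 - q) * (1 - q ^+ m).
    rewrite (le_trans h)// ler_piMr// ?mulr_ge0 ?exprn_ge0 ?invr_ge0 ?(ltW p)//.
    by rewrite lerBlDr lerDl exprn_ge0.
  elim: m => [|m IH]; first by rewrite addn0 subrr nm0 expr0 subrr mulr0.
  rewrite (le_trans (nm_dist (u (n + m)%N) _ _))// addnS (le_trans (lerD (hu _) IH))//.
  rewrite exprD exprS le_eqVlt; apply/orP; left; apply/eqP.
  by field; rewrite gt_eqF.
have [|l ul] := @cauchy_lim _ _ _ \oo _ u.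
  move=> e e0; have [N hN] := geometric_small (c / (1 - q)) q01 e0.
  exists (u N), N => // n /= Nn; rewrite -(subnKC Nn) (le_lt_trans (key _ _))//.
  by rewrite mulrAC hN.
exists l; split => // n.
apply: (@nm_lim_le _ _ _ \oo _ (fun m => u n - u m)).
  by apply: cvgB => //; exact: cvg_cst.
by exists n => // m /= nm'; rewrite -(subnKC nm') nmB key.
Qed.

End Geometric.

Section Bounded.
Context {R : realType} {H : completeNormedModType R[i]}.
Implicit Types (X Y T : H -> H) (x y : H).

Lemma add_opE X Y x : (X + Y) x = X x + Y x. Proof. by []. Qed.
Lemma opp_opE X x : (- X) x = - X x. Proof. by []. Qed.
Lemma sub_opE X Y x : (X - Y) x = X x - Y x. Proof. by []. Qed.
Lemma scale_opE a X x : (a *: X) x = a *: X x. Proof. by []. Qed.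
Lemma zero_opE x : (0 : H -> H) x = 0. Proof. by []. Qed.
Definition opE := (add_opE, sub_opE, opp_opE, scale_opE, zero_opE).

Lemma boP X (bX : bounded_op X) a x y : X (a *: x + y) = a *: X x + X y.
Proof. by case: bX => l _; exact: l. Qed.
Lemma boD X (bX : bounded_op X) x y : X (x + y) = X x + X y.
Proof. by have := boP bX 1 x y; rewrite !scale1r. Qed.
Lemma bo0 X (bX : bounded_op X) : X 0 = 0.
Proof. by apply: (addrI (X 0)); rewrite -(boD bX) !addr0. Qed.
Lemma boZ X (bX : bounded_op X) a x : X (a *: x) = a *: X x.
Proof. by rewrite -[a *: x]addr0 (boP bX) (bo0 bX) addr0. Qed.
Lemma boN X (bX : bounded_op X) x : X (- x) = - X x.
Proof. by rewrite -scaleN1r (boZ bX) scaleN1r. Qed.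
Lemma boB X (bX : bounded_op X) x y : X (x - y) = X x - X y.
Proof. by rewrite (boD bX) (boN bX). Qed.
Lemma bo_sumE X (bX : bounded_op X) (I : Type) (r : seq I) (Q : pred I) (F : I -> H) :
  X (\sum_(i <- r | Q i) F i) = \sum_(i <- r | Q i) X (F i).
Proof. by elim/big_rec2 : _ => [|i a b _ <-]; rewrite ?(bo0 bX) ?(boD bX). Qed.

Lemma bo_bound X : bounded_op X -> exists2 c, 0 <= c & forall x, nm (X x) <= c * nm x.
Proof.
move=> [_ [c hc]]; exists `|c| => // x.
by rewrite (le_trans (hc x))// ler_wpM2r ?nm_ge0// ler_norm.
Qed.

Lemma bo_intro X (c : R) : (forall a x y, X (a *: x + y) = a *: X x + X y) ->
  (forall x, nm (X x) <= c * nm x) -> bounded_op X.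
Proof. by move=> l b; split=> [a x y|]; [exact: l|exists c]. Qed.

Lemma bo_id : bounded_op (idfun : H -> H).
Proof. by apply: (@bo_intro _ 1) => // x; rewrite mul1r. Qed.

Lemma bo_zero : bounded_op (0 : H -> H).
Proof.
apply: (@bo_intro _ 0) => [a x y|x]; rewrite !opE ?scaler0 ?addr0//.
by rewrite nm0 mul0r.
Qed.

Lemma bo_add X Y : bounded_op X -> bounded_op Y -> bounded_op (X + Y).
Proof.
move=> bX bY; have [c _ hc] := bo_bound bX; have [d _ hd] := bo_bound bY.
apply: (@bo_intro _ (c + d)) => [a x y|x]; rewrite !opE.
  by rewrite (boP bX) (boP bY) scalerDr addrACA.
by rewrite (le_trans (nmD _ _))// mulrDl lerD.
Qed.

Lemma bo_scale a X : bounded_op X -> bounded_op (a *: X).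
Proof.
move=> bX; have [c _ hc] := bo_bound bX.
apply: (@bo_intro _ (nm a * c)) => [b x y|x]; rewrite !opE.
  by rewrite (boP bX) scalerDr !scalerA mulrC.
by rewrite nmZ -mulrA ler_wpM2l ?nm_ge0.
Qed.

Lemma bo_opp X : bounded_op X -> bounded_op (- X).
Proof. by move=> bX; rewrite -scaleN1r; exact: bo_scale. Qed.

Lemma bo_sub X Y : bounded_op X -> bounded_op Y -> bounded_op (X - Y).
Proof. by move=> bX bY; apply: bo_add => //; exact: bo_opp. Qed.

Lemma bo_comp X Y : bounded_op X -> bounded_op Y -> bounded_op (X \o Y).
Proof.
move=> bX bY; have [c c0 hc] := bo_bound bX; have [d _ hd] := bo_bound bY.
apply: (@bo_intro _ (c * d)) => [a x y|x] /=; first by rewrite !boP.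
by rewrite (le_trans (hc _))// -mulrA ler_wpM2l.
Qed.

Lemma bo_sum (I : Type) (r : seq I) (Q : pred I) (F : I -> H -> H) :
  (forall i, Q i -> bounded_op (F i)) -> bounded_op (\sum_(i <- r | Q i) F i).
Proof.
by move=> h; elim/big_ind : _ => [||//]; [exact: bo_zero|exact: bo_add].
Qed.

Lemma bo_iter n X : bounded_op X -> bounded_op (iter n X).
Proof.
move=> bX; elim: n => [|n IH]; first exact: bo_id.
by rewrite (_ : iter n.+1 X = X \o iter n X)//; exact: bo_comp.
Qed.

Lemma fct_sumE (I : Type) (r : seq I) (Q : pred I) (F : I -> H -> H) x :
  (\sum_(i <- r | Q i) F i) x = \sum_(i <- r | Q i) F i x.
Proof. by elim/big_rec2 : _ => [//|i a b _ <-]. Qed.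

Lemma bo_hassum (I : choiceType) X (f : I -> H) s :
  bounded_op X -> hassum f s -> hassum (fun i => X (f i)) (X s).
Proof.
move=> bX; have [c _ hc] := bo_bound bX; apply: (hassum_map (c := c)) => //.
by move=> x y; exact: (boB bX).
Qed.

Lemma bo_cvg (T : Type) (F : set_system T) (FF : Filter F) X (f : T -> H) l :
  bounded_op X -> f @ F --> l -> (fun t => X (f t)) @ F --> X l.
Proof.
move=> bX /cvg_nmP h; have [c c0 hc] := bo_bound bX; apply/cvg_nmP => e e0.
have p : 0 < c + 1 by rewrite ltr_wpDl.
have /h : 0 < e / (c + 1) by rewrite divr_gt0.
apply: filterS => t; rewrite ltr_pdivlMr// => ht.
rewrite -(boB bX) (le_lt_trans (hc _))// (le_lt_trans _ ht)// mulrC.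
by rewrite ler_wpM2l ?nm_ge0// lerDl.
Qed.

Lemma opnorm_set_sup X : bounded_op X ->
  has_sup [set nm (X x) | x in [set x | nm x <= 1]].
Proof.
move=> bX; have [c c0 hc] := bo_bound bX; split.
  by exists (nm (X 0)); exists 0 => //=; rewrite nm0.
exists c => _ [x /= x1 <-]; rewrite (le_trans (hc x))//.
by rewrite ler_piMr.
Qed.

Lemma opnorm_ge0 X : bounded_op X -> 0 <= opnorm X.
Proof.
move=> bX; apply: (@le_trans _ _ (nm (X 0))); first exact: nm_ge0.
by apply: ub_le_sup; [case: (opnorm_set_sup bX)|exists 0 => //=; rewrite nm0].
Qed.

Lemma opnormP X x : bounded_op X -> nm (X x) <= opnorm X * nm x.
Proof.
move=> bX; have [->|x0] := eqVneq x 0; first by rewrite (bo0 bX) nm0 mulr0.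
have p : 0 < nm x by rewrite lt_def nm_eq0 x0 nm_ge0.
rewrite -ler_pdivrMr// mulrC.
have e : nm (((nm x)^-1)%:C *: X x) = (nm x)^-1 * nm (X x).
  by rewrite nmZ nmC ger0_norm// invr_ge0 ltW.
rewrite -e -(boZ bX); apply: ub_le_sup; first by case: (opnorm_set_sup bX).
exists (((nm x)^-1)%:C *: x) => //=.
by rewrite nmZ nmC ger0_norm ?invr_ge0 ?(ltW p)// mulVf// gt_eqF.
Qed.

Lemma opnorm_le X c : 0 <= c -> (forall x, nm (X x) <= c * nm x) -> opnorm X <= c.
Proof.
move=> c0 hc; apply: ge_sup.
  by exists (nm (X 0)); exists 0 => //=; rewrite nm0.
move=> _ [x /= x1 <-]; rewrite (le_trans (hc x))//.
by rewrite ler_piMr.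
Qed.

(** Neumann series, under a bound on the iterates that lets the operator be a
    contraction for an equivalent norm only. *)
Lemma neumann T (c q : R) : bounded_op T -> 0 <= q < 1 ->
  (forall n x, nm (iter n T x) <= c * q ^+ n * nm x) ->
  exists Y, is_inverse (idfun + T) Y.
Proof.
move=> bT q01 hT.
pose u x n := \sum_(j < n) (-1) ^+ j *: iter j T x.
have uS x n : u x n.+1 - u x n = (-1) ^+ n *: iter n T x.
  by rewrite /u big_ord_recr /= addrAC subrr add0r.
have hu x n : nm (u x n.+1 - u x n) <= (c * nm x) * q ^+ n.
  by rewrite uS nmZ nmX nmN nm1 expr1n mul1r mulrAC hT.
have ex x : exists l, u x @ \oo --> l /\
    forall n, nm (u x n - l) <= (c * nm x) * q ^+ n / (1 - q).
  exact: (geometric_cvg q01 (hu x)).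
pose Y x := projT1 (cid (ex x)).
have Yc x : u x @ \oo --> Y x by have [] := projT2 (cid (ex x)).
have Yb x : nm (Y x) <= (c / (1 - q)) * nm x.
  have [_ /(_ 0%N)] := projT2 (cid (ex x)).
  by rewrite {1}/u big_ord0 sub0r nmN expr0 mulr1 mulrAC.
have uT x n : u x n + T (u x n) = x - (-1) ^+ n *: iter n T x.
  elim: n => [|n IH]; first by rewrite /u big_ord0 (bo0 bT) addr0 expr0 scale1r subrr.
  have -> : u x n.+1 = u x n + (-1) ^+ n *: iter n T x by rewrite /u big_ord_recr.
  rewrite (boD bT) (boZ bT) addrACA IH exprS mulN1r scaleNr opprK.
  by rewrite addrA subrK.
have Tu x n : u (x + T x) n = u x n + T (u x n).
  rewrite /u (bo_sumE bT) -big_split /=; apply: eq_bigr => j _.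
  by rewrite (boD (bo_iter j bT)) (boZ bT) -iterSr iterS scalerDr.
have small x : (fun n => (-1) ^+ n *: iter n T x) @ \oo --> (0 : H).
  apply/cvg_nmP => e e0; have [N hN] := geometric_small (c * nm x) q01 e0.
  exists N => // n /hN; apply: le_lt_trans.
  by rewrite subr0 nmZ nmX nmN nm1 expr1n mul1r mulrAC hT.
have YK : cancel Y (idfun + T).
  move=> x; rewrite opE /=.
  apply: (@lim_unique _ _ _ \oo _ (fun n => u x n + T (u x n))).
    by apply: cvgD => //; exact: bo_cvg.
  rewrite -[X in _ --> X]subr0.
  have -> : (fun n => u x n + T (u x n)) = (fun n => x - (-1) ^+ n *: iter n T x).
    by apply/funext => n; exact: uT.
  by apply: cvgB => //; exact: cvg_cst.
have KY : cancel (idfun + T) Y.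
  move=> x; rewrite opE /=.
  apply: (@lim_unique _ _ _ \oo _ (u (x + T x))) => //.
  rewrite -[X in _ --> X]subr0.
  have -> : u (x + T x) = (fun n => x - (-1) ^+ n *: iter n T x).
    by apply/funext => n; rewrite Tu uT.
  by apply: cvgB => //; exact: cvg_cst.
exists Y; split => //; apply: (bo_intro _ Yb) => a x y.
have inj : injective (idfun + T) := can_inj KY.
have bI : bounded_op (idfun + T) by apply: bo_add => //; exact: bo_id.
by apply: inj; rewrite YK (boP bI) !YK.
Qed.

Lemma neumann_small T (q : R) : bounded_op T -> 0 <= q < 1 ->
  (forall x, nm (T x) <= q * nm x) -> exists Y, is_inverse (idfun + T) Y.
Proof.
move=> bT q01 h; apply: (@neumann _ 1 q) => // n x; rewrite mul1r.
elim: n => [|n IH]; first by rewrite expr0 mul1r.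
rewrite iterS (le_trans (h _))// exprS -mulrA ler_wpM2l//.
by case/andP: q01.
Qed.

Lemma inv_opP (W : H -> H) : cont_invertible W -> is_inverse W (inv_op W).
Proof. by move=> [_ ex]; exact: (xgetPex _ ex). Qed.

End Bounded.

(** * Operators and their matrices *)

Definition irange (N : nat) : seq int :=
  [seq i%:Z - N%:Z | i <- iota 0 (2 * N).+1].

Lemma mem_irange N (n : int) : (n \in irange N) = (`|n| <= N)%N.
Proof.
apply/mapP/idP => [[i + ->]|h].
  by rewrite mem_iota add0n leq0n /= => ilt; lia.
exists (absz (n + N%:Z)); last by lia.
by rewrite mem_iota; lia.
Qed.

Lemma irange_uniq N : uniq (irange N).
Proof. by rewrite map_inj_uniq ?iota_uniq// => i j; lia. Qed.

Lemma sum_irange (V : nmodType) (f : int -> V) N :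
  \sum_(i < (2 * N).+1) f (i%:Z - N%:Z) = \sum_(n <- irange N) f n.
Proof.
rewrite /irange big_map -(big_mkord xpredT (fun i : nat => f (i%:Z - N%:Z))).
by rewrite /index_iota subn0.
Qed.

Section Resolution.
Context {R : realType} {H : completeNormedModType R[i]}.
Variables (ip : {dot H for Num.conj}) (ip_norm : scalar_product_norm ip).
Variables (P : int -> H -> H) (resP : resolution_of_identity ip P).
Implicit Types (x y : H) (X Y : H -> H) (i j n : int) (m k N : nat).
#[local] Existing Instance summability.totally_filter.

Lemma P_bo n : bounded_op (P n).
Proof. by case: resP => [[h _ _ _] _]; exact: h. Qed.

Lemma PP i j x : P i (P j x) = if i == j then P i x else 0.
Proof.
case: resP => [[_ idem orth _] _]; case: eqVneq => [->|/eqP ij].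
  exact: (congr1 (fun f => f x) (idem j)).
exact: (congr1 (fun f => f x) (orth i j ij)).
Qed.

Lemma P_idem n x : P n (P n x) = P n x.
Proof. by rewrite PP eqxx. Qed.

Lemma P_sa n x y : ip (P n x) y = ip x (P n y).
Proof. by case: resP => [_ /(_ n)[_ sa]]; exact: sa. Qed.

Lemma P_hassum x : hassum (fun n => P n x) x.
Proof. by case: resP => [[_ _ _ h] _]; constructor; exact: h. Qed.

Lemma P_ext x y : (forall n, P n x = P n y) -> x = y.
Proof.
move=> h; apply: (hassum_unique (P_hassum x)).
by rewrite (funext h); exact: P_hassum.
Qed.

Lemma ip_PP i j x y : i != j -> ip (P i x) (P j y) = 0.
Proof. by move=> ij; rewrite P_sa PP (negbTE ij) ip0r. Qed.

Lemma P_sq x : (\esum_(n in [set: int]) (nm (P n x) ^+ 2)%:E = (nm x ^+ 2)%:E)%E.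
Proof. by apply: ortho_hassum_nm (P_hassum x) => // i j; exact: ip_PP. Qed.

Lemma P_le n x : nm (P n x) <= nm x.
Proof.
rewrite -(@ler_sqr R) ?nnegrE ?nm_ge0// -lee_fin -(P_sq x).
apply: esum_ge; exists [set n]; first by split.
by rewrite fsbig_set1.
Qed.

(** Norms are compared coordinate by coordinate, by Parseval. *)
Lemma P_dominated (c : R) x y : 0 <= c ->
  (forall n, nm (P n x) <= c * nm (P n y)) -> nm x <= c * nm y.
Proof.
move=> c0 h; rewrite -(@ler_sqr R) ?nnegrE ?mulr_ge0 ?nm_ge0//.
rewrite -lee_fin -P_sq; apply/esum_le_fset => [n|A]; first exact: sqr_ge0.
have hA : \sum_(n <- A) nm (P n y) ^+ 2 <= nm y ^+ 2.
  by move: A; apply/esum_le_fset => [n|]; [exact: sqr_ge0|rewrite P_sq].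
rewrite exprMn (le_trans _ (ler_wpM2l (sqr_ge0 c) hA))// mulr_sumr.
by apply: ler_sum => n _; rewrite -exprMn ler_sqr ?nnegrE ?mulr_ge0 ?nm_ge0.
Qed.

(** Orthogonal coordinates can be prescribed freely, subject to square
    summability. *)
Lemma assemble (y : int -> H) : (forall n, P n (y n) = y n) ->
  (\esum_(n in [set: int]) (nm (y n) ^+ 2)%:E < +oo)%E ->
  exists2 s, hassum y s & forall n, P n s = y n.
Proof.
move=> Py fin; have [|s ys] := ortho_hassum ip_norm (v := y) _ fin.
  by move=> i j ij; rewrite -(Py i) -(Py j); exact: ip_PP.
exists s => // n; apply: hassum_unique (bo_hassum (P_bo n) ys) _.
rewrite (_ : (fun i => _) = fun i => if i == n then y n else 0); last first.
  by apply/funext => i; rewrite -(Py i) PP eq_sym; case: eqVneq => [->|//]; rewrite Py.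
have := @hassum_fin _ _ _ (fun i => if i == n then y n else 0) [fset n]%fset.
rewrite big_seq_fset1 eqxx; apply => i; rewrite inE => /negbTE -> //.
Qed.

(** At every vector the rows are orthogonal, so they are the coordinates of one
    vector; the bound is Parseval. *)
Lemma op_of_rows (T : int -> H -> H) (c : R) : 0 <= c ->
  (forall n a x y, T n (a *: x + y) = a *: T n x + T n y) ->
  (forall n x, P n (T n x) = T n x) ->
  (forall x, \esum_(n in [set: int]) (nm (T n x) ^+ 2)%:E <= (c ^+ 2 * nm x ^+ 2)%:E)%E ->
  exists X, [/\ bounded_op X, forall x, nm (X x) <= c * nm x,
    forall x, hassum (T^~ x) (X x) & forall n x, P n (X x) = T n x].
Proof.
move=> c0 Tlin PT Tc.
have ex x : exists s, hassum (T^~ x) s /\ forall n, P n s = T n x.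
  have [//||s h1 h2] := @assemble (T^~ x); last by exists s.
  by rewrite (le_lt_trans (Tc x))// ltry.
pose X x := projT1 (cid (ex x)).
have Xs x : hassum (T^~ x) (X x) by have [] := projT2 (cid (ex x)).
have XP n x : P n (X x) = T n x by have [_ ->] := projT2 (cid (ex x)).
have Xc x : nm (X x) <= c * nm x.
  rewrite -(@ler_sqr R) ?nnegrE ?mulr_ge0 ?nm_ge0// exprMn -lee_fin -P_sq.
  by rewrite (le_trans _ (Tc x))//; apply: le_esum => n _; rewrite XP.
exists X; split => //; apply: (bo_intro _ Xc) => a x y.
by apply: P_ext => n; rewrite (boP (P_bo n)) !XP.
Qed.

Lemma diag_op (mu : int -> R[i]) (c : R) : 0 <= c -> (forall n, nm (mu n) <= c) ->
  exists D, [/\ bounded_op D, forall x, nm (D x) <= c * nm x &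
    forall n x, P n (D x) = mu n *: P n x].
Proof.
move=> c0 hmu.
have [||x|D [bD Dc _ DP]] := @op_of_rows (fun n x => mu n *: P n x) c c0.
- by move=> n a x y; rewrite (boP (P_bo n)) scalerDr !scalerA mulrC.
- by move=> n x; rewrite (boZ (P_bo n)) P_idem.
- have h : forall A : {fset int}, \sum_(n <- A) nm (P n x) ^+ 2 <= nm x ^+ 2.
    by apply/esum_le_fset => [n|]; [exact: sqr_ge0|rewrite P_sq].
  apply/esum_le_fset => [n|A]; first exact: sqr_ge0.
  rewrite (le_trans _ (ler_wpM2l (sqr_ge0 c) (h A)))// mulr_sumr.
  apply: ler_sum => n _; rewrite nmZ exprMn ler_wpM2r ?sqr_ge0//.
  by rewrite ler_sqr ?nnegrE ?nm_ge0.
- by exists D.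
Qed.

Lemma PblockE N x : Pblock P N x = \sum_(n <- irange N) P n x.
Proof. by rewrite -sum_irange /Pblock fct_sumE. Qed.

Lemma Pb_bo N : bounded_op (Pblock P N).
Proof. by apply: bo_sum => i _; exact: P_bo. Qed.

Lemma P_Pb n N x : P n (Pblock P N x) = if (`|n| <= N)%N then P n x else 0.
Proof.
rewrite PblockE (bo_sumE (P_bo n)) -mem_irange; case: ifPn => h.
  rewrite (bigD1_seq n) ?irange_uniq//= P_idem big1 ?addr0// => i /negbTE.
  by rewrite PP eq_sym => ->.
by rewrite big_seq big1// => i iN; rewrite PP; case: eqP iN h => // -> ->.
Qed.

Lemma Pb_P n N x : Pblock P N (P n x) = if (`|n| <= N)%N then P n x else 0.
Proof.
apply: P_ext => i; rewrite P_Pb !PP; case: eqVneq => [->|ne].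
  by case: ifP => _; rewrite ?P_idem ?(bo0 (P_bo n)).
by case: ifP => _; case: ifP => _; rewrite ?PP ?(negbTE ne) ?(bo0 (P_bo i)).
Qed.

Lemma Pb_Pb N N' x : (N <= N')%N -> Pblock P N' (Pblock P N x) = Pblock P N x.
Proof.
move=> NN'; apply: P_ext => i; rewrite !P_Pb; case: ifP => //.
by case: ifP => // h /negP[]; exact: leq_trans NN'.
Qed.

Lemma Pb_Pb' N N' x : (N <= N')%N -> Pblock P N (Pblock P N' x) = Pblock P N x.
Proof.
move=> NN'; apply: P_ext => i; rewrite !P_Pb; case: ifP => //.
by move=> h; rewrite (leq_trans h NN').
Qed.

Lemma Pb_sa N x y : ip (Pblock P N x) y = ip x (Pblock P N y).
Proof. by rewrite !PblockE ip_suml ip_sumr; apply: eq_bigr => i _; rewrite P_sa. Qed.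

Lemma Pb_compl_le N x : nm (x - Pblock P N x) <= nm x.
Proof.
rewrite -[leRHS]mul1r; apply: P_dominated => // n; rewrite mul1r (boB (P_bo n)) P_Pb.
by case: ifP => // _; rewrite ?subrr ?subr0// nm0 nm_ge0.
Qed.

Lemma fset_irange (A : {fset int}) : exists N, forall n, n \in A -> (`|n| <= N)%N.
Proof.
exists (\max_(n <- A) `|n|)%N => n nA.
by rewrite (big_fsetD1 n)//= leq_maxl.
Qed.

Lemma Pb_cvg x : (fun N => Pblock P N x) @ \oo --> x.
Proof.
apply/cvg_nmP => e e0; have /hassum_nmP/(_ _ e0)[A hA] := P_hassum x.
have [N0 hN] := fset_irange A; exists N0 => // N /= NN.
pose F := seq_fset tt (irange N).
have : (A `<=` F)%fset.
  by apply/fsubsetP => n /hN h; rewrite seq_fsetE mem_irange (leq_trans h).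
move=> /hA; rewrite PblockE.
rewrite (_ : \sum_(n <- F) _ = \sum_(n <- irange N) P n x)//.
apply: perm_big; apply: uniq_perm; rewrite ?fset_uniq ?irange_uniq// => n.
by rewrite seq_fsetE.
Qed.

Lemma entryE X i j x : entry P X i j x = P i (X (P j x)).
Proof. by []. Qed.

(** Both sides are determined on each P j, and the P j sum to the identity. *)
Lemma entry_inj X Y : bounded_op X -> bounded_op Y ->
  (forall i j, entry P X i j = entry P Y i j) -> X = Y.
Proof.
move=> bX bY h; apply/funext => x; apply: P_ext => i.
have hX := bo_hassum (bo_comp (P_bo i) bX) (P_hassum x).
apply: hassum_unique hX _.
rewrite (_ : (fun _ => _) = fun j => (P i \o Y) (P j x)).
  exact: (bo_hassum (bo_comp (P_bo i) bY) (P_hassum x)).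
by apply/funext => j; exact: (congr1 (fun f => f x) (h i j)).
Qed.

Lemma of_matrixE (M : int -> int -> H -> H) X : bounded_op X ->
  (forall i j, entry P X i j = M i j) -> of_matrix P M = X.
Proof.
move=> bX hX; have ex : exists X, [set X | bounded_op X /\ forall i j, entry P X i j = M i j] X.
  by exists X.
have [b h] := xgetPex 0 ex; apply: entry_inj => // i j.
by rewrite h hX.
Qed.

Definition blk m i j := ((`|i| <= m) && (`|j| <= m))%N || (i == j).

Lemma blk_diag m i : blk m i i.
Proof. by rewrite /blk eqxx orbT. Qed.

Lemma blk_sub m k i j : (m <= k)%N -> blk m i j -> blk k i j.
Proof. by rewrite /blk => mk /orP[/andP[h1 h2]|->]; rewrite ?orbT// !(leq_trans _ mk). Qed.

Definition block_bounded X := [/\ forall n, bounded_op (X \o P n),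
  forall N x, X (Pblock P N x) = \sum_(n <- irange N) X (P n x) &
  exists2 c : R, 0 <= c & forall n x, nm (P n (X (P n x))) <= c * nm (P n x)].

Lemma bo_block_bounded X : bounded_op X -> block_bounded X.
Proof.
move=> bX; split => [n|N x|]; first exact: bo_comp (P_bo n).
  by rewrite PblockE (bo_sumE bX).
have [c c0 hc] := bo_bound bX; exists c => // n x.
by rewrite (le_trans (P_le _ _)).
Qed.

(** Block-bounded operators are what makes J_m meaningful for the unbounded B:
    the central block is a finite sum of bounded operators and the remaining
    diagonal is a bounded diagonal of blocks. *)
Lemma Jt_spec m X : block_bounded X -> bounded_op (Jt P m X) /\
  forall i j, entry P (Jt P m X) i j = if blk m i j then entry P X i j else 0.
Proof.
move=> [bXP XPb [c c0 hc]].
have bXPx n x : P n (X (P n x)) = (P n \o (X \o P n)) x by [].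
have X0 : X 0 = 0 by have := bo0 (bXP 0); rewrite /= (bo0 (P_bo 0)).
pose T n x := if (m < `|n|)%N then P n (X (P n x)) else 0.
have [|||D [bD _ Ds DP]] := @op_of_rows T c c0.
- move=> n a x y; rewrite /T; case: ifP => _; rewrite ?scaler0 ?addr0//.
  by rewrite !bXPx (boP (bo_comp (P_bo n) (bXP n))).
- by move=> n x; rewrite /T; case: ifP => _; rewrite ?P_idem// (bo0 (P_bo n)).
- move=> x; have h : forall A : {fset int}, \sum_(n <- A) nm (P n x) ^+ 2 <= nm x ^+ 2.
    by apply/esum_le_fset => [n|]; [exact: sqr_ge0|rewrite P_sq].
  apply/esum_le_fset => [n|A]; first exact: sqr_ge0.
  rewrite (le_trans _ (ler_wpM2l (sqr_ge0 c) (h A)))// mulr_sumr.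
  apply: ler_sum => n _; rewrite -exprMn ler_sqr ?nnegrE ?nm_ge0 ?mulr_ge0 ?nm_ge0//.
  by rewrite /T; case: ifP => _; rewrite ?hc// nm0 mulr_ge0 ?nm_ge0.
have JE : Jt P m X = (Pblock P m \o X \o Pblock P m) + D.
  congr (_ + _); apply/funext => x; apply: hassum_lim.
  by rewrite (_ : (fun i => _) = T^~ x)//; apply/funext => n; rewrite /T; case: ifP.
have bXb : bounded_op (X \o Pblock P m).
  rewrite (_ : X \o _ = \sum_(n <- irange m) (X \o P n)); first by apply: bo_sum.
  by apply/funext => x; rewrite fct_sumE /= XPb.
have bb : bounded_op (Pblock P m \o X \o Pblock P m).
  exact: (bo_comp (Pb_bo m) bXb).
rewrite JE; split; first exact: bo_add.
move=> i j; apply/funext => x; rewrite entryE opE /= (boD (P_bo i)) DP P_Pb Pb_P /T /blk.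
rewrite PP; case: (eqVneq i j) => [<-|ij].
  rewrite orbT; case: (leqP (absz i) m) => hi /=; last by rewrite add0r entryE.
  by rewrite addr0 entryE.
rewrite orbF X0 (bo0 (P_bo i)).
by case: (leqP (absz i) m) => hi; case: (leqP (absz j) m) => hj /=;
  rewrite ?addr0 ?X0 ?(bo0 (P_bo i)).
Qed.

End Resolution.

(** * Bessel, Parseval and Riesz *)

Section RealSums.
Context {R : realType}.

Lemma esum_pair (I J : choiceType) (a : I -> J -> \bar R) :
  (forall i j, 0 <= a i j)%E ->
  (\esum_(i in [set: I]) \esum_(j in [set: J]) a i j =
   \esum_(k in [set: I * J]) a k.1 k.2)%E.
Proof.
move=> a0; rewrite (@esum_esum _ _ _ _ (fun=> setT) a)//.
by congr esum; apply/seteqP; split.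
Qed.

Lemma esum_swap (I J : choiceType) (a : I -> J -> \bar R) :
  (forall i j, 0 <= a i j)%E ->
  (\esum_(i in [set: I]) \esum_(j in [set: J]) a i j =
   \esum_(j in [set: J]) \esum_(i in [set: I]) a i j)%E.
Proof.
move=> a0; rewrite !esum_pair//.
rewrite (@reindex_esum _ _ _ [set: J * I] [set: I * J] (fun k => (k.2, k.1)))//.
split => //; first by move=> [x y] [x' y'] _ _ [-> ->].
by move=> [x y] _; exists (y, x).
Qed.

Lemma esum_single (I : choiceType) (a : I -> R) (i0 : I) : 
  (forall i, i != i0 -> a i = 0) -> 0 <= a i0 ->
  (\esum_(i in [set: I]) (a i)%:E = (a i0)%:E)%E.
Proof.
move=> h h0; rewrite -(@esum_set1 R I i0 (fun i => (a i)%:E)) ?lee_fin//.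
rewrite [RHS]esum_mkcond; apply: eq_esum => i _.
case: ifPn => //; rewrite in_set1 => ne; by rewrite h.
Qed.

Lemma cauchy_schwarz_fin (I : Type) (r : seq I) (a b : I -> R) (al be : R) :
  (forall i, 0 <= a i) -> (forall i, 0 <= b i) -> 0 <= al -> 0 <= be ->
  \sum_(i <- r) a i ^+ 2 <= al ^+ 2 -> \sum_(i <- r) b i ^+ 2 <= be ^+ 2 ->
  \sum_(i <- r) a i * b i <= al * be.
Proof.
move=> a0 b0 al0 be0 ha hb; apply/ler_addgt0Pr => eps eps0.
(* weights shifted by d > 0 avoid the case distinction on al = 0 *)
have [d d0 hd] : exists2 d : R, 0 < d & (al + d) * (be + d) <= al * be + eps.
  pose d := Num.min 1 (eps / (al + be + 1)).
  have p : 0 < al + be + 1 by rewrite ltr_wpDl ?addr_ge0.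
  have d0 : 0 < d by rewrite lt_min ltr01 divr_gt0.
  exists d => //; have d1 : d <= 1 by rewrite ge_min lexx.
  have d2 : d * (al + be + 1) <= eps by rewrite -ler_pdivlMr// ge_min lexx orbT.
  have : d * d <= d by rewrite ler_piMr// ltW.
  nra.
have p1 : 0 < al + d by rewrite ltr_wpDl.
have p2 : 0 < be + d by rewrite ltr_wpDl.
apply: le_trans hd.
pose t := (be + d) / (al + d).
have t0 : 0 < t by rewrite divr_gt0.
have step i : a i * b i <= (t * a i ^+ 2 + t^-1 * b i ^+ 2) / 2.
  have : 0 <= (t * a i - b i) ^+ 2 / t by rewrite divr_ge0 ?sqr_ge0 ?ltW.
  rewrite (_ : _ / t = t * a i ^+ 2 + t^-1 * b i ^+ 2 - a i * b i *+ 2); first lra.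
  by field; rewrite gt_eqF.
rewrite (le_trans (ler_sum _ (fun i _ => step i)))// -mulr_suml big_split /= -!mulr_sumr.
have ha' : \sum_(i <- r) a i ^+ 2 <= (al + d) ^+ 2.
  by rewrite (le_trans ha)// ler_sqr ?nnegrE ?lerDl ?(ltW d0) ?(ltW p1).
have hb' : \sum_(i <- r) b i ^+ 2 <= (be + d) ^+ 2.
  by rewrite (le_trans hb)// ler_sqr ?nnegrE ?lerDl ?(ltW d0) ?(ltW p2).
rewrite ler_pdivrMr// (le_trans (lerD (ler_wpM2l (ltW t0) ha') (ler_wpM2l _ hb')))//.
  by rewrite invr_ge0 ltW.
rewrite le_eqVlt; apply/orP; left; apply/eqP; rewrite /t.
by field; rewrite !gt_eqF.
Qed.

End RealSums.

Section Parseval.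
Context {R : realType} {H : completeNormedModType R[i]}.
Variables (ip : {dot H for Num.conj}) (ip_norm : scalar_product_norm ip).

Lemma nm_unit e : ip e e = 1 -> nm e = 1.
Proof.
move=> h; have : nm e ^+ 2 = 1 by apply: complexI; rewrite -(ip_nm ip_norm) h.
by move/eqP; rewrite sqrf_eq1 => /orP[/eqP //|/eqP h1]; have := nm_ge0 e; rewrite h1; lra.
Qed.

Variables (I : choiceType) (e : I -> H).
Hypothesis (e_orth : forall i j, i != j -> ip (e i) (e j) = 0).
Hypothesis (e_unit : forall i, e i = 0 \/ ip (e i) (e i) = 1).

Lemma nm_coef x i : nm (ip x (e i) *: e i) = nm (ip x (e i)).
Proof.
by rewrite nmZ; case: (e_unit i) => [->|/nm_unit ->]; rewrite ?ip0r ?nm0 ?mulr0 ?mulr1.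
Qed.

Lemma ip_partial x i (A : {fset I}) : i \in A ->
  ip (\sum_(j <- A) ip x (e j) *: e j) (e i) = ip x (e i).
Proof.
move=> iA; rewrite ip_suml (big_fsetD1 i)//= big1_seq => [|j].
  rewrite ipZl; case: (e_unit i) => ->; first by rewrite !ip0r mul0r addr0.
  by rewrite mulr1 addr0.
by rewrite !inE => /andP[_ /andP[ji _]]; rewrite ipZl e_orth// mulr0.
Qed.

Lemma bessel x (A : {fset I}) : \sum_(i <- A) nm (ip x (e i)) ^+ 2 <= nm x ^+ 2.
Proof.
pose y := \sum_(i <- A) ip x (e i) *: e i.
have yn : nm y ^+ 2 = \sum_(i <- A) nm (ip x (e i)) ^+ 2.
  rewrite (nm2_sum_orth ip_norm) ?fset_uniq//.
    by apply: eq_bigr => i _; rewrite nm_coef.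
  by move=> i j ij; rewrite ipZl ipZr e_orth// !mulr0.
have o : ip (x - y) y = 0.
  rewrite {2}/y ip_sumr big1_seq// => i /andP[_ iA].
  by rewrite ipZr ipBl /y ip_partial// subrr mulr0.
have -> : nm x ^+ 2 = nm (x - y) ^+ 2 + nm y ^+ 2.
  by rewrite -(nm2D_orth ip_norm o) subrK.
by rewrite -yn lerDr sqr_ge0.
Qed.

Hypothesis (e_total : forall x, (forall i, ip x (e i) = 0) -> x = 0).

(** The sum exists by orthogonality, and it is x because the difference is
    orthogonal to every e i. *)
Lemma frame_hassum x : hassum (fun i => ip x (e i) *: e i) x.
Proof.
have [||s hs] := @ortho_hassum _ _ ip ip_norm I (fun i => ip x (e i) *: e i).
- by move=> i j ij; rewrite ipZl ipZr e_orth// !mulr0.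
- apply: (@le_lt_trans _ _ (nm x ^+ 2)%:E); last by rewrite ltry.
  apply/esum_le_fset => [i|A]; first exact: sqr_ge0.
  by under eq_bigr do rewrite nm_coef; exact: bessel.
suff E : x = s by rewrite [X in hassum _ X]E.
apply/eqP; rewrite -subr_eq0; apply/eqP/e_total => i.
apply: nm0_eq0; apply/eqP; rewrite eq_le nm_ge0 andbT.
apply/ler_addgt0Pr => eps eps0; rewrite add0r.
have p : 0 < nm (e i) + 1 by rewrite ltr_wpDl ?nm_ge0.
have /hassum_nmP/(_ (eps / (nm (e i) + 1)))[|A hA] := hs; first by rewrite divr_gt0.
have {}hA := hA (i |` A)%fset (fsubsetU1 _ _).
set y := \sum_(j <- _) _ in hA.
have yi : ip (x - y) (e i) = 0 by rewrite ipBl ip_partial ?subrr// !inE eqxx.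
have -> : ip (x - s) (e i) = ip (y - s) (e i).
  by rewrite -{1}(subrK y x) -addrA ipDl yi add0r.
rewrite (le_trans (nm_ip ip_norm _ _))//.
move: hA; rewrite ltr_pdivlMr// => hA; rewrite (le_trans _ (ltW hA))//.
by rewrite ler_wpM2l ?nm_ge0// lerDl.
Qed.

Lemma parseval x :
  (\esum_(i in [set: I]) (nm (ip x (e i)) ^+ 2)%:E = (nm x ^+ 2)%:E)%E.
Proof.
rewrite -(ortho_hassum_nm ip_norm _ (frame_hassum x)).
  by apply: eq_esum => i _; rewrite nm_coef.
by move=> i j ij; rewrite ipZl ipZr e_orth// !mulr0.
Qed.

(** The vector representing phi has the coordinates conj (phi (e i)), and its sum
    converges by testing phi on its own partial sums. *)
Lemma riesz (phi : H -> R[i]) (c : R) : 0 <= c ->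
  (forall a x y, phi (a *: x + y) = a * phi x + phi y) ->
  (forall x, nm (phi x) <= c * nm x) -> exists y, forall x, phi x = ip x y.
Proof.
move=> c0 lin hc.
have p0 : phi 0 = 0.
  by apply: nm0_eq0; apply/eqP; rewrite eq_le nm_ge0 andbT (le_trans (hc _))// nm0 mulr0.
have pD x y : phi (x + y) = phi x + phi y by rewrite -{1}[x]scale1r lin mul1r.
have pZ a x : phi (a *: x) = a * phi x by rewrite -[a *: x]addr0 lin p0 addr0.
have pS (r : seq I) (f : I -> H) : phi (\sum_(i <- r) f i) = \sum_(i <- r) phi (f i).
  by elim/big_rec2 : _ => [//|i a b _ <-]; rewrite pD.
pose v i := Num.conj (phi (e i)) *: e i.
have vn i : nm (v i) = nm (phi (e i)).
  rewrite nmZ nm_conj; case: (e_unit i) => [->|/nm_unit ->]; last by rewrite mulr1.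
  by rewrite p0 nm0 mul0r.
have vo i j : i != j -> ip (v i) (v j) = 0.
  by move=> ij; rewrite ipZl ipZr e_orth// !mulr0.
have vA (A : {fset I}) : \sum_(i <- A) nm (v i) ^+ 2 <= c ^+ 2.
  set S := \sum_(i <- A) nm (v i) ^+ 2.
  have S0 : 0 <= S by apply: sumr_ge0 => i _; exact: sqr_ge0.
  pose x := \sum_(i <- A) v i.
  have xn : nm x ^+ 2 = S by rewrite (nm2_sum_orth ip_norm) ?fset_uniq.
  have px : phi x = S%:C.
    rewrite pS /S rmorph_sum/=; apply: eq_bigr => i _.
    by rewrite pZ vn sqr_nm mulrC.
  have : S <= c * nm x by rewrite -[leLHS](ger0_norm S0) -nmC -px hc.
  rewrite -xn expr2.
  have [->|x0] := eqVneq (nm x) 0; first by rewrite mulr0 sqr_ge0.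
  have xp : 0 < nm x by rewrite lt_def x0 nm_ge0.
  by rewrite ler_pM2r// => h; rewrite -expr2 ler_sqr ?nnegrE ?nm_ge0.
have [|y hy] := @ortho_hassum _ _ ip ip_norm I v vo.
  apply: (@le_lt_trans _ _ (c ^+ 2)%:E); last by rewrite ltry.
  by apply/esum_le_fset => [i|//]; exact: sqr_ge0.
have ey i : ip (e i) y = phi (e i).
  rewrite ipC.
  have -> : ip y (e i) = Num.conj (phi (e i)); last by rewrite conjCK.
  apply/eqP; rewrite -subr_eq0 -nm_eq0 eq_le nm_ge0 andbT.
  apply/ler_addgt0Pr => eps eps0; rewrite add0r.
  have p : 0 < nm (e i) + 1 by rewrite ltr_wpDl ?nm_ge0.
  have /hassum_nmP/(_ (eps / (nm (e i) + 1)))[|A hA] := hy; first by rewrite divr_gt0.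
  have {}hA := hA (i |` A)%fset (fsubsetU1 _ _).
  set z := \sum_(j <- _) _ in hA.
  have zi : ip z (e i) = Num.conj (phi (e i)).
    rewrite ip_suml (big_fsetD1 i) ?inE ?eqxx//= big1_seq => [|j].
      rewrite ipZl; case: (e_unit i) => h; last by rewrite h mulr1 addr0.
      by rewrite h p0 rmorph0 mul0r addr0.
    by rewrite !inE => /andP[_ /andP[ji _]]; rewrite ipZl e_orth// mulr0.
  rewrite -zi -ipBl (le_trans (nm_ip ip_norm _ _))//.
  move: hA; rewrite ltr_pdivlMr// => hA; rewrite (le_trans _ (ltW hA))//.
  by rewrite nmB ler_wpM2l ?nm_ge0// lerDl.
exists y => x.
have hphi : hassum (fun i => phi (ip x (e i) *: e i) : R[i]^o) (phi x : R[i]^o).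
  apply: (@hassum_map R H R[i]^o _ _ _ phi c _ _ (frame_hassum x)) => // u w.
  by rewrite -scaleN1r pD pZ mulN1r.
apply: hassum_unique hphi _.
have -> : (fun i => phi (ip x (e i) *: e i)) = (fun i => ip (ip x (e i) *: e i) y).
  by apply/funext => i; rewrite pZ ipZl ey.
apply: (@hassum_map R H R[i]^o _ _ _ (fun z => ip z y) (nm y) _ _ (frame_hassum x)).
  by move=> u w; rewrite ipBl.
by move=> u; rewrite mulrC; exact: nm_ip.
Qed.

End Parseval.

(** * Orthonormal systems adapted to a resolution of the identity *)

Section GramSchmidt.
Context {R : realType} {H : completeNormedModType R[i]}.
Variables (ip : {dot H for Num.conj}) (ip_norm : scalar_product_norm ip).

Definition coord_sum (u : seq H) (x : H) : H := \sum_(v <- u) ip x v *: v.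

(** A vector that depends on the later ones of s has zero remainder and is
    dropped. *)
Lemma gram_schmidt (S : set H) (s : seq H) : S 0 ->
  (forall a x y, S x -> S y -> S (a *: x + y)) -> (forall x, x \in s -> S x) ->
  exists u : seq H, [/\ (size u <= size s)%N, orthonormal ip u,
    forall x, x \in u -> S x & forall x, x \in s -> coord_sum u x = x].
Proof.
move=> S0 SP; elim: s => [_|a s IH Ss]; first by exists [::]; split.
have [|u [us uo uS uc]] := IH; first by move=> x xs; apply: Ss; rewrite inE xs orbT.
have /orthonormalP[uu uo'] := uo.
have Scs x : S (coord_sum u x).
  rewrite /coord_sum big_seq; elim/big_rec : _ => // i y iu Sy.
  by apply: (SP _ _ _) => //; exact: uS.
pose a' := a - coord_sum u a.
have a'o v : v \in u -> ip a' v = 0.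
  move=> vu; rewrite ipBl /coord_sum ip_suml (bigD1_seq v)//= big1_seq => [|w].
    by rewrite ipZl (uo' v v vu vu) eqxx mulr1 addr0 subrr.
  by move=> /andP[wv wu]; rewrite ipZl (uo' w v wu vu) (negbTE wv) mulr0.
have [a0|a0] := eqVneq a' 0.
  exists u; split => //; first exact: leq_trans us _.
  move=> x; rewrite inE => /orP[/eqP ->|]; last exact: uc.
  by apply/eqP; rewrite eq_sym -subr_eq0; apply/eqP.
have np : 0 < nm a' by rewrite lt_def nm_eq0 a0 nm_ge0.
pose v := ((nm a')^-1)%:C *: a'.
have vo w : w \in u -> ip v w = 0 by move=> wu; rewrite ipZl a'o// mulr0.
have vv : ip v v = 1.
  rewrite (ip_nm ip_norm) nmZ nmC ger0_norm ?invr_ge0 ?ltW// mulVf ?gt_eqF//.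
  by rewrite expr1n.
have vu : v \notin u by apply/negP => /vo; rewrite vv => /eqP; rewrite oner_eq0.
exists (v :: u); split => //=.
- apply/orthonormalP; split; first by rewrite /= vu uu.
  move=> x y; rewrite !inE => /orP[/eqP ->|xu] /orP[/eqP ->|yu].
  + by rewrite vv eqxx.
  + by rewrite vo//; case: eqP yu vu => // <- ->.
  + by rewrite ip_eq0C ?vo//; case: eqP xu vu => // -> ->.
  + exact: uo'.
- move=> x; rewrite inE => /orP[/eqP ->|]; last exact: uS.
  rewrite /v /a' -[_ *: _]addr0; apply: (SP _ _ _) => //.
  by rewrite addrC -scaleN1r; apply: (SP _ _ _) => //; apply: Ss; rewrite mem_head.
- move=> x; rewrite inE => xas; rewrite /coord_sum big_cons -/(coord_sum u x).
  case/orP: xas => [/eqP ->|xs].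
    have -> : ip a v = (nm a')%:C.
      have -> : a = a' + coord_sum u a by rewrite /a' subrK.
      rewrite ipDl (_ : ip (coord_sum u a) v = 0) ?addr0; last first.
        rewrite ip_suml big1_seq// => w /andP[_ wu].
        by rewrite ipZl (ip_eq0C (vo _ wu)) mulr0.
      have cr : Num.conj ((nm a')^-1)%:C = ((nm a')^-1)%:C by exact: conjc_real.
      rewrite ipZr (ip_nm ip_norm) cr -rmorphM /= expr2 mulrA mulVf ?mul1r//.
      by rewrite gt_eqF.
    rewrite /v scalerA -rmorphM /= divff ?gt_eqF// scale1r /a' subrK//.
  rewrite uc// -{1}(uc _ xs) ip_suml big1_seq ?scale0r ?add0r// => w /andP[_ wu].
  by rewrite ipZl (ip_eq0C (vo _ wu)) mulr0.
Qed.

(** Zero vectors pad the bases of the ranges of the P n, so that one index type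
    serves for all multiplicities. *)
Definition adapted_frame (P : int -> H -> H) (d : int -> nat) (e : int * nat -> H) :=
  [/\ forall k l, k != l -> ip (e k) (e l) = 0,
      forall k, e k = 0 \/ ip (e k) (e k) = 1,
      forall n x, P n x = \sum_(s < d n) ip x (e (n, s : nat)) *: e (n, s : nat),
      forall k, P k.1 (e k) = e k &
      forall n s, (d n <= s)%N -> e (n, s) = 0].

Lemma exists_adapted_frame (P : int -> H -> H) (d : int -> nat) :
  resolution_of_identity ip P ->
  (forall n, exists v : 'I_(d n) -> H, (forall i, P n (v i) = v i) /\
     forall x, exists c : 'I_(d n) -> R[i], P n x = \sum_i c i *: v i) ->
  exists e, adapted_frame P d e.
Proof.
move=> resP hv.
have ex n : exists u : seq H, [/\ (size u <= d n)%N, orthonormal ip u,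
    forall x, x \in u -> P n x = x & forall x, coord_sum u (P n x) = P n x].
  have [v [vP vc]] := hv n.
  have bP := P_bo resP n.
  have [||x|u [us uo uP uc]] := @gram_schmidt [set x | P n x = x] [seq v i | i <- enum 'I_(d n)].
  - exact: (bo0 bP).
  - by move=> a x y /= hx hy; rewrite (boP bP) hx hy.
  - by move=> /mapP[i _ ->] /=.
  exists u; split => //; first by rewrite (leq_trans us)// size_map size_enum_ord.
  move=> x; have [c ->] := vc x.
  rewrite {1}/coord_sum.
  have vuc i : coord_sum u (v i) = v i by apply: uc; apply: map_f; rewrite mem_enum.
  under eq_bigr do rewrite ip_suml scaler_suml.
  rewrite exchange_big /=; apply: eq_bigr => i _; rewrite -{2}(vuc i) scaler_sumr.
  by apply: eq_bigr => w _; rewrite ipZl scalerA.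
pose u n := projT1 (cid (ex n)).
have uP n : [/\ (size (u n) <= d n)%N, orthonormal ip (u n),
    forall x, x \in u n -> P n x = x & forall x, coord_sum (u n) (P n x) = P n x].
  exact: projT2 (cid (ex n)).
pose e (k : int * nat) := nth 0 (u k.1) k.2.
have eP k : P k.1 (e k) = e k.
  have [_ _ h _] := uP k.1; rewrite /e; case: (ltnP k.2 (size (u k.1))) => hk.
    by apply: h; exact: mem_nth.
  by rewrite nth_default// (bo0 (P_bo resP _)).
exists e; split => //.
- move=> [n s] [n' s'] kl; rewrite -(eqP (introT eqP (eP (n, s)))) -(eP (n', s')) /=.
  case: (eqVneq n n') kl => [<-|nn'] kl; last exact: ip_PP.
  rewrite (eP (n, s)) (eP (n, s')) /e /=.
  have [_ /orthonormalP[uu uo] _ _] := uP n.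
  case: (ltnP s (size (u n))) => hs; last by rewrite nth_default// ip0l.
  case: (ltnP s' (size (u n))) => hs'; last by rewrite [X in ip _ X]nth_default// ip0r.
  rewrite uo ?mem_nth// nth_uniq//.
  by case: (eqVneq s s') kl => [->|//]; rewrite eqxx.
- move=> [n s]; rewrite /e /=.
  have [_ /orthonormalP[uu uo] _ _] := uP n.
  case: (ltnP s (size (u n))) => hs; last by left; rewrite nth_default.
  by right; rewrite uo ?mem_nth// eqxx.
- move=> n x; have [us _ uPn uc] := uP n.
  rewrite -uc /coord_sum (big_nth 0) big_mkord.
  rewrite (big_ord_widen (d n) (fun i => ip (P n x) (nth 0 (u n) i) *: nth 0 (u n) i))//.
  rewrite big_mkcond /=; apply: eq_bigr => i _; rewrite /e /=.
  case: ltnP => hi; last by rewrite nth_default// scaler0.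
  by rewrite (P_sa resP) uPn// mem_nth.
- move=> n s hs; rewrite /e nth_default//=; have [us _ _ _] := uP n.
  exact: leq_trans us hs.
Qed.

End GramSchmidt.

(** * Hilbert-Schmidt operators *)

Section HilbertSchmidt.
Context {R : realType} {H : completeNormedModType R[i]}.
Variables (ip : {dot H for Num.conj}) (ip_norm : scalar_product_norm ip).
Variables (P : int -> H -> H) (resP : resolution_of_identity ip P).
Variables (d : int -> nat) (e : int * nat -> H) (fr : adapted_frame ip P d e).
Implicit Types (x y : H) (X Y : H -> H) (i j n : int) (k l : int * nat) (m N : nat).
Local Notation K := (int * nat)%type.

Lemma e_orth (k l : K) : k != l -> ip (e k) (e l) = 0.
Proof. by case: fr => h _ _ _ _; exact: h. Qed.
Lemma e_unit (k : K) : e k = 0 \/ ip (e k) (e k) = 1.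
Proof. by case: fr => _ h _ _ _; exact: h. Qed.
Lemma P_coord n x : P n x = \sum_(s < d n) ip x (e (n, s : nat)) *: e (n, s : nat).
Proof. by case: fr => _ _ h _ _; exact: h. Qed.
Lemma P_e (k : K) n : P n (e k) = if n == k.1 then e k else 0.
Proof.
have Pe : P k.1 (e k) = e k by case: fr => _ _ _ h _; exact: h.
by rewrite -Pe (PP resP); case: eqP => // ->.
Qed.
Lemma e_total x : (forall k, ip x (e k) = 0) -> x = 0.
Proof.
move=> h; apply: (P_ext resP) => n; rewrite (bo0 (P_bo resP n)) P_coord.
by rewrite big1// => s _; rewrite h scale0r.
Qed.

Lemma nm_e k : nm (e k) <= 1.
Proof. by case: (e_unit k) => [->|/(nm_unit ip_norm) ->]; rewrite ?nm0. Qed.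

Let coords := parseval ip_norm e_orth e_unit e_total.
Let expand := frame_hassum ip_norm e_orth e_unit e_total.

Lemma bo_frame_ext X Y : bounded_op X -> bounded_op Y ->
  (forall k, X (e k) = Y (e k)) -> X = Y.
Proof.
move=> bX bY h; apply/funext => x.
apply: hassum_unique (bo_hassum bX (expand x)) _.
rewrite (_ : (fun _ => _) = fun k => Y (ip x (e k) *: e k)).
  exact: bo_hassum (expand x).
by apply/funext => k; rewrite (boZ bX) (boZ bY) h.
Qed.

Definition hs2 X : \bar R := (\esum_(k in [set: K]) (nm (X (e k)) ^+ 2)%:E)%E.

Lemma hs2_ge0 X : (0 <= hs2 X)%E.
Proof. by apply: esum_ge0 => k _; rewrite lee_fin sqr_ge0. Qed.

(** The vectors b k are the images of the e k under the adjoint of Y, obtained from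
    Riesz representation; the equality of the square sums is Parseval used
    twice. *)
Lemma adjoint_vectors Y : bounded_op Y -> exists b : K -> H,
  (forall x k, ip (Y x) (e k) = ip x (b k)) /\
  (\esum_(k in [set: K]) (nm (b k) ^+ 2)%:E)%E = hs2 Y.
Proof.
move=> bY; have [c c0 hc] := bo_bound bY.
have ex k : exists y, forall x, ip (Y x) (e k) = ip x y.
  apply: (riesz ip_norm e_orth e_unit e_total c0).
    by move=> a x y; rewrite (boP bY) ipDl ipZl.
  move=> x; rewrite (le_trans (nm_ip ip_norm _ _))//.
  by rewrite (le_trans _ (hc x))// ler_piMr ?nm_ge0// nm_e.
pose b k := projT1 (cid (ex k)).
have bE x k : ip (Y x) (e k) = ip x (b k) by exact: (projT2 (cid (ex k)) x).
exists b; split => //.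
rewrite /hs2 [LHS](_ : _ = (\esum_(k in [set: K]) \esum_(l in [set: K])
    (nm (ip (Y (e l)) (e k)) ^+ 2)%:E)%E).
  rewrite esum_swap; last by move=> i j; rewrite lee_fin sqr_ge0.
  by apply: eq_esum => l _; exact: coords.
apply: eq_esum => k _; rewrite -coords; apply: eq_esum => l _.
by rewrite bE ipC nm_conj.
Qed.

Lemma onb_parseval E : orthonormal_basis ip E -> forall x,
  (\esum_(f in E) (nm (ip x f) ^+ 2)%:E = (nm x ^+ 2)%:E)%E.
Proof.
move=> [E1 Eo Et] x; pose g (f : H) := if f \in E then f else 0.
have go f f' : f != f' -> ip (g f) (g f') = 0.
  move=> ff'; rewrite /g; case: ifPn => [fE|_]; last by rewrite ip0l.
  case: ifPn => [f'E|_]; last by rewrite ip0r.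
  by apply: Eo; [exact: set_mem|exact: set_mem|exact/eqP].
have gu f : g f = 0 \/ ip (g f) (g f) = 1.
  by rewrite /g; case: ifPn => [fE|_]; [right; apply: E1; exact: set_mem|left].
have gt z : (forall f, ip z (g f) = 0) -> z = 0.
  move=> h; apply: Et => f fE; have := h f.
  by rewrite /g mem_set.
rewrite -(parseval ip_norm go gu gt) esum_mkcond; apply: eq_esum => f _.
by rewrite /g; case: ifPn => // _; rewrite ip0r nm0 expr0n.
Qed.

Lemma frame_onb : orthonormal_basis ip [set f | exists2 k, f = e k & f <> 0].
Proof.
split.
- by move=> _ [k -> ek0]; case: (e_unit k).
- move=> _ _ [k -> ek0] [l -> el0] kl; apply: e_orth.
  by apply/eqP => E; apply: kl; rewrite E.
- move=> x h; apply: e_total => k; have [->|/eqP k0] := eqVneq (e k) 0; first by rewrite ip0r.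
  by apply: h; exists k.
Qed.

(** By Parseval the sum over any orthonormal basis is the sum of the squared norms
    of the adjoint vectors. *)
Lemma hsnorm2E X : bounded_op X -> hsnorm2 ip X = hs2 X.
Proof.
move=> bX; have [b [bE bn]] := adjoint_vectors bX.
have key E : orthonormal_basis ip E -> (\esum_(f in E) (nm (X f) ^+ 2)%:E = hs2 X)%E.
  move=> onb; rewrite -bn.
  rewrite [LHS](_ : _ = (\esum_(f in [set: H]) \esum_(k in [set: K])
      (if f \in E then nm (ip f (b k)) ^+ 2 else 0)%:E)%E); last first.
    rewrite esum_mkcond; apply: eq_esum => f _; case: ifPn => fE.
      by rewrite -coords; apply: eq_esum => k _; rewrite bE.
    by rewrite esum1.
  rewrite esum_swap; last by move=> f k; case: ifP => // _; rewrite lee_fin sqr_ge0.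
  apply: eq_esum => k _; rewrite -(onb_parseval onb) [RHS]esum_mkcond.
  apply: eq_esum => f _; case: ifP => // _; by rewrite ipC nm_conj.
rewrite /hsnorm2 [X in ereal_sup X](_ : _ = [set hs2 X]) ?ereal_sup1//.
apply/seteqP; split => [_ [E onb <-]|_ ->]; first exact: key.
by exists [set f | exists2 k, f = e k & f <> 0]; [exact: frame_onb|exact: key frame_onb].
Qed.

Definition HS X := bounded_op X /\ (hs2 X < +oo)%E.
Definition hsn X : R := Num.sqrt (fine (hs2 X)).

Lemma HSP X : hilbert_schmidt ip X <-> HS X.
Proof. by split => -[bX]; rewrite ?hsnorm2E// -hsnorm2E. Qed.

Lemma hsn_ge0 X : 0 <= hsn X.
Proof. exact: sqrtr_ge0. Qed.

Lemma hs2_hsn X : HS X -> hs2 X = (hsn X ^+ 2)%:E.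
Proof.
move=> [_ fin]; have h0 := hs2_ge0 X.
by rewrite sqr_sqrtr ?fineK ?fine_ge0 ?ge0_fin_numE.
Qed.

Lemma HS_le X (c : R) : bounded_op X -> 0 <= c -> (hs2 X <= (c ^+ 2)%:E)%E ->
  HS X /\ hsn X <= c.
Proof.
move=> bX c0 h; have hX : HS X by split => //; rewrite (le_lt_trans h)// ltry.
split => //; rewrite -(@ler_sqr R) ?nnegrE ?hsn_ge0//.
by rewrite -lee_fin -hs2_hsn.
Qed.

Lemma HS_fin X (A : {fset K}) : HS X -> \sum_(k <- A) nm (X (e k)) ^+ 2 <= hsn X ^+ 2.
Proof.
move=> hX; move: A; apply/esum_le_fset => [k|]; first exact: sqr_ge0.
by rewrite -hs2_hsn.
Qed.

Lemma HS_le_fin X (c : R) : bounded_op X -> 0 <= c ->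
  (forall A : {fset K}, \sum_(k <- A) nm (X (e k)) ^+ 2 <= c ^+ 2) ->
  HS X /\ hsn X <= c.
Proof.
by move=> bX c0 h; apply: HS_le => //; apply/esum_le_fset => [k|//]; exact: sqr_ge0.
Qed.

(** Cauchy-Schwarz for the expansion of x along the frame. *)
Lemma op_hs X x : HS X -> nm (X x) <= hsn X * nm x.
Proof.
move=> hX; have [bX _] := hX.
apply: (hassum_le (bo_hassum bX (expand x))) => A.
rewrite (le_trans (nm_sum _ _ _))//.
under eq_bigr do rewrite (boZ bX) nmZ mulrC.
apply: cauchy_schwarz_fin; rewrite ?hsn_ge0 ?nm_ge0//; try by move=> ?; exact: nm_ge0.
  exact: HS_fin.
exact: (bessel ip_norm e_orth e_unit).
Qed.

Lemma HS_comp X Y (c : R) : bounded_op X -> 0 <= c -> (forall x, nm (X x) <= c * nm x) ->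
  HS Y -> HS (X \o Y) /\ hsn (X \o Y) <= c * hsn Y.
Proof.
move=> bX c0 hc hY; have [bY _] := hY.
apply: HS_le_fin; rewrite ?mulr_ge0 ?hsn_ge0//; first exact: bo_comp.
move=> A; rewrite exprMn (le_trans _ (ler_wpM2l (sqr_ge0 c) (HS_fin A hY)))// mulr_sumr.
by apply: ler_sum => k _; rewrite -exprMn ler_sqr ?nnegrE ?mulr_ge0 ?nm_ge0//; exact: hc.
Qed.

Lemma HSM X Y : HS X -> HS Y -> HS (X \o Y) /\ hsn (X \o Y) <= hsn X * hsn Y.
Proof.
move=> hX hY; apply: HS_comp; rewrite ?hsn_ge0//; first by case: hX.
by move=> x; exact: op_hs.
Qed.

Lemma HSD X Y : HS X -> HS Y -> HS (X + Y) /\ hsn (X + Y) <= hsn X + hsn Y.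
Proof.
move=> hX hY; have [bX _] := hX; have [bY _] := hY.
apply: HS_le_fin; rewrite ?addr_ge0 ?hsn_ge0//; first exact: bo_add.
move=> A.
have step k : nm ((X + Y) (e k)) ^+ 2 <=
    nm (X (e k)) ^+ 2 + nm (Y (e k)) ^+ 2 + 2 * (nm (X (e k)) * nm (Y (e k))).
  apply: (@le_trans _ _ ((nm (X (e k)) + nm (Y (e k))) ^+ 2)).
    by rewrite ler_sqr ?nnegrE ?addr_ge0 ?nm_ge0// nmD.
  by rewrite le_eqVlt; apply/orP; left; apply/eqP; ring.
rewrite (le_trans (ler_sum _ (fun k _ => step k)))//.
rewrite !big_split /= -mulr_sumr.
have h1 := HS_fin A hX; have h2 := HS_fin A hY.
have : \sum_(k <- A) nm (X (e k)) * nm (Y (e k)) <= hsn X * hsn Y.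
  by apply: cauchy_schwarz_fin; rewrite ?hsn_ge0//; move=> ?; exact: nm_ge0.
by nra.
Qed.

Lemma HSZ (a : R[i]) X : HS X -> HS (a *: X) /\ hsn (a *: X) <= nm a * hsn X.
Proof.
move=> hX; rewrite (_ : a *: X = (a *: idfun) \o X)//.
apply: HS_comp; rewrite ?nm_ge0//; first by apply: bo_scale; exact: bo_id.
by move=> x; rewrite opE nmZ.
Qed.

Lemma HSN X : HS X -> HS (- X) /\ hsn (- X) <= hsn X.
Proof. by move=> /(HSZ (-1)); rewrite scaleN1r nmN nm1 mul1r. Qed.

Lemma HSB X Y : HS X -> HS Y -> HS (X - Y) /\ hsn (X - Y) <= hsn X + hsn Y.
Proof.
move=> hX hY; have [hN1 hN2] := HSN hY; have [h1 h2] := HSD hX hN1.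
by split => //; rewrite (le_trans h2)// lerD2l.
Qed.

Lemma hsn_dist X Y : hsn (X - Y) = hsn (Y - X).
Proof.
rewrite /hsn; congr (Num.sqrt (fine _)); apply: eq_esum => k _.
by rewrite !opE nmB.
Qed.

Lemma HS0 : HS 0 /\ hsn 0 = 0.
Proof.
have h : hs2 0 = 0%E by apply: esum1 => k _; rewrite opE nm0 expr0n.
by split; [split; [exact: bo_zero|rewrite h ltry]|rewrite /hsn h sqrtr0].
Qed.

Lemma hsn_eq0 X : HS X -> hsn X = 0 -> X = 0.
Proof.
move=> hX h; apply/funext => x; apply: nm0_eq0; apply/eqP.
by rewrite eq_le nm_ge0 andbT (le_trans (op_hs x hX))// h mul0r.
Qed.

Lemma HS_sum (I : Type) (r : seq I) (Q : pred I) (F : I -> H -> H) :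
  (forall a : I, Q a -> HS (F a)) -> HS (\sum_(i <- r | Q i) F i).
Proof.
move=> h; elim/big_ind : _ => [||//]; first by case: HS0.
by move=> X Y hX hY; have [] := HSD hX hY.
Qed.

(** The sum over the frame reduces to the finitely many vectors of one block. *)
Lemma HS_P X n : bounded_op (X \o P n) -> HS (X \o P n).
Proof.
move=> bX; have [c c0 hc] := bo_bound bX.
have [] // := @HS_le_fin (X \o P n) (Num.sqrt (c ^+ 2 * (d n)%:R)) bX (sqrtr_ge0 _).
move=> A; rewrite sqr_sqrtr ?mulr_ge0 ?sqr_ge0//.
pose F := seq_fset tt [seq (n, s) | s <- iota 0 (d n)].
have out k : k \notin F -> (X \o P n) (e k) = 0.
  rewrite seq_fsetE => hk; rewrite /= P_e; case: eqVneq => [nk|_]; last first.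
    by have := bo0 bX; rewrite /= (bo0 (P_bo resP n)).
  suff -> : e k = 0 by have := bo0 bX; rewrite /= (bo0 (P_bo resP n)).
  case: k nk hk => n' s /= <-; rewrite mem_map ?mem_iota; last by move=> ? ? [].
  by rewrite add0n /= -leqNgt => hs; case: fr => _ _ _ _; exact.
rewrite (le_trans (_ : _ <= \sum_(k <- (A `&` F)%fset) nm ((X \o P n) (e k)) ^+ 2))//.
  rewrite (big_fset_incl _ (fsubsetIl A F))// => k kA.
  by rewrite !inE kA andTb => /out ->; rewrite nm0 expr0n.
have step k : nm ((X \o P n) (e k)) ^+ 2 <= c ^+ 2.
  rewrite ler_sqr ?nnegrE ?nm_ge0//.
  by rewrite (le_trans (hc _))// ler_piMr ?nm_e.
rewrite (le_trans (ler_sum _ (fun k _ => step k)))//.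
rewrite big_const_seq count_predT iter_addr_0 -[leLHS]mulr_natr.
rewrite ler_wpM2l ?sqr_ge0// ler_nat (leq_trans (fsubset_leq_card (fsubsetIr A F)))//.
by rewrite size_seq_fset (leq_trans (size_undup _))// size_map size_iota.
Qed.

End HilbertSchmidt.

(** * Square summable matrices *)

Section HSMatrices.
Context {R : realType} {H : completeNormedModType R[i]}.
Variables (ip : {dot H for Num.conj}) (ip_norm : scalar_product_norm ip).
Variables (P : int -> H -> H) (resP : resolution_of_identity ip P).
Variables (d : int -> nat) (e : int * nat -> H) (fr : adapted_frame ip P d e).
Implicit Types (x y : H) (X Y : H -> H) (i j : int) (k l : int * nat) (m n N : nat).
Local Notation K := (int * nat)%type.

(** The image of x is the sum of the ip x (e k) *: c k, absolutely convergent by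
    Cauchy-Schwarz. *)
Lemma hs_columns (c : K -> H) : (forall k, e k = 0 -> c k = 0) ->
  (\esum_(k in [set: K]) (nm (c k) ^+ 2)%:E < +oo)%E ->
  exists X, bounded_op X /\ forall k, X (e k) = c k.
Proof.
move=> c0 fin.
have eo := e_orth fr; have eu := e_unit fr.
have ex x : exists s, hassum (fun k => ip x (e k) *: c k) s.
  apply: cauchy_hassum => eps eps0.
  have p : 0 < nm x + 1 by rewrite ltr_wpDl ?nm_ge0.
  pose del := eps / (nm x + 1); have del0 : 0 < del by rewrite divr_gt0.
  have [A hA] := esum_tail (fun k => sqr_ge0 (nm (c k))) fin (exprn_gt0 2 del0).
  exists A => B /hA hB; rewrite (le_lt_trans (nm_sum _ _ _))//.
  under eq_bigr do rewrite nmZ.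
  apply: (@le_lt_trans _ _ (nm x * del)).
    apply: cauchy_schwarz_fin; rewrite ?nm_ge0 ?(ltW del0) ?(ltW hB)//;
      try by move=> ?; exact: nm_ge0.
    exact: (bessel ip_norm eo eu).
  by rewrite mulrC /del -mulrA gtr_pMr// ltr_pdivrMl// mulr1 ltrDl.
pose X x := projT1 (cid (ex x)).
have Xs x : hassum (fun k => ip x (e k) *: c k) (X x) by exact: projT2 (cid (ex x)).
pose C := Num.sqrt (fine (\esum_(k in [set: K]) (nm (c k) ^+ 2)%:E)%E).
have hC (A : {fset K}) : \sum_(k <- A) nm (c k) ^+ 2 <= C ^+ 2.
  have g0 : (0 <= \esum_(k in [set: K]) (nm (c k) ^+ 2)%:E)%E.
    by apply: esum_ge0 => k _; rewrite lee_fin sqr_ge0.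
  move: A; apply/esum_le_fset => [k|]; first exact: sqr_ge0.
  by rewrite /C sqr_sqrtr ?fine_ge0// fineK// ge0_fin_numE.
exists X; split.
  apply: (@bo_intro _ _ X C) => [a x y|x].
    apply: hassum_unique (Xs _) _.
    have -> : (fun k => ip (a *: x + y) (e k) *: c k) =
        (fun k => a *: (ip x (e k) *: c k) + ip y (e k) *: c k).
      by apply/funext => k; rewrite ipDl ipZl scalerDl scalerA.
    apply: hassumD => //; apply: (@bo_hassum _ _ _ (a *: idfun)) (Xs x).
    by apply: bo_scale; exact: bo_id.
  apply: (hassum_le (Xs x)) => A; rewrite (le_trans (nm_sum _ _ _))//.
  under eq_bigr do rewrite nmZ mulrC.
  apply: cauchy_schwarz_fin; rewrite ?nm_ge0 ?sqrtr_ge0//; try by move=> ?; exact: nm_ge0.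
  exact: (bessel ip_norm eo eu).
move=> l; apply: hassum_unique (Xs _) _.
have h k : k \notin [fset l]%fset -> ip (e l) (e k) *: c k = 0.
  by rewrite inE => kl; rewrite eo ?scale0r// eq_sym.
have := hassum_fin h; rewrite big_seq_fset1.
by case: (eu l) => [/c0 ->|->]; rewrite ?scaler0 ?scale1r.
Qed.

Lemma mx_hs2 (M : int -> int -> H -> H) :
  (forall i j, bounded_op (M i j)) -> (forall i j x, M i j (P j x) = M i j x) ->
  (\esum_(ij in [set: int * int]) hs2 e (M ij.1 ij.2) =
   \esum_(l in [set: K]) \esum_(i in [set: int]) (nm (M i l.1 (e l)) ^+ 2)%:E)%E.
Proof.
move=> bM MP; rewrite -(@esum_pair _ _ _ (fun i j => hs2 e (M i j))); last first.
  by move=> i j; exact: hs2_ge0.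
rewrite [RHS]esum_swap; last by move=> l i; rewrite lee_fin sqr_ge0.
apply: eq_esum => i _; rewrite /hs2 esum_swap; last by move=> l j; rewrite lee_fin sqr_ge0.
apply: eq_esum => l _; apply: esum_single; last exact: sqr_ge0.
move=> j jl; rewrite -MP (P_e resP fr) (negbTE jl) (bo0 (bM i j)) nm0.
by rewrite expr0n.
Qed.

Lemma hs2_rows X :
  hs2 e X = (\esum_(l in [set: K]) \esum_(i in [set: int]) (nm (P i (X (e l))) ^+ 2)%:E)%E.
Proof. by apply: eq_esum => l _; rewrite (P_sq ip_norm resP). Qed.

Lemma hs2_entries X : bounded_op X ->
  (\esum_(ij in [set: int * int]) hs2 e (entry P X ij.1 ij.2) = hs2 e X)%E.
Proof.
move=> bX; rewrite mx_hs2.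
- rewrite hs2_rows; apply: eq_esum => l _; apply: eq_esum => i _.
  by rewrite entryE (P_e resP fr) eqxx.
- move=> i j; exact: (bo_comp (bo_comp (P_bo resP i) bX) (P_bo resP j)).
- by move=> i j x; rewrite !entryE (P_idem resP).
Qed.

Lemma hs_of_matrix (M : int -> int -> H -> H) :
  (forall i j, bounded_op (M i j)) -> (forall i j x, M i j (P j x) = M i j x) ->
  (forall i j x, P i (M i j x) = M i j x) ->
  (\esum_(ij in [set: int * int]) hs2 e (M ij.1 ij.2) < +oo)%E ->
  exists Y, HS e Y /\ forall i j, entry P Y i j = M i j.
Proof.
move=> bM MP PM; rewrite mx_hs2// => fin.
have ex l : exists c, (forall i, P i c = M i l.1 (e l)).
  have [//||c _ hc] := @assemble _ _ _ ip_norm _ resP (fun i => M i l.1 (e l)); last by exists c.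
  apply: le_lt_trans fin.
  rewrite -(@esum_set1 _ _ l (fun l : K => \esum_(i in [set: int]) (nm (M i l.1 (e l)) ^+ 2)%:E)%E); last first.
    by apply: esum_ge0 => i _; rewrite lee_fin sqr_ge0.
  rewrite esum_mkcond; apply: le_esum => k _; case: ifP => // _.
  by apply: esum_ge0 => i _; rewrite lee_fin sqr_ge0.
pose c l := projT1 (cid (ex l)).
have Pc i l : P i (c l) = M i l.1 (e l) by exact: (projT2 (cid (ex l)) i).
have c2 : (\esum_(l in [set: K]) (nm (c l) ^+ 2)%:E =
    \esum_(l in [set: K]) \esum_(i in [set: int]) (nm (M i l.1 (e l)) ^+ 2)%:E)%E.
  apply: eq_esum => l _; rewrite -(P_sq ip_norm resP); apply: eq_esum => i _.
  by rewrite Pc.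
have [||Y [bY Ye]] := @hs_columns c.
- move=> k k0; apply: (P_ext resP) => i.
  by rewrite Pc k0 (bo0 (bM _ _)) (bo0 (P_bo resP i)).
- by rewrite c2.
exists Y; split.
  split => //; rewrite /hs2.
  rewrite (_ : (\esum_(k in _) _)%E = (\esum_(l in [set: K]) (nm (c l) ^+ 2)%:E)%E) ?c2//.
  by rewrite -c2; apply: eq_esum => l _; rewrite Ye.
move=> i j.
have bE : bounded_op (entry P Y i j).
  exact: (bo_comp (bo_comp (P_bo resP i) bY) (P_bo resP j)).
apply: (bo_frame_ext ip_norm resP fr bE (bM i j)) => k.
rewrite entryE (P_e resP fr); case: eqVneq => [->|jk]; first by rewrite Ye Pc.
rewrite -MP (P_e resP fr) (negbTE jk) (bo0 bY) (bo0 (P_bo resP i)).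
by rewrite (bo0 (bM i j)).
Qed.

(** Entrywise domination passes to Hilbert-Schmidt norms, since the squared norm is
    the sum over the entries. *)
Lemma schur_dom X Y (c : R) : HS e X -> bounded_op Y -> 0 <= c ->
  (forall i j x, nm (P i (Y (P j x))) <= c * nm (P i (X (P j x)))) ->
  HS e Y /\ hsn e Y <= c * hsn e X.
Proof.
move=> hX bY c0 h; have [bX _] := hX.
apply: HS_le_fin; rewrite ?mulr_ge0 ?hsn_ge0//.
move=> A; rewrite exprMn (le_trans _ (ler_wpM2l (sqr_ge0 c) (HS_fin A hX)))// mulr_sumr.
apply: ler_sum => k _; rewrite -exprMn ler_sqr ?nnegrE ?mulr_ge0 ?nm_ge0//.
apply: (P_dominated ip_norm resP) => // i.
by have := h i k.1 (e k); rewrite (P_e resP fr) eqxx.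
Qed.

Lemma schur_exists X (mu : int -> int -> R[i]) (c : R) : HS e X -> 0 <= c ->
  (forall i j, nm (mu i j) <= c) ->
  exists Y, [/\ HS e Y, hsn e Y <= c * hsn e X &
    forall i j, entry P Y i j = mu i j *: entry P X i j].
Proof.
move=> hX c0 hmu; have [bX fX] := hX.
have bE i j : bounded_op (entry P X i j).
  exact: (bo_comp (bo_comp (P_bo resP i) bX) (P_bo resP j)).
have [||||Y [hY YE]] := @hs_of_matrix (fun i j => mu i j *: entry P X i j).
- by move=> i j; apply: bo_scale.
- by move=> i j x; rewrite !opE !entryE (P_idem resP).
- by move=> i j x; rewrite opE (boZ (P_bo resP i)) !entryE (P_idem resP).
- apply: (@le_lt_trans _ _ (c ^+ 2 * hsn e X ^+ 2)%:E); last by rewrite ltry.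
  rewrite (@mx_hs2 (fun i j => mu i j *: entry P X i j)); first last.
  - by move=> i j x; rewrite !opE !entryE (P_idem resP).
  - by move=> i j; apply: bo_scale.
  rewrite (@esum_pair _ _ _ (fun l i => (nm ((mu i l.1 *: entry P X i l.1) (e l)) ^+ 2)%:E)).
    apply/esum_le_fset => [t|A]; first exact: sqr_ge0.
    have hA : \sum_(t <- A) nm (P t.2 (X (e t.1))) ^+ 2 <= hsn e X ^+ 2.
      move: A; apply/esum_le_fset => [t|]; first exact: sqr_ge0.
      rewrite -(hs2_hsn hX) hs2_rows.
      rewrite (@esum_pair _ _ _ (fun l i => (nm (P i (X (e l))) ^+ 2)%:E))//.
      by move=> l i; rewrite lee_fin sqr_ge0.
    rewrite (le_trans _ (ler_wpM2l (sqr_ge0 c) hA))// mulr_sumr.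
    apply: ler_sum => t _; rewrite opE entryE (P_e resP fr) eqxx nmZ -exprMn.
    by rewrite ler_sqr ?nnegrE ?mulr_ge0 ?nm_ge0// ler_wpM2r ?nm_ge0.
  by move=> l i; rewrite lee_fin sqr_ge0.
exists Y; split => //.
have bY : bounded_op Y by case: hY.
have [] // := @schur_dom X Y c hX bY c0 _.
move=> i j x; have /(congr1 (fun f => f x)) := YE i j.
by rewrite opE !entryE => ->; rewrite nmZ ler_wpM2r ?nm_ge0.
Qed.

(** The square sum of the entries outside a large central square is small. It is
    stated for the operators Y dominated by the tail of X, as it is applied to
    various modifications of X. *)
Lemma hs_tail X (eps : R) : HS e X -> 0 < eps -> exists N, forall Y (c : R),
  bounded_op Y -> 0 <= c ->
  (forall i j x, nm (P i (Y (P j x))) <=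
     (if ((`|i| <= N) && (`|j| <= N))%N then 0 else c) * nm (P i (X (P j x)))) ->
  HS e Y /\ hsn e Y <= c * eps.
Proof.
move=> hX eps0; have [bX fX] := hX.
pose a (t : K * int) := nm (P t.2 (X (e t.1))) ^+ 2.
have a0 t : 0 <= a t by exact: sqr_ge0.
have fa : (\esum_(t in [set: K * int]) (a t)%:E < +oo)%E.
  move: fX; rewrite hs2_rows (@esum_pair _ _ _ (fun l i => (nm (P i (X (e l))) ^+ 2)%:E)) //.
  by move=> i j; rewrite lee_fin sqr_ge0.
have [A hA] := esum_tail a0 fa (exprn_gt0 2 eps0).
have [N hN] : exists N, forall t, t \in A -> ((`|t.2| <= N) && (`|t.1.1| <= N))%N.
  exists (\max_(t <- A) maxn `|t.2| `|t.1.1|)%N => t tA.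
  by rewrite -geq_max (big_fsetD1 t)//= leq_maxl.
exists N => Y c bY c0 h.
apply: HS_le; rewrite ?mulr_ge0 ?(ltW eps0)//.
rewrite hs2_rows (@esum_pair _ _ _ (fun l i => (nm (P i (Y (e l))) ^+ 2)%:E)); last first.
  by move=> i j; rewrite lee_fin sqr_ge0.
apply/esum_le_fset => [t|B]; first exact: sqr_ge0.
have step t : nm (P t.2 (Y (e t.1))) ^+ 2 <= (if t \in A then 0 else c ^+ 2 * a t).
  have := h t.2 t.1.1 (e t.1); rewrite !(P_e resP fr) eqxx => ht.
  case: ifPn => [/hN tN|_].
    have -> : nm (P t.2 (Y (e t.1))) = 0; last by rewrite expr0n.
    by apply/eqP; rewrite eq_le nm_ge0 andbT; move: ht; rewrite tN mul0r.
  rewrite /a -exprMn ler_sqr ?nnegrE ?mulr_ge0 ?nm_ge0// (le_trans ht)//.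
  by rewrite ler_wpM2r ?nm_ge0//; case: ifP.
rewrite (le_trans (ler_sum _ (fun t _ => step t)))//.
rewrite -(big_fset_incl _ (fsubsetDl B A)); last first.
  by move=> t tB; rewrite !inE tB andbT negbK => ->.
apply: (@le_trans _ _ (c ^+ 2 * \sum_(t <- (B `\` A)%fset) a t)).
  rewrite mulr_sumr; apply: ler_sum => t _; case: ifP => // _.
  by rewrite mulr_ge0 ?sqr_ge0.
rewrite exprMn ler_wpM2l ?sqr_ge0// ltW// hA//.
by apply/fdisjointP => t tA; rewrite inE tA.
Qed.

(** The columns converge; the limit operator is rebuilt from its columns, with the
    rate preserved by taking limits in finite partial sums. *)
Lemma hs_complete (X : nat -> H -> H) (c q : R) : 0 <= q < 1 ->
  (forall n, HS e (X n)) -> (forall n, hsn e (X n.+1 - X n) <= c * q ^+ n) ->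
  exists Y, HS e Y /\ forall n, hsn e (X n - Y) <= c * q ^+ n / (1 - q).
Proof.
move=> q01 hX hd; have /andP[q0 q1] := q01.
have p : 0 < 1 - q by rewrite subr_gt0.
have c0 : 0 <= c by have := hd 0%N; rewrite expr0 mulr1; apply: le_trans; exact: hsn_ge0.
have C0 : 0 <= c / (1 - q) by rewrite divr_ge0// ltW.
have hB n m : HS e (X n - X m) by have [] := HSB (hX n) (hX m).
have dist n m : hsn e (X n - X (n + m)%N) <= c * q ^+ n / (1 - q).
  suff h : hsn e (X n - X (n + m)%N) <= c * q ^+ n / (1 - q) * (1 - q ^+ m).
    rewrite (le_trans h)// ler_piMr// ?mulr_ge0 ?exprn_ge0 ?invr_ge0 ?(ltW p)//.
    by rewrite lerBlDr lerDl exprn_ge0.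
  elim: m => [|m IH]; first by rewrite addn0 subrr (HS0 e).2 expr0 subrr mulr0.
  have -> : X n - X (n + m.+1)%N = (X n - X (n + m)%N) + (X (n + m)%N - X (n + m).+1).
    by rewrite addnS addrA subrK.
  have [_ h] := HSD (hB n (n + m)%N) (hB (n + m)%N (n + m).+1).
  rewrite (le_trans h)// (hsn_dist e (X (n + m)%N)).
  rewrite (le_trans (lerD IH (hd _)))// exprD exprS le_eqVlt; apply/orP; left; apply/eqP.
  by field; rewrite gt_eqF.
have colX k n : nm (X n.+1 (e k) - X n (e k)) <= c * q ^+ n.
  rewrite (le_trans (op_hs ip_norm resP fr (e k) (hB n.+1 n)))//.
  by rewrite (le_trans _ (hd n))// ler_piMr ?hsn_ge0// (nm_e ip_norm fr).
have ex k : exists y, X^~ (e k) @ \oo --> y.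
  by have [y [hy _]] := geometric_cvg q01 (colX k); exists y.
pose y k := projT1 (cid (ex k)).
have hy k : X^~ (e k) @ \oo --> y k by exact: projT2 (cid (ex k)).
have fatou (n : nat) (A : {fset K}) :
    \sum_(k <- A) nm (X n (e k) - y k) ^+ 2 <= (c * q ^+ n / (1 - q)) ^+ 2.
  pose S (r : seq K) (m : nat) := \sum_(k <- r) nm (X n (e k) - X m (e k)) ^+ 2.
  have Sc r : S r @ \oo --> \sum_(k <- r) nm (X n (e k) - y k) ^+ 2.
    elim: r => [|k r IH].
      by rewrite big_nil /S; under eq_fun do rewrite big_nil; exact: cvg_cst.
    rewrite big_cons /S; under eq_fun do rewrite big_cons; apply: cvgD => //.
    rewrite expr2; under eq_fun do rewrite expr2.
    by apply: cvgM; apply: nm_cvg; apply: cvgB => //; exact: cvg_cst.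
  apply: (cvgr_to_le (Sc A)).
  exists n => // m /= nm'; rewrite -(subnKC nm').
  apply: le_trans (HS_fin A (hB n (n + (m - n))%N)) _.
  rewrite ler_sqr ?nnegrE ?hsn_ge0//.
  by rewrite !mulr_ge0 ?exprn_ge0// invr_ge0 ltW.
have [||Y [bY Ye]] := @hs_columns y.
- move=> k k0; apply: (lim_unique _ (hy k)); rewrite k0.
  rewrite (_ : X^~ 0 = fun=> 0); first exact: cvg_cst.
  by apply/funext => n; rewrite (bo0 (hX n).1).
- pose D := 2 * (c * q ^+ 0 / (1 - q)) ^+ 2 + 2 * hsn e (X 0%N) ^+ 2.
  apply: (@le_lt_trans _ _ D%:E); last by rewrite ltry.
  apply/esum_le_fset => [k|A]; first exact: sqr_ge0.
  have h1 := fatou 0%N A; have h2 := HS_fin A (hX 0%N).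
  rewrite /D (le_trans _ (lerD (ler_wpM2l _ h1) (ler_wpM2l _ h2)))//.
  rewrite !mulr_sumr -big_split /=; apply: ler_sum => k _.
  have : nm (y k) <= nm (X 0%N (e k) - y k) + nm (X 0%N (e k)).
    by rewrite nmB -{1}(subrK (X 0%N (e k)) (y k)) nmD.
  have := nm_ge0 (y k); have := sqr_ge0 (nm (X 0%N (e k) - y k) - nm (X 0%N (e k))).
  nra.
have key n : HS e (X n - Y) /\ hsn e (X n - Y) <= c * q ^+ n / (1 - q).
  apply: HS_le_fin.
  - by apply: bo_sub => //; case: (hX n).
  - by rewrite !mulr_ge0 ?exprn_ge0// invr_ge0 ltW.
  - by move=> A; under eq_bigr do rewrite !opE Ye; exact: fatou.
exists Y; split; last by move=> n; case: (key n).
have -> : Y = X 0%N - (X 0%N - Y) by rewrite opprB addrC subrK.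
by have [] := HSB (hX 0%N) (key 0%N).1.
Qed.

End HSMatrices.

(** * The unperturbed operator *)

Section LinearOn.
Context {R : realType} {H : completeNormedModType R[i]}.
Variables (D : set H) (T : H -> H) (lin : linear_on D T).

Lemma on0 : D 0. Proof. by case: lin. Qed.
Lemma on_dom a x y : D x -> D y -> D (a *: x + y).
Proof. by case: lin => _ h _; exact: h. Qed.
Lemma onE a x y : D x -> D y -> T (a *: x + y) = a *: T x + T y.
Proof. by case: lin => _ _ h; exact: h. Qed.
Lemma onD_dom x y : D x -> D y -> D (x + y).
Proof. by move=> Dx Dy; rewrite -[x]scale1r; exact: on_dom. Qed.
Lemma onD x y : D x -> D y -> T (x + y) = T x + T y.
Proof. by move=> Dx Dy; rewrite -[X in X + y]scale1r onE// scale1r. Qed.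
Lemma onT0 : T 0 = 0.
Proof. by apply: (addrI (T 0)); rewrite -onD ?addr0//; exact: on0. Qed.
Lemma onZ_dom a x : D x -> D (a *: x).
Proof. by move=> Dx; rewrite -[_ *: _]addr0; apply: on_dom => //; exact: on0. Qed.
Lemma onZ a x : D x -> T (a *: x) = a *: T x.
Proof. by move=> Dx; rewrite -[a *: x]addr0 onE ?onT0 ?addr0//; exact: on0. Qed.
Lemma onN_dom x : D x -> D (- x).
Proof. by move=> Dx; rewrite -scaleN1r; exact: onZ_dom. Qed.
Lemma onN x : D x -> T (- x) = - T x.
Proof. by move=> Dx; rewrite -scaleN1r onZ// scaleN1r. Qed.
Lemma onB_dom x y : D x -> D y -> D (x - y).
Proof. by move=> Dx Dy; apply: onD_dom => //; exact: onN_dom. Qed.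
Lemma onB x y : D x -> D y -> T (x - y) = T x - T y.
Proof. by move=> Dx Dy; rewrite onD ?onN//; exact: onN_dom. Qed.
Lemma on_sum_dom (I : eqType) (r : seq I) (F : I -> H) :
  (forall i, i \in r -> D (F i)) -> D (\sum_(i <- r) F i).
Proof.
move=> h; rewrite big_seq; elim/big_ind : _ => //; first exact: on0.
by move=> x y; exact: onD_dom.
Qed.
Lemma on_sum (I : eqType) (r : seq I) (F : I -> H) :
  (forall i, i \in r -> D (F i)) -> T (\sum_(i <- r) F i) = \sum_(i <- r) T (F i).
Proof.
elim: r => [|a r IH] h; first by rewrite !big_nil onT0.
have hr i : i \in r -> D (F i) by move=> ir; apply: h; rewrite inE ir orbT.
rewrite !big_cons onD ?IH//; first by apply: h; rewrite mem_head.
exact: on_sum_dom.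
Qed.

Lemma closed_op_lim (S : Type) (F : set_system S) (FF : ProperFilter F)
  (u : S -> H) x y : closed_op D T -> (forall s, D (u s)) -> u @ F --> x ->
  (fun s => T (u s)) @ F --> y -> D x /\ T x = y.
Proof.
move=> cT Du ux Tu.
have : [set p : H * H | D p.1 /\ p.2 = T p.1] (x, y).
  apply: (closed_cvg _ cT _ (x, y) (cvg_pair ux Tu)).
  by apply: filterE => s /=.
by move=> [/= ? ->].
Qed.

End LinearOn.

Lemma nm_circle {R : realType} (r t : R) : 0 < r ->
  nm (r%:C * (cos t +i* sin t)) = r.
Proof.
move=> r0; rewrite nmM nmC gtr0_norm// (_ : nm (cos t +i* sin t) = 1) ?mulr1//.
by rewrite /nm normc_def /= cos2Dsin2 sqrtr1.
Qed.

Section Unperturbed.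
Context {R : realType} {H : completeNormedModType R[i]}.
Variables (ip : {dot H for Num.conj}) (ip_norm : scalar_product_norm ip).
Variables (DA : set H) (A : H -> H) (lam : int -> R[i]) (mult : int -> nat).
Variables (P : int -> H -> H) (hA : unperturbed ip DA A lam mult P).
Implicit Types (x y : H) (i j n : int) (N : nat).

Let lin := unp_linear hA.
Let resP := unp_resolution hA.

Lemma P_dom n x : DA (P n x).
Proof. by case: (unp_eigen hA n x). Qed.

Lemma A_P n x : A (P n x) = lam n *: P n x.
Proof. by case: (unp_eigen hA n x). Qed.

(** A commutes with its resolvents, hence with the Riemann sums that converge to
    P n, and A is closed. *)
Lemma P_A n x : DA x -> P n (A x) = lam n *: P n x.
Proof.
move=> Dx; have [r r0 [_ [S [hS cS]]]] := unp_riesz hA n.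
have SA z : nm (z - lam n) = r -> DA (S z x) /\ A (S z x) = S z (A x).
  move=> /hS[bS S1 S2]; have [DS e1] := S1 x; split => //.
  have := S2 _ Dx; rewrite (boB bS) (boZ bS) => e2.
  by apply: (addIr (- (z *: S z x))); rewrite e1 e2.
have wr k N : nm (lam n + r%:C * (cos (2 * pi * k%:R / N.+1%:R) +i* sin (2 * pi * k%:R / N.+1%:R)) - lam n) = r.
  by rewrite addrC addKr nm_circle.
suff [_ <-] : DA (P n x) /\ A (P n x) = P n (A x) by rewrite A_P.
apply: (closed_op_lim _ (F := \oo) (u := fun N => contour_sum S (lam n) r N x) (unp_closed hA)).
- move=> N; apply: (on_sum_dom lin) => k _ /=.
  by apply: (onZ_dom lin); apply: (onN_dom lin); case: (SA _ (wr k N)).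
- exact: cS.
- apply: cvg_trans (cS (A x)); apply: near_eq_cvg; near=> N.
  rewrite /contour_sum (on_sum lin) => [|k _].
    apply: eq_bigr => k _; have [D1 E1] := SA _ (wr k N).
    by rewrite (onZ lin) ?(onN lin) ?E1//; exact: (onN_dom lin).
  by apply: (onZ_dom lin); apply: (onN_dom lin); case: (SA _ (wr k N)).
Unshelve. all: by end_near. Qed.

(** Closedness of A, applied to the truncations of y. *)
Lemma in_dom y z : (forall n, P n z = lam n *: P n y) -> DA y /\ A y = z.
Proof.
move=> h.
have APb N : DA (Pblock P N y) /\ A (Pblock P N y) = Pblock P N z.
  rewrite !PblockE; split; first by apply: (on_sum_dom lin) => n _; exact: P_dom.
  rewrite (on_sum lin) => [|n _]; last exact: P_dom.
  by apply: eq_bigr => n _; rewrite A_P h.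
apply: (closed_op_lim _ (F := \oo) (u := fun N => Pblock P N y) (unp_closed hA)).
- by move=> N; case: (APb N).
- exact: (@Pb_cvg _ _ _ _ resP y).
- rewrite (_ : (fun N => _) = (fun N => Pblock P N z)); first exact: (@Pb_cvg _ _ _ _ resP z).
  by apply/funext => N; case: (APb N).
Qed.

Lemma eigenvector_P n x : DA x -> A x = lam n *: x -> P n x = x.
Proof.
move=> Dx Ax; apply: (P_ext resP) => j; rewrite (PP resP); case: eqVneq => // jn.
apply/eqP; rewrite eq_sym -(inj_eq (scalerI (_ : lam j - lam n != 0))) ?scaler0.
  by rewrite scalerBl -P_A// Ax (boZ (P_bo resP j)) subrr.
by rewrite subr_eq0 (inj_eq (unp_distinct hA)).
Qed.

Lemma unperturbed_frame : exists e, adapted_frame ip P mult e.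
Proof.
apply: (exists_adapted_frame ip_norm resP) => n.
have [_ [v hv] _] := unp_semisimple hA n.
have eq0 (c : 'I_(mult n) -> R[i]) : \sum_s c s *: v s = 0 -> c = fun=> 0.
  move=> c0; have /hv[u [hu uu]] : DA 0 /\ A 0 = lam n *: 0.
    by split; [exact: (on0 lin)|rewrite (onT0 lin) scaler0].
  rewrite -(uu c) ?c0//; apply: uu; rewrite big1// => i _; by rewrite scale0r.
exists v; split=> [i|x].
  have /hv[Dv Av] : exists! c : 'I_(mult n) -> R[i], v i = \sum_s c s *: v s.
    exists (fun s => (s == i)%:R); split.
      rewrite (bigD1 i)//= eqxx scale1r big1 ?addr0// => j /negbTE ji.
      by rewrite ji scale0r.
    move=> c hc; apply/funext => j.
    have /eq0/(congr1 (fun f => f j)) : \sum_s ((s == i)%:R - c s) *: v s = 0.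
      under eq_bigr do rewrite scalerBl; rewrite sumrB -hc (bigD1 i)//= eqxx scale1r.
      by rewrite big1 ?addr0 ?subrr// => k /negbTE ki; rewrite ki scale0r.
    by move/eqP; rewrite subr_eq0 => /eqP.
  exact: eigenvector_P.
have /hv[c [hc _]] : DA (P n x) /\ A (P n x) = lam n *: P n x.
  by split; [exact: P_dom|exact: A_P].
by exists c.
Qed.

(** Every single term of the sums in unp_separated is at most their supremum. *)
Lemma gap : exists2 del : R, 0 < del & forall i j, i != j -> del <= nm (lam i - lam j).
Proof.
have := unp_separated hA; set S := ereal_sup _ => fin.
have S0 : (0 <= S)%E.
  have : (\esum_(n in [set n : int | n != 0%R]) ((nm (lam n - lam 0%R)) ^- 2)%:E <= S)%E.
    by apply: ereal_sup_ubound; exists 0.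
  by apply: le_trans; apply: esum_ge0 => n _; rewrite lee_fin invr_ge0 sqr_ge0.
pose s := fine S; have SE : S = s%:E by rewrite fineK// ge0_fin_numE.
have s0 : 0 <= s by rewrite -lee_fin -SE.
exists ((1 + s)^-1).
  by rewrite invr_gt0 ltr_pwDl.
move=> i j ij; have p : 0 < nm (lam i - lam j).
  by rewrite lt_def nm_eq0 nm_ge0 andbT subr_eq0 (inj_eq (unp_distinct hA)).
have h : (nm (lam i - lam j)) ^- 2 <= s.
  rewrite -lee_fin -SE; apply: (@le_trans _ _ (\esum_(n in [set n | n != j]) ((nm (lam n - lam j)) ^- 2)%:E)%E).
    apply: esum_ge; exists [set i]; first by split => // _ /= ->.
    by rewrite fsbig_set1.
  by apply: ereal_sup_ubound; exists j.
rewrite -[leRHS]invrK lef_pV2 ?posrE ?invr_gt0 ?ltr_pwDl//.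
set t := (nm _)^-1 in h *; have t0 : 0 < t by rewrite invr_gt0.
have : t ^+ 2 <= s by rewrite exprVn.
have := sqr_ge0 (t - 1).
nra.
Qed.

(** The terms of a convergent sum of inverse squares tend to zero. *)
Lemma lam_far i (L : R) : exists N, forall j, (N < `|j|)%N -> L < nm (lam i - lam j).
Proof.
wlog L0 : L / 0 < L.
  move=> h; have [N hN] := h (`|L| + 1) (ltr_wpDl (normr_ge0 _) ltr01).
  exists N => j /hN; apply: le_lt_trans; rewrite (le_trans (ler_norm L))// lerDl.
  exact: ler01.
pose a n : R := if n == i then 0 else (nm (lam n - lam i)) ^- 2.
have a0 n : 0 <= a n by rewrite /a; case: ifP => // _; rewrite invr_ge0 sqr_ge0.
have fin : (\esum_(n in [set: int]) (a n)%:E < +oo)%E.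
  apply: le_lt_trans (unp_separated hA).
  apply: (@le_trans _ _ (\esum_(n in [set n | n != i]) ((nm (lam n - lam i)) ^- 2)%:E)%E).
    rewrite [leRHS]esum_mkcond; apply: le_esum => n _; rewrite /a.
    case: eqVneq => [->|ni]; first by case: ifP => //; rewrite lee_fin invr_ge0 sqr_ge0.
    by rewrite mem_set.
  by apply: ereal_sup_ubound; exists i.
have L2 : 0 < L ^- 2 by rewrite invr_gt0 exprn_gt0.
have [F hF] := esum_tail a0 fin L2.
have [N hN] := fset_irange F.
exists (maxn N `|i|) => j; rewrite gtn_max => /andP[Nj ij].
have jF : [disjoint F & [fset j]]%fset.
  rewrite fdisjointX1; apply/negP => /hN; by rewrite leqNgt Nj.
have := hF _ jF; rewrite big_seq_fset1 /a.
have ji : j != i by apply: contraTneq ij => ->; rewrite ltnn.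
rewrite (negbTE ji).
have p : 0 < nm (lam j - lam i).
  by rewrite lt_def nm_eq0 nm_ge0 andbT subr_eq0 (inj_eq (unp_distinct hA)).
rewrite ltf_pV2 ?posrE ?exprn_gt0//.
by rewrite ltr_sqr ?nnegrE ?nm_ge0 ?(ltW L0)// nmB.
Qed.

Lemma lam_far_from (z : R[i]) (L : R) :
  exists N, forall j, (N < `|j|)%N -> L < nm (lam j - z).
Proof.
have [N hN] := lam_far 0 (L + nm (lam 0 - z)).
exists N => j /hN h.
have := nm_dist z (lam 0) (lam j); rewrite (nmB z) => h2.
by rewrite -(ltrD2l (nm (lam 0 - z))) addrC (lt_le_trans h).
Qed.

(** The value of M on the domain of A is recovered from its values on the ranges
    of the P l; this replaces continuity for relatively bounded operators. *)
Definition A_continuous (M : H -> H) :=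
  forall y, DA y -> hassum (fun l => M (P l y)) (M y).

Lemma bo_A_continuous M : bounded_op M -> A_continuous M.
Proof. by move=> bM y _; exact: bo_hassum (P_hassum resP y). Qed.

Lemma A_continuousB M M' : A_continuous M -> A_continuous M' -> A_continuous (M - M').
Proof.
move=> h h' y Dy; rewrite sub_opE; apply: hassumD; first exact: h.
have bN : bounded_op (- idfun : H -> H) by apply: bo_opp; exact: bo_id.
exact: (bo_hassum bN (h' y Dy)).
Qed.

Lemma A_A_continuous : A_continuous A.
Proof.
move=> y Dy; rewrite (_ : (fun l => _) = fun l => P l (A y)); first exact: (P_hassum resP).
by apply/funext => l; rewrite P_A// A_P.
Qed.

(** The partial sums of y converge in the graph norm of A. *)
Lemma rel_bounded_A_continuous M (c : R) : linear_on DA M ->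
  (forall x, DA x -> nm (M x) <= c * (nm x + nm (A x))) -> A_continuous M.
Proof.
move=> linM hM y Dy; apply/hassum_nmP => eps eps0.
have p : 0 < `|c| + 1 by rewrite ltr_wpDl.
have e20 : 0 < eps / (`|c| + 1) / 2 by rewrite !divr_gt0.
have /hassum_nmP/(_ _ e20)[F1 hF1] := P_hassum resP y.
have /hassum_nmP/(_ _ e20)[F2 hF2] := A_A_continuous Dy.
exists (F1 `|` F2)%fset => F FF.
have {}hF1 := hF1 F (fsubset_trans (fsubsetUl _ _) FF).
have {}hF2 := hF2 F (fsubset_trans (fsubsetUr _ _) FF).
have DF : DA (\sum_(l <- F) P l y) by apply: (on_sum_dom lin) => l _; exact: P_dom.
rewrite -(on_sum linM); last by move=> l _; exact: P_dom.
rewrite -(onB linM)// (le_lt_trans (hM _ _))//; first exact: (onB_dom lin).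
rewrite (onB lin)// (on_sum lin); last by move=> l _; exact: P_dom.
apply: (@le_lt_trans _ _ (`|c| * (eps / (`|c| + 1)))).
  rewrite (le_trans (ler_wpM2r _ (ler_norm c)))// ?addr_ge0 ?nm_ge0//.
  by rewrite ler_wpM2l// (splitr (eps / _)) lerD// ltW.
by rewrite mulrCA gtr_pMr// ltr_pdivrMr// mul1r ltrDl.
Qed.

(** Both sides have the same coordinates along each P i, and the coordinates of a
    vector decide whether it belongs to the domain of A. *)
Lemma intertwine G M : bounded_op G -> A_continuous M ->
  (forall i j x, (lam i - lam j) *: P i (G (P j x)) = P i (M (P j x))) ->
  forall x, DA x -> DA (G x) /\ A (G x) = G (A x) + M x.
Proof.
move=> bG cM h x Dx; apply: in_dom => i.
have bPG := bo_comp (P_bo resP i) bG.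
have h1 := bo_hassum (P_bo resP i) (cM x Dx).
have h2 := bo_hassum bPG (P_hassum resP (A x)).
have h3 := bo_hassum (bo_scale (lam i) bPG) (P_hassum resP x).
rewrite (boD (P_bo resP i)).
apply: hassum_unique (hassumD h2 h1) _.
rewrite (_ : (fun _ => _) = fun j => (lam i *: (P i \o G)) (P j x)); first exact: h3.
apply/funext => j; rewrite -h P_A// (boZ bPG) scale_opE /=.
by rewrite -scalerDl addrC subrK.
Qed.

End Unperturbed.

(** * The transforms on bounded operators *)

Section Transforms.
Context {R : realType} {H : completeNormedModType R[i]}.
Variables (ip : {dot H for Num.conj}) (ip_norm : scalar_product_norm ip).
Variables (DA : set H) (A : H -> H) (lam : int -> R[i]) (mult : int -> nat).
Variables (P : int -> H -> H) (hA : unperturbed ip DA A lam mult P).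
Variables (e : int * nat -> H) (fr : adapted_frame ip P mult e).
Implicit Types (x y : H) (X Y : H -> H) (i j : int) (m k N : nat).

Let lin := unp_linear hA.
Let resP := unp_resolution hA.

Definition gam m i j : R[i] := if blk m i j then 0 else (lam i - lam j)^-1.

Lemma Gammat_eq m X Y : block_bounded P X -> bounded_op Y ->
  (forall i j, entry P Y i j = gam m i j *: entry P X i j) ->
  Gammat P lam m X = Y.
Proof.
move=> bbX bY hY; apply: (of_matrixE resP) => // i j; rewrite hY.
have [_ hJ] := Jt_spec ip_norm resP m bbX.
have XJ : entry P (X - Jt P m X) i j = entry P X i j - entry P (Jt P m X) i j.
  by apply/funext => x; rewrite sub_opE !entryE sub_opE (boB (P_bo resP i)).
rewrite XJ hJ /gam; case: eqVneq => [->|ij]; first by rewrite blk_diag scale0r.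
by case: ifP => _; rewrite ?subrr ?scaler0 ?scale0r// subr0.
Qed.

Lemma HS_bo X : HS e X -> bounded_op X. Proof. by case. Qed.

Lemma HS_block_bounded X : HS e X -> block_bounded P X.
Proof. by move=> /HS_bo; exact: (bo_block_bounded ip_norm resP). Qed.

Lemma Jt_entry k X : bounded_op X ->
  forall i j x, P i (Jt P k X (P j x)) = if blk k i j then P i (X (P j x)) else 0.
Proof.
move=> bX i j x; have [_ hJ] := Jt_spec ip_norm resP k (bo_block_bounded ip_norm resP bX).
have /(congr1 (fun f => f x)) := hJ i j; rewrite entryE => ->.
by case: ifP.
Qed.

Lemma Jt_bo k X : bounded_op X -> bounded_op (Jt P k X).
Proof. by move=> /(bo_block_bounded ip_norm resP) /(Jt_spec ip_norm resP k) []. Qed.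

Lemma Jt_HS k X : HS e X -> HS e (Jt P k X) /\ hsn e (Jt P k X) <= hsn e X.
Proof.
move=> hX; rewrite -[X in _ <= X]mul1r.
apply: (schur_dom ip_norm resP fr hX (Jt_bo k (HS_bo hX))) => // i j x.
by rewrite Jt_entry ?mul1r//; [case: ifP => _; rewrite ?nm0 ?nm_ge0|exact: (HS_bo hX)].
Qed.

Lemma JtD k X Y : bounded_op X -> bounded_op Y ->
  Jt P k (X + Y) = Jt P k X + Jt P k Y.
Proof.
move=> bX bY; have bXY := bo_add bX bY.
apply: (entry_inj resP); [exact: Jt_bo|by apply: bo_add; exact: Jt_bo|] => i j.
apply/funext => x; rewrite !entryE add_opE (boD (P_bo resP i)) !Jt_entry//.
by case: ifP => _; rewrite ?addr0// add_opE (boD (P_bo resP i)).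
Qed.

Lemma JtN k X : bounded_op X -> Jt P k (- X) = - Jt P k X.
Proof.
move=> bX; have bN := bo_opp bX.
apply: (entry_inj resP); [exact: Jt_bo|by apply: bo_opp; exact: Jt_bo|] => i j.
apply/funext => x; rewrite !entryE opp_opE (boN (P_bo resP i)) !Jt_entry//.
by case: ifP => _; rewrite ?oppr0// opp_opE (boN (P_bo resP i)).
Qed.

Lemma JtB k X Y : bounded_op X -> bounded_op Y ->
  Jt P k (X - Y) = Jt P k X - Jt P k Y.
Proof. by move=> bX bY; rewrite JtD ?JtN//; exact: bo_opp. Qed.

Lemma Jt_Jt m k X : (m <= k)%N -> block_bounded P X -> Jt P k (Jt P m X) = Jt P m X.
Proof.
move=> mk bbX; have [bJ hJ] := Jt_spec ip_norm resP m bbX.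
apply: (entry_inj resP) => //; first exact: Jt_bo.
move=> i j; apply/funext => x; rewrite entryE Jt_entry// -entryE hJ.
by case: (boolP (blk m i j)) => [/(blk_sub mk) ->|_] //; case: ifP.
Qed.

Lemma Jt_eq0 k X : bounded_op X -> (forall i j x, blk k i j -> P i (X (P j x)) = 0) ->
  Jt P k X = 0.
Proof.
move=> bX h; apply: (entry_inj resP); [exact: Jt_bo|exact: bo_zero|] => i j.
apply/funext => x; rewrite !entryE Jt_entry// zero_opE (bo0 (P_bo resP i)).
by case: ifP => // b; rewrite h.
Qed.

Definition block_diagonal k X := forall i j x, ~~ blk k i j -> P i (X (P j x)) = 0.
Definition block_offdiagonal k X := forall i j x, blk k i j -> P i (X (P j x)) = 0.

Lemma Jt_block_diagonal k X : block_bounded P X -> block_diagonal k (Jt P k X).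
Proof.
move=> bbX i j x b; have [_ hJ] := Jt_spec ip_norm resP k bbX.
by rewrite -entryE hJ (negbTE b).
Qed.

Lemma blk_trans k i j l : blk k i j -> blk k j l -> blk k i l.
Proof.
rewrite /blk => /orP[/andP[h1 h2]|/eqP ->//] /orP[/andP[h3 h4]|/eqP <-].
  by rewrite h1 h4.
by rewrite h1 h2.
Qed.

Lemma blk_sym k i j : blk k i j = blk k j i.
Proof. by rewrite /blk andbC eq_sym. Qed.

(** Being in the same block is an equivalence relation. *)
Lemma off_diag_comp k X V : bounded_op X -> bounded_op V ->
  block_offdiagonal k X -> block_diagonal k V -> block_offdiagonal k (X \o V).
Proof.
move=> bX bV oX dV i j x bij /=.
have h := bo_hassum (bo_comp (P_bo resP i) bX) (P_hassum resP (V (P j x))).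
apply: (hassum_unique h); rewrite (_ : (fun _ => _) = fun=> 0).
  by have := @hassum_fin _ _ _ (fun l : int => (0 : H)) fset0; rewrite big_seq_fset0; apply.
apply/funext => l /=; case: (boolP (blk k l j)) => b; last first.
  by rewrite dV// (bo0 bX) (bo0 (P_bo resP i)).
by apply: oX; apply: blk_trans bij _; rewrite blk_sym.
Qed.

Lemma diag_off_comp k X V : bounded_op X -> bounded_op V ->
  block_offdiagonal k X -> block_diagonal k V -> block_offdiagonal k (V \o X).
Proof.
move=> bX bV oX dV i j x bij /=.
have h := bo_hassum (bo_comp (P_bo resP i) bV) (P_hassum resP (X (P j x))).
apply: (hassum_unique h); rewrite (_ : (fun _ => _) = fun=> 0).
  by have := @hassum_fin _ _ _ (fun l : int => (0 : H)) fset0; rewrite big_seq_fset0; apply.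
apply/funext => l /=; case: (boolP (blk k i l)) => b; last first.
  by rewrite dV.
by rewrite oX ?(bo0 bV) ?(bo0 (P_bo resP i))//; apply: blk_trans bij; rewrite blk_sym.
Qed.

Section Gap.
Variables (del : R) (del0 : 0 < del).
Hypothesis gapP : forall i j, i != j -> del <= nm (lam i - lam j).

Lemma gam_le m i j : nm (gam m i j) <= del^-1.
Proof.
rewrite /gam; case: ifPn => [_|b]; first by rewrite nm0 invr_ge0 ltW.
have ij : i != j by apply: contraNneq b => ->; exact: blk_diag.
have d := gapP ij; rewrite nmV lef_pV2 ?posrE//.
exact: lt_le_trans d.
Qed.

(** The differences of eigenvalues are bounded below by del. *)
Lemma Gammat_spec k X : HS e X -> [/\ HS e (Gammat P lam k X),
  hsn e (Gammat P lam k X) <= del^-1 * hsn e X &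
  forall i j x, P i (Gammat P lam k X (P j x)) = gam k i j *: P i (X (P j x))].
Proof.
move=> hX; have d0 : 0 <= del^-1 by rewrite invr_ge0 ltW.
have [Y [hY nY eY]] := schur_exists ip_norm resP fr hX d0 (gam_le k).
rewrite (Gammat_eq (HS_block_bounded hX) (HS_bo hY) eY); split => // i j x.
exact: (congr1 (fun f => f x) (eY i j)).
Qed.

Lemma Gammat_off k X : HS e X -> block_offdiagonal k (Gammat P lam k X).
Proof.
by move=> hX i j x b; have [_ _ ->] := Gammat_spec k hX; rewrite /gam b scale0r.
Qed.

Lemma GammatB k X Y : HS e X -> HS e Y ->
  Gammat P lam k (X - Y) = Gammat P lam k X - Gammat P lam k Y.
Proof.
move=> hX hY; have [hXY _] := HSB hX hY.
have [h1 _ e1] := Gammat_spec k hXY; have [h2 _ e2] := Gammat_spec k hX.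
have [h3 _ e3] := Gammat_spec k hY.
apply: (entry_inj resP (HS_bo h1) (bo_sub (HS_bo h2) (HS_bo h3))) => i j.
apply/funext => x; rewrite !entryE e1 !sub_opE !(boB (P_bo resP i)) e2 e3.
by rewrite scalerBr.
Qed.

Lemma gam_intertwine k X (bX : bounded_op X) (Y : H -> H) :
  (forall i j x, P i (Y (P j x)) = gam k i j *: P i (X (P j x))) ->
  forall i j x, (lam i - lam j) *: P i (Y (P j x)) = P i ((X - Jt P k X) (P j x)).
Proof.
move=> h i j x; rewrite h scalerA sub_opE (boB (P_bo resP i)) Jt_entry// /gam.
case: ifPn => b; first by rewrite mulr0 scale0r subrr.
have ij : i != j by apply: contraNneq b => ->; exact: blk_diag.
by rewrite mulfV ?scale1r ?subr0// subr_eq0 (inj_eq (unp_distinct hA)).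
Qed.

End Gap.

(** Mapping the domain of A onto itself. The resolvent S intertwines G with
    G + M S, and the latter is a contraction for the norm |x| + K |S x|, which
    measures S x in the graph norm of A. *)
Lemma domain_bijection G M (z : R[i]) S (C : R) : bounded_op G ->
  (forall x, nm (G x) <= 4^-1 * nm x) ->
  linear_on DA M ->
  (forall x, DA x -> DA (G x) /\ A (G x) = G (A x) + M x) ->
  is_resolvent DA A z S -> 0 < C ->
  (forall x, nm (M (S x)) <= 4^-1 * nm x + C * nm (S x)) ->
  cont_invertible (idfun + G) /\ forall x, DA (x + G x) <-> DA x.
Proof.
move=> bG hG linM hM [bS S1 S2] C0 hMS.
have [s s0 hs] := bo_bound bS.
have q14 : 0 <= (4^-1 : R) < 1 by apply/andP; split; lra.
have [Y invY] := neumann_small bG q14 hG.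
have bI : bounded_op (idfun + G) by apply: bo_add => //; exact: bo_id.
split; first by split => //; exists Y.
move=> x; split=> [Dy|Dx]; last by have [Dg _] := hM x Dx; exact: (onD_dom lin).
pose G' : H -> H := G + (M \o S).
have MSlin a u v : M (S (a *: u + v)) = a *: M (S u) + M (S v).
  by have [Du _] := S1 u; have [Dv _] := S1 v; rewrite (boP bS) (onE linM).
have bMS : bounded_op (M \o S).
  apply: (@bo_intro _ _ _ (4^-1 + C * s)) => [a u v|u] /=; first exact: MSlin.
  by rewrite (le_trans (hMS u))// mulrDl lerD2l -mulrA ler_pM2l.
have bG' : bounded_op G' := bo_add bG bMS.
have GS u : G (S u) = S (G' u).
  have [DS AS] := S1 u; have [DGS AGS] := hM _ DS.
  have := S2 _ DGS; rewrite AGS => <-; congr (S _).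
  have Gu : G u = G (A (S u)) - z *: G (S u) by rewrite -(boZ bG) -(boB bG) AS.
  by rewrite /G' add_opE /= Gu addrAC.
(* C = K / 4, so that G' halves both terms of Nn *)
pose K := 4 * C; have K0 : 0 < K by rewrite mulr_gt0.
pose Nn u := nm u + K * nm (S u).
have Nn_le u : Nn (G' u) <= 2^-1 * Nn u.
  rewrite /Nn -GS; have h1 := hG (S u); have h2 := hG u; have h3 := hMS u.
  have h4 : nm (G' u) <= nm (G u) + nm (M (S u)) by exact: nmD.
  have : K * nm (G (S u)) <= K * (4^-1 * nm (S u)) by rewrite ler_pM2l.
  rewrite /K in K0 *; lra.
have iterN n u : nm (iter n G' u) <= (1 + K * s) * 2^-1 ^+ n * nm u.
  have h : Nn (iter n G' u) <= 2^-1 ^+ n * Nn u.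
    elim: n => [|n IH]; first by rewrite expr0 mul1r.
    rewrite iterS (le_trans (Nn_le _))// exprS -mulrA ler_wpM2l//.
  apply: (@le_trans _ _ (Nn (iter n G' u))).
    by rewrite lerDl mulr_ge0 ?nm_ge0 ?ltW.
  have hN : Nn u <= (1 + K * s) * nm u.
    by rewrite /Nn mulrDl mul1r lerD2l -mulrA ler_pM2l.
  rewrite (le_trans h)// (mulrC (1 + K * s)) -mulrA.
  by apply: ler_wpM2l hN; apply: exprn_ge0.
have [Y' [bY' _ Y'K]] : exists Y', is_inverse (idfun + G') Y'.
  by apply: (neumann bG' _ iterN); apply/andP; split; lra.
pose w := A (x + G x) - z *: (x + G x).
have Sw : S w = x + G x by exact: S2.
have -> : x = S (Y' w).
  have [_ WK _] := invY; apply: (can_inj WK); rewrite !add_opE /=.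
  by rewrite GS -(boD bS) -[Y' w + _]/((idfun + G') (Y' w)) Y'K Sw.
by case: (S1 (Y' w)).
Qed.

End Transforms.

(** * The transforms of the perturbation *)

Section Perturbation.
Context {R : realType} {H : completeNormedModType R[i]}.
Variables (ip : {dot H for Num.conj}) (ip_norm : scalar_product_norm ip).
Variables (DA : set H) (A B : H -> H) (lam : int -> R[i]) (mult : int -> nat).
Variables (P : int -> H -> H) (hA : unperturbed ip DA A lam mult P).
Variables (hB : perturbation ip DA A B lam P).
Variables (e : int * nat -> H) (fr : adapted_frame ip P mult e).
Implicit Types (x y : H) (X Y : H -> H) (i j : int) (m k N : nat).

Let lin := unp_linear hA.
Let resP := unp_resolution hA.
Let linB := per_linear hB.

Lemma B_A_continuous : A_continuous DA P B.
Proof.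
have [c _ hc] := per_bounded hB.
exact: (rel_bounded_A_continuous hA linB hc).
Qed.

Lemma BP_bo j : bounded_op (B \o P j).
Proof.
have [c c0 hc] := per_bounded hB.
apply: (@bo_intro _ _ _ (c * (1 + nm (lam j)))) => [a x y|x] /=.
  by rewrite (boP (P_bo resP j)) (onE linB)//; exact: (P_dom hA).
rewrite (le_trans (hc _ (P_dom hA j x)))// (A_P hA) nmZ -mulrA ler_pM2l//.
by rewrite mulrDl mul1r lerD ?ler_wpM2l ?nm_ge0// (P_le ip_norm resP).
Qed.

Lemma BPb N x : B (Pblock P N x) = \sum_(n <- irange N) B (P n x).
Proof. by rewrite PblockE (on_sum linB)// => n _; exact: (P_dom hA). Qed.

Lemma Bentry_bo i j : bounded_op (entry P B i j).
Proof. exact: (bo_comp (P_bo resP i) (BP_bo j)). Qed.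

Lemma Bentry_HS i j : HS e (entry P B i j).
Proof.
have [bP [c c0 hc]] := (P_bo resP i, bo_bound (P_bo resP i)).
by have [] := HS_comp bP c0 hc (HS_P ip_norm resP fr (BP_bo j)).
Qed.

Lemma Bdiag_sum : (\esum_(n in [set: int]) hs2 e (entry P B n n) < +oo)%E.
Proof.
apply: le_lt_trans (per_diagonal hB); apply: le_esum => n _.
by rewrite (hsnorm2E ip_norm resP fr (Bentry_bo n n)).
Qed.

(** Each P j has a finite-dimensional range in the domain of A, and the diagonal
    blocks are bounded together by per_diagonal. *)
Lemma B_block_bounded : block_bounded P B.
Proof.
split; [exact: BP_bo|exact: BPb|].
pose a n := hsn e (entry P B n n) ^+ 2.
have fin := Bdiag_sum.
have eqa : (\esum_(n in [set: int]) hs2 e (entry P B n n) = \esum_(n in [set: int]) (a n)%:E)%E.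
  by apply: eq_esum => n _; rewrite (hs2_hsn (Bentry_HS n n)).
rewrite eqa in fin.
have a0 n : 0 <= a n by exact: sqr_ge0.
have [F hF] := esum_tail a0 fin ltr01.
pose c := 1 + \sum_(n <- F) hsn e (entry P B n n).
have c1 : 1 <= c by rewrite lerDl sumr_ge0// => n _; exact: hsn_ge0.
exists c; first by apply: le_trans c1.
move=> n x; have -> : P n (B (P n x)) = entry P B n n (P n x) by rewrite entryE (P_idem resP).
rewrite (le_trans (op_hs ip_norm resP fr _ (Bentry_HS n n)))// ler_wpM2r ?nm_ge0//.
have [nF|nF] := boolP (n \in F).
  rewrite /c (big_fsetD1 n)//= addrCA lerDl addr_ge0// sumr_ge0// => j _.
  exact: hsn_ge0.
apply: le_trans c1; have := hF [fset n]%fset; rewrite fdisjointX1 nF => /(_ isT).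
rewrite big_seq_fset1 /a => /ltW; rewrite -[X in _ <= X](expr1n R 2).
by rewrite ler_sqr ?nnegrE ?hsn_ge0.
Qed.

Lemma JB_bo m : bounded_op (Jt P m B).
Proof. by case: (Jt_spec ip_norm resP m B_block_bounded). Qed.

Lemma JB_entry m i j x :
  P i (Jt P m B (P j x)) = if blk m i j then P i (B (P j x)) else 0.
Proof.
have [_ h] := Jt_spec ip_norm resP m B_block_bounded.
by have /(congr1 (fun f => f x)) := h i j; rewrite entryE => ->; case: ifP.
Qed.

Lemma JB0_HS : HS e (Jt P 0 B).
Proof.
split; first exact: JB_bo.
rewrite -(hs2_entries ip_norm resP fr (JB_bo 0)).
rewrite -(@esum_pair _ _ _ (fun i j => hs2 e (entry P (Jt P 0 B) i j))); last first.
  by move=> i j; exact: hs2_ge0.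
apply: le_lt_trans Bdiag_sum; apply: le_esum => i _.
rewrite [leRHS](_ : _ = (\esum_(j in [set: int]) (if j == i then hsn e (entry P B i i) ^+ 2 else 0)%:E)%E).
  apply: le_esum => j _; case: eqVneq => [->|ji].
    rewrite -hs2_hsn; last exact: Bentry_HS.
    apply: le_esum => k _; rewrite lee_fin !entryE JB_entry blk_diag//.
  rewrite /hs2 esum1// => k _; rewrite entryE JB_entry (_ : blk 0 i j = false) ?nm0 ?expr0n//.
  apply/negbTE; rewrite /blk negb_or eq_sym ji andbT; apply: contra ji.
  by rewrite !leqn0 !absz_eq0 => /andP[/eqP -> /eqP ->].
rewrite (@esum_single _ _ _ i) ?eqxx ?sqr_ge0//; last by move=> j /negbTE ->.
by rewrite -hs2_hsn//; exact: Bentry_HS.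
Qed.

Lemma JB_HS m : HS e (Jt P m B).
Proof.
pose F := \sum_(i <- irange m) \sum_(j <- irange m | j != i) entry P B i j.
have hF : HS e F.
  by apply: HS_sum => i _; apply: HS_sum => j _; exact: Bentry_HS.
suff -> : Jt P m B = Jt P 0 B + F by have [] := HSD JB0_HS hF.
apply: (entry_inj resP); [exact: JB_bo|by apply: bo_add; [exact: JB_bo|case: hF]|].
move=> i j; apply/funext => x.
have FE : P i (F (P j x)) = if [&& (`|i| <= m)%N, (`|j| <= m)%N & i != j] then P i (B (P j x)) else 0.
  have in1 i' : P i ((\sum_(j' <- irange m | j' != i') entry P B i' j') (P j x)) =
      if i == i' then (\sum_(j' <- irange m | j' != i') entry P B i' j') (P j x) else 0.
    rewrite fct_sumE (bo_sumE (P_bo resP i)); case: eqVneq => [->|ii].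
      by apply: eq_bigr => j' _; rewrite entryE (P_idem resP).
    by rewrite big1// => j' _; rewrite entryE (PP resP) (negbTE ii).
  rewrite /F fct_sumE (bo_sumE (P_bo resP i)) -!mem_irange.
  under eq_bigr do rewrite in1.
  case: (boolP (i \in irange m)) => im /=; last first.
    by rewrite big_seq big1// => i' i'm; case: eqVneq im => // ->; rewrite i'm.
  rewrite (bigD1_seq i) ?irange_uniq//= eqxx [X in _ + X]big1 ?addr0 => [|i' /negbTE ii]; last first.
    by rewrite eq_sym ii.
  rewrite fct_sumE.
  have in2 j' : entry P B i j' (P j x) = if j' == j then P i (B (P j x)) else 0.
    rewrite entryE (PP resP); case: eqVneq => // [->//|_].
    by rewrite (onT0 linB) (bo0 (P_bo resP i)).
  under eq_bigr do rewrite in2.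
  case: (boolP (j \in irange m)) => jm /=; last first.
    by rewrite big_seq_cond big1// => j' /andP[j'm _]; case: eqVneq jm => // <-; rewrite j'm.
  rewrite big_mkcond (bigD1_seq j) ?irange_uniq//= eqxx [X in _ + X]big1 ?addr0 => [|j' /negbTE ->].
    by rewrite eq_sym; case: ifP.
  by rewrite if_same.
rewrite !entryE add_opE (boD (P_bo resP i)) !JB_entry FE /blk.
case: (eqVneq i j) => [->|ij]; first by rewrite !orbT !andbF addr0.
rewrite !orbF andbT /= !leqn0.
have -> : (absz i == 0)%N && (absz j == 0)%N = false.
  by apply/negbTE; apply: contra ij; rewrite !absz_eq0 => /andP[/eqP -> /eqP ->].
by rewrite add0r.
Qed.

Lemma hs2Z_le (a : R[i]) X : HS e X -> (hs2 e (a *: X) <= hs2 e X * (nm a ^+ 2)%:E)%E.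
Proof.
move=> hX; have [h1 h2] := HSZ a hX.
rewrite (hs2_hsn h1) (hs2_hsn hX) -EFinM lee_fin -exprMn mulrC.
by rewrite ler_sqr ?nnegrE ?mulr_ge0 ?nm_ge0 ?hsn_ge0// mulrC.
Qed.

(** The assumption per_summable1 says that the matrix of Gamma_m B is square summable. *)
Lemma GB_spec m : HS e (Gammat P lam m B) /\
  forall i j x, P i (Gammat P lam m B (P j x)) = gam lam m i j *: P i (B (P j x)).
Proof.
have [||||Y [hY eY]] := @hs_of_matrix _ _ _ ip_norm _ resP _ _ fr
    (fun i j => gam lam m i j *: entry P B i j).
- by move=> i j; apply: bo_scale; exact: Bentry_bo.
- by move=> i j x; rewrite !scale_opE !entryE (P_idem resP).
- by move=> i j x; rewrite !scale_opE (boZ (P_bo resP i)) !entryE (P_idem resP).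
- apply: le_lt_trans (per_summable1 hB).
  rewrite [leRHS]esum_mkcond; apply: le_esum => -[i j] _ /=.
  case: (eqVneq i j) => [->|ij].
    rewrite /gam blk_diag scale0r (_ : hs2 _ _ = 0%E).
      by case: ifP => // _; rewrite mule_ge0 ?lee_fin ?invr_ge0 ?sqr_ge0// (hsnorm2E ip_norm resP fr) ?hs2_ge0//; exact: Bentry_bo.
    by apply: esum1 => k _; rewrite zero_opE nm0 expr0n.
  rewrite mem_set// (hsnorm2E ip_norm resP fr (Bentry_bo i j)).
  rewrite (le_trans (hs2Z_le _ (Bentry_HS i j)))// lee_wpmul2l ?hs2_ge0// lee_fin.
  rewrite /gam; case: ifP => _; first by rewrite nm0 expr0n invr_ge0 sqr_ge0.
  by rewrite nmV exprVn.
have -> : Gammat P lam m B = Y.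
  by apply: (Gammat_eq ip_norm hA B_block_bounded) => //; case: hY.
by split => // i j x; exact: (congr1 (fun f => f x) (eY i j)).
Qed.

(** The entries with both indices at most m are removed, so a tail remains. *)
Lemma GB_small (eps : R) : 0 < eps ->
  exists N, forall m, (N <= m)%N -> hsn e (Gammat P lam m B) <= eps.
Proof.
move=> eps0; have [h0 e0] := GB_spec 0.
have [N hN] := hs_tail ip_norm resP fr h0 eps0.
exists N => m Nm; have [hm em] := GB_spec m.
have [||| _] := hN (Gammat P lam m B) 1.
- by case: hm.
- exact: ler01.
- move=> i j x; rewrite em e0 /gam; case: (boolP (blk m i j)) => b.
    by rewrite scale0r nm0 mulr_ge0 ?nm_ge0//; case: ifP.
  rewrite (negbTE (contraNN (blk_sub (leq0n m)) b)) ifN ?mul1r//.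
  apply: contra b => /andP[hi hj].
  by rewrite /blk (leq_trans hi Nm) (leq_trans hj Nm).
- by rewrite mul1r.
Qed.

Lemma BJ_linear m : linear_on DA (B - Jt P m B).
Proof.
split=> [|a x y|a x y Dx Dy]; [exact: (on0 lin)|exact: (on_dom lin)|].
rewrite !sub_opE (onE linB)// (boP (JB_bo m)) scalerBr opprD addrACA //.
Qed.

Lemma BJ_continuous m : A_continuous DA P (B - Jt P m B).
Proof.
apply: A_continuousB B_A_continuous _.
exact: (bo_A_continuous hA (JB_bo m)).
Qed.

Lemma GB_intertwine m x : DA x -> DA (Gammat P lam m B x) /\
  A (Gammat P lam m B x) = Gammat P lam m B (A x) + (B - Jt P m B) x.
Proof.
have [[bG _] eG] := GB_spec m.
apply: (intertwine hA bG (BJ_continuous m)) => i j {}x.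
rewrite eG scalerA sub_opE (boB (P_bo resP i)) JB_entry /gam.
case: ifPn => b; first by rewrite mulr0 scale0r subrr.
have ij : i != j by apply: contraNneq b => ->; exact: blk_diag.
by rewrite mulfV ?scale1r ?subr0// subr_eq0 (inj_eq (unp_distinct hA)).
Qed.

(** The sum defining the matrix product is the value of B on the expansion of a
    vector of the domain of A. *)
Lemma mulGammaE i j x :
  mulGamma_entry P lam B i j x = P i (B (Gammat P lam 0 B (P j x))).
Proof.
have [[bG _] eG] := GB_spec 0.
have [Dy _] := GB_intertwine 0 (P_dom hA j x).
set y := Gammat P lam 0 B (P j x) in Dy *.
have h := bo_hassum (P_bo resP i) (B_A_continuous Dy).
apply: hassum_lim; rewrite (_ : (fun _ => _) = fun l => P i (B (P l y)))//.
apply/funext => l; rewrite /y eG /gam.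
have [->|lj] := eqVneq l j.
  by rewrite blk_diag scale0r (onT0 linB) (bo0 (P_bo resP i)).
have -> : blk 0 l j = false.
  apply/negbTE; rewrite /blk negb_or lj andbT; apply: contra lj.
  by rewrite !leqn0 !absz_eq0 => /andP[/eqP -> /eqP ->].
rewrite (onZ linB); last exact: (P_dom hA).
by rewrite (boZ (P_bo resP i)) scale_opE /= /entry /= (P_idem resP).
Qed.

(** The assumption per_summable2 makes the matrix of B (Gamma B) square summable; the
    operator with this matrix agrees with B (Gamma B) on the domain of A because
    the latter is relatively bounded. *)
Lemma BG0_exists : exists Z, HS e Z /\
  forall x, DA x -> Z x = B (Gammat P lam 0 B x).
Proof.
have [[bG _] eG] := GB_spec 0; set G := Gammat P lam 0 B in bG eG *.
have [c c0 hc] := per_bounded hB.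
have BGP j : bounded_op (B \o G \o P j).
  have [g g0 hg] := bo_bound bG.
  have bBJ : bounded_op ((B - Jt P 0 B) \o P j).
    exact: (bo_sub (BP_bo j) (bo_comp (JB_bo 0) (P_bo resP j))).
  have [b b0 hb] := bo_bound bBJ.
  apply: (@bo_intro _ _ _ (c * (g + (g * nm (lam j) + b)))) => [a x y|x] /=.
    rewrite (boP (P_bo resP j)) (boP bG) (onE linB)//.
      by case: (GB_intertwine 0 (P_dom hA j x)).
    by case: (GB_intertwine 0 (P_dom hA j y)).
  have [Dy Ay] := GB_intertwine 0 (P_dom hA j x).
  rewrite (le_trans (hc _ Dy))// -mulrA ler_pM2l// Ay (A_P hA) !mulrDl.
  apply: lerD; first by rewrite (le_trans (hg _))// ler_wpM2l// (P_le ip_norm resP).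
  rewrite (le_trans (nmD _ _))//; apply: lerD; last exact: hb.
  rewrite (le_trans (hg _))// nmZ -mulrA !ler_wpM2l ?nm_ge0//.
  exact: (P_le ip_norm resP).
have bM i j : bounded_op (P i \o B \o G \o P j) by exact: (bo_comp (P_bo resP i) (BGP j)).
have ME i j : mulGamma_entry P lam B i j = P i \o B \o G \o P j.
  by apply/funext => x; rewrite mulGammaE.
have [||||Z [hZ eZ]] := @hs_of_matrix _ _ _ ip_norm _ resP _ _ fr
    (fun i j => P i \o B \o G \o P j).
- exact: bM.
- by move=> i j x /=; rewrite (P_idem resP).
- by move=> i j x /=; rewrite (P_idem resP).
- apply: le_lt_trans (per_summable2 hB); apply: le_esum => -[i j] _ /=.
  by rewrite ME (hsnorm2E ip_norm resP fr (bM i j)).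
exists Z; split => // x Dx.
have bZ : bounded_op Z by case: hZ.
have h1 := bo_hassum bZ (P_hassum resP x).
apply: (hassum_unique h1).
rewrite (_ : (fun _ => _) = fun l => B (G (P l x))); last first.
  apply/funext => l; apply: (P_ext resP) => i.
  by have /(congr1 (fun f => f x)) := eZ i l.
have BGlin : linear_on DA (B \o G).
  split=> [|a u v|a u v Du Dv]; [exact: (on0 lin)|exact: (on_dom lin)|].
  rewrite /= (boP bG) (onE linB)//; first by case: (GB_intertwine 0 Du).
  by case: (GB_intertwine 0 Dv).
have [g g0 hg] := bo_bound bG; have [b b0 hb] := bo_bound (JB_bo 0).
apply: (@rel_bounded_A_continuous _ _ _ _ _ _ _ _ hA (B \o G) (c * (2 * g + c + b)) BGlin) => //.
move=> u Du /=; have [Dy Ay] := GB_intertwine 0 Du.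
rewrite (le_trans (hc _ Dy))// -mulrA ler_pM2l// Ay sub_opE.
have h2 := hg u; have h3 := hg (A u); have h4 := hb u; have h5 := hc _ Du.
have h6 : nm (G (A u) + (B u - Jt P 0 B u)) <= nm (G (A u)) + (nm (B u) + nm (Jt P 0 B u)).
  by rewrite (le_trans (nmD _ _))// lerD2l nmBD.
have n1 := nm_ge0 u; have n2 := nm_ge0 (A u).
have m1 : 0 <= g * nm (A u) by rewrite mulr_ge0.
have m2 : 0 <= b * nm (A u) by rewrite mulr_ge0.
have m3 : 0 <= g * nm u by rewrite mulr_ge0.
have m4 : 0 <= c * nm u by rewrite mulr_ge0// ltW.
have m5 : 0 <= c * nm (A u) by rewrite mulr_ge0// ltW.
rewrite -/G; nra.
Qed.

Lemma G_cut m : Gammat P lam m B =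
  Gammat P lam 0 B - (Pblock P m \o Gammat P lam 0 B \o Pblock P m).
Proof.
have [[b0 _] e0] := GB_spec 0; have [[bm _] em] := GB_spec m.
have bPb := Pb_bo resP m.
apply: (entry_inj resP) => //.
  by apply: bo_sub => //; exact: (bo_comp (bo_comp bPb b0) bPb).
move=> i j; apply/funext => x.
rewrite !entryE sub_opE (boB (P_bo resP i)) /= (P_Pb resP) (Pb_P resP) em e0.
have [ij|ij] := eqVneq i j.
  rewrite -ij /gam !blk_diag scale0r sub0r.
  case: (leqP (absz i) m) => hi; last by rewrite oppr0.
  by rewrite e0 /gam blk_diag scale0r oppr0.
have b0f : blk 0 i j = false.
  apply/negbTE; rewrite /blk negb_or ij andbT; apply: contra ij.
  by rewrite !leqn0 !absz_eq0 => /andP[/eqP -> /eqP ->].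
rewrite /gam b0f /blk (negbTE ij) orbF.
case: (leqP (absz i) m) => hi; last by rewrite subr0.
case: (leqP (absz j) m) => hj; rewrite /= ?(bo0 b0) ?(bo0 (P_bo resP i)) ?subr0//.
by rewrite e0 /gam b0f subrr scale0r.
Qed.

Lemma BG_exists m : exists Z, HS e Z /\
  forall x, DA x -> Z x = B (Gammat P lam m B x).
Proof.
have [Z [hZ ZE]] := BG0_exists; have [h0 e0] := GB_spec 0.
have bPb := Pb_bo resP m.
have bBPb : bounded_op (B \o Pblock P m).
  rewrite (_ : B \o _ = \sum_(n <- irange m) (B \o P n)).
    by apply: bo_sum => n _; exact: BP_bo.
  by apply/funext => x; rewrite fct_sumE /= BPb.
have GPb : HS e (Gammat P lam 0 B \o Pblock P m).
  have bb := bo_comp h0.1 bPb.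
  rewrite (_ : _ \o _ = \sum_(n <- irange m) (Gammat P lam 0 B \o P n)).
    apply: HS_sum => n _; apply: (HS_P ip_norm resP fr).
    exact: (bo_comp h0.1 (P_bo resP n)).
  by apply/funext => x; rewrite fct_sumE /= PblockE (bo_sumE h0.1).
have [c c0 hc] := bo_bound bBPb.
have [hF _] := HS_comp bBPb c0 hc GPb.
exists (Z - ((B \o Pblock P m) \o (Gammat P lam 0 B \o Pblock P m))).
split; first by have [] := HSB hZ hF.
move=> x Dx; have [D1 _] := GB_intertwine 0 Dx.
have D2 : DA (Pblock P m (Gammat P lam 0 B (Pblock P m x))).
  by rewrite PblockE; apply: (on_sum_dom lin) => n _; exact: (P_dom hA).
by rewrite sub_opE ZE// (G_cut m); exact: (esym (onB linB D1 D2)).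
Qed.

Lemma bounded_extensionE X Z : bounded_op Z -> (forall x, DA x -> Z x = X x) ->
  bounded_extension DA X = Z.
Proof.
move=> bZ hZ.
have ex : exists Y, [set Y | bounded_op Y /\ forall x, DA x -> Y x = X x] Y by exists Z.
have [bY hY] : bounded_op (bounded_extension DA X) /\
  forall x, DA x -> bounded_extension DA X x = X x by exact: (xgetPex 0 ex).
apply: (entry_inj resP) => // i j; apply/funext => x.
by rewrite !entryE hY ?hZ//; exact: (P_dom hA).
Qed.

(** By per_small the off-diagonal part of B is Y (A - z) with a small Y, and J_m B is
    bounded. *)
Lemma BJ_relative_bound m (eps : R) : 0 < eps -> exists (z : R[i]) S (C : R),
  [/\ is_resolvent DA A z S, 0 < C &
   forall x, nm ((B - Jt P m B) (S x)) <= eps * nm x + C * nm (S x)].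
Proof.
move=> eps0; have [z [Y [[S hS] bY eY Yeps]]] := per_small hB eps0.
have [bS S1 S2] := hS.
have offB y : DA y -> (B - Jt P 0 B) y = Y (A y - z *: y).
  move=> Dy; apply: (hassum_unique (BJ_continuous 0 Dy)).
  have h := bo_hassum bY (P_hassum resP (A y - z *: y)).
  rewrite (_ : (fun _ => _) = fun l => Y (P l (A y - z *: y)))//.
  apply/funext => l; apply: (P_ext resP) => i.
  have /(congr1 (fun f => f y)) := eY i l; rewrite entryE => e1.
  rewrite (boB (P_bo resP l)) (P_A hA)// (boZ (P_bo resP l)) -scalerBl.
  rewrite (boZ bY) (boZ (P_bo resP i)) e1 sub_opE (boB (P_bo resP i)) JB_entry.
  have [il|il] := eqVneq i l; first by rewrite il blk_diag subrr /= scaler0.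
  have -> : blk 0 i l = false.
    apply/negbTE; rewrite /blk negb_or il andbT; apply: contra il.
    by rewrite !leqn0 !absz_eq0 => /andP[/eqP -> /eqP ->].
  rewrite subr0 scale_opE scalerA mulfV ?scale1r//.
  rewrite subr_eq0; apply/eqP => lz.
  have : spectrum DA A (lam l) by rewrite (unp_spectrum hA); exists l.
  by apply; rewrite lz; exists S.
have bD := bo_sub (JB_bo 0) (JB_bo m).
have [C C0 hC] := bo_bound bD.
exists z, S, (C + 1); split => //; first by rewrite ltr_wpDl.
move=> x; have [Dx Ex] := S1 x.
have -> : (B - Jt P m B) (S x) = (B - Jt P 0 B) (S x) + (Jt P 0 B - Jt P m B) (S x).
  by rewrite !sub_opE addrA subrK.
rewrite offB// Ex (le_trans (nmD _ _))// lerD//.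
  by rewrite (le_trans (opnormP _ bY))// ler_wpM2r ?nm_ge0// ltW.
by rewrite (le_trans (hC _))// ler_wpM2r ?nm_ge0// lerDl.
Qed.

End Perturbation.

(** * The fixed point of Phi *)

(** The variables K and L stand for J_k Q and for J_k (Q G). *)
Lemma perturbed_difference {R : realType} {H : completeNormedModType R[i]}
    (Q G G' K L L' : H -> H) : bounded_op Q -> bounded_op G' ->
  ((Q \o G) - (G \o K) - (G \o L) + Q) - ((Q \o G') - (G' \o K) - (G' \o L') + Q) =
  ((Q \o (G - G')) - ((G - G') \o K)) - (((G - G') \o L) + (G' \o (L - L'))).
Proof.
move=> bQ bG'; apply/funext => x.
rewrite !(add_opE, opp_opE) /= !(add_opE, opp_opE) (boB bQ) (boB bG').
rewrite (addrA (G (L x) - _)) subrK.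
rewrite [in LHS]opprD addrACA subrr addr0 !opprB.
rewrite (addrC (G' (L' x))) addrACA ?opprB; congr (_ + _); last by rewrite addrC.
by rewrite (addrC (G' (K x)) (- _)) addrACA (addrC (- G (K x))).
Qed.

Section FixedPoint.
Context {R : realType} {H : completeNormedModType R[i]}.
Variables (ip : {dot H for Num.conj}) (ip_norm : scalar_product_norm ip).
Variables (DA : set H) (A : H -> H) (lam : int -> R[i]) (mult : int -> nat).
Variables (P : int -> H -> H) (hA : unperturbed ip DA A lam mult P).
Variables (e : int * nat -> H) (fr : adapted_frame ip P mult e).
Variables (del : R) (del0 : 0 < del).
Hypothesis gapP : forall i j : int, i != j -> del <= nm (lam i - lam j).
Implicit Types (x y : H) (X Y : H -> H) (i j : int) (m k n N : nat).

Let resP := unp_resolution hA.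
Let D := del^-1.
Let D0 : 0 <= D. Proof. by rewrite invr_ge0 ltW. Qed.

Notation Gk k X := (Gammat P lam k X).

Lemma lam_far_block N (L : R) : exists K, forall i j,
  (`|i| <= N)%N -> (K < `|j|)%N -> L < nm (lam i - lam j).
Proof.
pose K i := projT1 (cid (lam_far hA i L)).
have hK i j : (K i < `|j|)%N -> L < nm (lam i - lam j).
  exact: (projT2 (cid (lam_far hA i L)) j).
exists (\max_(i <- irange N) K i)%N => i j iN h; apply: hK.
by rewrite (leq_ltn_trans _ h)// (leq_bigmax_seq)// mem_irange.
Qed.

(** Rows and columns of index at most N are divided by differences of eigenvalues
    larger than L when k is large; what remains of Q outside them is small. *)
Lemma Gamma_small Q (eps : R) : HS e Q -> 0 < eps ->
  exists k0, forall k, (k0 <= k)%N ->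
    hsn e (Gk k Q) <= eps /\ forall X, HS e X ->
    hsn e (Q \o Gk k X) <= eps * hsn e X /\
    hsn e (Gk k X \o Jt P k Q) <= eps * hsn e X.
Proof.
move=> hQ eps0; have bQ := HS_bo hQ.
pose q := hsn e Q; have q0 : 0 <= q := hsn_ge0 e Q.
have p1 : 0 < D + 1 by rewrite ltr_wpDl.
pose eps1 := eps / 2 / (D + 1); have eps10 : 0 < eps1 by rewrite !divr_gt0.
pose L := 2 * (q + 1) / eps; have L0 : 0 < L by rewrite divr_gt0// mulr_gt0// ltr_wpDl.
have DL : D * eps1 <= eps / 2.
  by rewrite /eps1 mulrCA -[leRHS]mulr1 ler_wpM2l ?divr_ge0 ?(ltW eps0)// ler_pdivrMr// mul1r lerDl.
have qL : q * L^-1 <= eps / 2.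
  by rewrite /L invf_div mulrA ler_pdivrMr ?mulr_gt0 ?ltr_wpDl//; nra.
have [N hN] := hs_tail ip_norm resP fr hQ eps10.
have [K hK] := lam_far_block N L.
exists (maxn N K) => k; rewrite geq_max => /andP[Nk Kk].
have bPb := Pb_bo resP N.
have gamL i j : ((`|i| <= N) || (`|j| <= N))%N -> nm (gam lam k i j) <= L^-1.
  rewrite /gam; case: ifPn => [_|b h]; first by rewrite nm0 invr_ge0 ltW.
  rewrite nmV lef_pV2 ?posrE//; last first.
    by apply: lt_le_trans (gapP _) => //; apply: contraNneq b => ->; exact: blk_diag.
  apply: ltW; case/orP: h => h.
    apply: hK => //; apply: (leq_ltn_trans Kk); rewrite ltnNge; apply: contra b => h2.
    by rewrite /blk (leq_trans h Nk) h2.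
  rewrite nmB; apply: hK => //; apply: (leq_ltn_trans Kk); rewrite ltnNge; apply: contra b => h2.
  by rewrite /blk (leq_trans h Nk) h2.
have [hGQ _ eGQ] := Gammat_spec ip_norm hA fr del0 gapP k hQ.
split.
  have [|||_ h] := hN (Gk k Q) D.
  - exact: HS_bo hGQ.
  - exact: D0.
  - move=> i j x; rewrite eGQ nmZ; case: ifPn => [/andP[hi hj]|_].
      by rewrite /gam /blk (leq_trans hi Nk) (leq_trans hj Nk) nm0 mul0r.
    by rewrite ler_wpM2r ?nm_ge0// (gam_le del0 gapP).
  - by apply: le_trans h _; apply: le_trans DL _; rewrite ler_pdivrMr// ler_peMr ?(ltW eps0)// ler1n.
move=> X hX; have [hG nG eG] := Gammat_spec ip_norm hA fr del0 gapP k hX.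
have bG := HS_bo hG; have x0 := hsn_ge0 e X.
have [hJ nJ] := Jt_HS ip_norm hA fr k hQ.
have bJ := HS_bo hJ.
split.
  have [|||hY1 nY1] := hN (Q - (Q \o Pblock P N)) 1.
  - by apply: bo_sub => //; exact: (bo_comp bQ bPb).
  - exact: ler01.
  - move=> i j x; rewrite sub_opE /= (Pb_P resP).
    case: (leqP (absz j) N) => hj; first by rewrite subrr (bo0 (P_bo resP i)) nm0 mulr_ge0 ?nm_ge0//; case: ifP.
    by rewrite (bo0 bQ) subr0 andbF mul1r.
  have [hY2 nY2] : HS e (Pblock P N \o Gk k X) /\
      hsn e (Pblock P N \o Gk k X) <= L^-1 * hsn e X.
    apply: (schur_dom ip_norm resP fr hX (bo_comp bPb bG)); first by rewrite invr_ge0 ltW.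
    move=> i j x; rewrite /= (P_Pb resP); case: ifP => hi; last first.
      by rewrite nm0 mulr_ge0 ?nm_ge0// invr_ge0 ltW.
    by rewrite eG nmZ ler_wpM2r ?nm_ge0// gamL// hi.
  have -> : Q \o Gk k X = ((Q - (Q \o Pblock P N)) \o Gk k X) + (Q \o (Pblock P N \o Gk k X)).
    by apply/funext => x; rewrite add_opE /= sub_opE /= subrK.
  have [h1 n1] := HSM ip_norm resP fr hY1 hG.
  have [h2 n2] := HSM ip_norm resP fr hQ hY2.
  have [_ n3] := HSD h1 h2.
  apply: le_trans n3 _; rewrite (splitr eps) mulrDl; apply: lerD.
    apply: le_trans n1 _; rewrite mul1r in nY1.
    apply: (@le_trans _ _ (eps1 * (D * hsn e X))); first by apply: ler_pM => //; exact: hsn_ge0.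
    by rewrite mulrA ler_wpM2r// mulrC.
  apply: le_trans n2 _; apply: (@le_trans _ _ (q * (L^-1 * hsn e X))).
    by apply: ler_wpM2l.
  by rewrite mulrA ler_wpM2r.
have [|||hY1 nY1] := hN (Jt P k Q - (Pblock P N \o Jt P k Q)) 1.
- by apply: bo_sub => //; exact: (bo_comp bPb bJ).
- exact: ler01.
- move=> i j x; rewrite sub_opE (boB (P_bo resP i)) /= (P_Pb resP).
  case: (leqP (absz i) N) => hi; first by rewrite subrr nm0 mulr_ge0 ?nm_ge0//; case: ifP.
  rewrite subr0 /= mul1r (Jt_entry ip_norm hA)//; case: ifP => // _.
  by rewrite nm0 nm_ge0.
have [hY2 nY2] : HS e (Gk k X \o Pblock P N) /\
    hsn e (Gk k X \o Pblock P N) <= L^-1 * hsn e X.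
  apply: (schur_dom ip_norm resP fr hX (bo_comp bG bPb)); first by rewrite invr_ge0 ltW.
  move=> i j x; rewrite /= (Pb_P resP); case: ifP => hj; last first.
    by rewrite (bo0 bG) (bo0 (P_bo resP i)) nm0 mulr_ge0 ?nm_ge0// invr_ge0 ltW.
  by rewrite eG nmZ ler_wpM2r ?nm_ge0// gamL// hj orbT.
have -> : Gk k X \o Jt P k Q =
    (Gk k X \o (Jt P k Q - (Pblock P N \o Jt P k Q))) + ((Gk k X \o Pblock P N) \o Jt P k Q).
  by apply/funext => x; rewrite add_opE /= sub_opE /= (boB bG) subrK.
have [h1 n1] := HSM ip_norm resP fr hG hY1.
have [h2 n2] := HSM ip_norm resP fr hY2 hJ.
have [_ n3] := HSD h1 h2.
apply: le_trans n3 _; rewrite (splitr eps) mulrDl; apply: lerD.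
  apply: le_trans n1 _; rewrite mul1r in nY1.
  apply: (@le_trans _ _ ((D * hsn e X) * eps1)).
    by apply: ler_pM => //; exact: hsn_ge0.
  by rewrite mulrAC ler_wpM2r.
apply: le_trans n2 _; apply: (@le_trans _ _ ((L^-1 * hsn e X) * q)).
  by apply: ler_pM => //; exact: hsn_ge0.
by rewrite mulrAC ler_wpM2r// mulrC.
Qed.

Section Step.
Variables (Q : H -> H) (hQ : HS e Q) (k : nat) (g : R) (g0 : 0 <= g).
Hypothesis hg : forall X, HS e X -> hsn e (Q \o Gk k X) <= g * hsn e X /\
    hsn e (Gk k X \o Jt P k Q) <= g * hsn e X.

Let spec X (hX : HS e X) := Gammat_spec ip_norm hA fr del0 gapP k hX.

Lemma T1_HS X : HS e X -> HS e (Q \o Gk k X).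
Proof. by move=> hX; have [hG _ _] := spec hX; have [] := HSM ip_norm resP fr hQ hG. Qed.

Lemma T2_HS X : HS e X -> HS e (Gk k X \o Jt P k Q).
Proof.
move=> hX; have [hG _ _] := spec hX; have [hJ _] := Jt_HS ip_norm hA fr k hQ.
by have [] := HSM ip_norm resP fr hG hJ.
Qed.

Lemma T3_HS X Y : HS e X -> HS e Y -> HS e (Gk k X \o Jt P k (Q \o Gk k Y)) /\
  hsn e (Gk k X \o Jt P k (Q \o Gk k Y)) <= D * g * hsn e X * hsn e Y.
Proof.
move=> hX hY; have [hG nG _] := spec hX.
have [hJ nJ] := Jt_HS ip_norm hA fr k (T1_HS hY).
have [h n] := HSM ip_norm resP fr hG hJ; split => //.
apply: le_trans n _; apply: (@le_trans _ _ ((D * hsn e X) * (g * hsn e Y))).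
  apply: ler_pM => //; try exact: hsn_ge0.
  by apply: le_trans nJ _; case: (hg hY).
by rewrite le_eqVlt; apply/orP; left; apply/eqP; ring.
Qed.

Lemma Phi_HS X : HS e X -> HS e (Phi P lam Q k X).
Proof.
move=> hX; have h1 := T1_HS hX; have h2 := T2_HS hX; have [h3 _] := T3_HS hX hX.
have [h4 _] := HSB h1 h2; have [h5 _] := HSB h4 h3.
by have [] := HSD h5 hQ.
Qed.

Lemma Phi_near_Q X : HS e X ->
  hsn e (Phi P lam Q k X - Q) <= g * (2 + D * hsn e X) * hsn e X.
Proof.
move=> hX; have h1 := T1_HS hX; have h2 := T2_HS hX; have [h3 n3] := T3_HS hX hX.
have [h4 n4] := HSB h1 h2; have [h5 n5] := HSB h4 h3.
have [n1 n2] := hg hX.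
rewrite /Phi addrK; apply: le_trans n5 _.
apply: (@le_trans _ _ ((g * hsn e X + g * hsn e X) + D * g * hsn e X * hsn e X)).
  by apply: lerD => //; apply: le_trans n4 _; exact: lerD.
by rewrite le_eqVlt; apply/orP; left; apply/eqP; ring.
Qed.

Lemma Phi_contracts X Y : HS e X -> HS e Y ->
  hsn e (Phi P lam Q k X - Phi P lam Q k Y) <=
    g * (2 + D * hsn e X + D * hsn e Y) * hsn e (X - Y).
Proof.
move=> hX hY; have [hXY _] := HSB hX hY.
have h1 := T1_HS hXY; have h2 := T2_HS hXY.
have [h3 n3] := T3_HS hXY hX; have [h3' n3'] := T3_HS hY hXY.
have [n1 n2] := hg hXY.
have EG := GammatB ip_norm hA fr del0 gapP k hX hY.
have bQ := HS_bo hQ; have bG := HS_bo (let: And3 h _ _ := spec hX in h).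
have bG' := HS_bo (let: And3 h _ _ := spec hY in h).
have EJ : Jt P k (Q \o Gk k (X - Y)) = Jt P k (Q \o Gk k X) - Jt P k (Q \o Gk k Y).
  rewrite -(JtB ip_norm hA)//; [|exact: (bo_comp bQ bG)|exact: (bo_comp bQ bG')].
  by congr (Jt P k _); apply/funext => x; rewrite /= EG !sub_opE /= (boB bQ).
have -> : Phi P lam Q k X - Phi P lam Q k Y =
    ((Q \o Gk k (X - Y)) - (Gk k (X - Y) \o Jt P k Q)) -
    ((Gk k (X - Y) \o Jt P k (Q \o Gk k X)) + (Gk k Y \o Jt P k (Q \o Gk k (X - Y)))).
  by rewrite EJ EG; exact: (perturbed_difference _ _ _ _ bQ bG').
have [h4 n4] := HSB h1 h2; have [h5 n5] := HSD h3 h3'; have [_ n6] := HSB h4 h5.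
apply: le_trans n6 _.
apply: (@le_trans _ _ ((g * hsn e (X - Y) + g * hsn e (X - Y)) +
  (D * g * hsn e (X - Y) * hsn e X + D * g * hsn e Y * hsn e (X - Y)))).
  apply: lerD; first by apply: le_trans n4 _; exact: lerD.
  by apply: le_trans n5 _; exact: lerD.
by rewrite le_eqVlt; apply/orP; left; apply/eqP; ring.
Qed.

(** Apply J_k to the fixed point equation: J_k kills the products of Gamma_k X with
    a block-diagonal operator. *)
Lemma fixed_point_V X : HS e X -> Phi P lam Q k X = X ->
  Jt P k X = Jt P k Q + Jt P k (Q \o Gk k X) /\
  X = (Q \o Gk k X) - (Gk k X \o Jt P k X) + Q.
Proof.
move=> hX fixX; have [hG _ _] := spec hX; have bG := HS_bo hG; have bQ := HS_bo hQ.
have b1 := HS_bo (T1_HS hX); have b2 := HS_bo (T2_HS hX).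
have b3 := HS_bo (T3_HS hX hX).1.
have oG := Gammat_off ip_norm hA fr del0 gapP (k := k) hX.
have z2 : Jt P k (Gk k X \o Jt P k Q) = 0.
  apply: (Jt_eq0 ip_norm hA b2); apply: (off_diag_comp hA bG (Jt_bo ip_norm hA k bQ) oG).
  exact: (Jt_block_diagonal ip_norm hA (HS_block_bounded ip_norm hA hQ)).
have z3 : Jt P k (Gk k X \o Jt P k (Q \o Gk k X)) = 0.
  apply: (Jt_eq0 ip_norm hA b3); apply: (off_diag_comp hA bG (Jt_bo ip_norm hA k b1) oG).
  exact: (Jt_block_diagonal ip_norm hA (HS_block_bounded ip_norm hA (T1_HS hX))).
have E : Jt P k X = Jt P k Q + Jt P k (Q \o Gk k X).
  have b12 := bo_sub b1 b2.
  rewrite -[in LHS]fixX /Phi (JtD ip_norm hA k (bo_sub b12 b3) bQ).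
  by rewrite (JtB ip_norm hA k b12 b3) (JtB ip_norm hA k b1 b2) z2 z3 !subr0 addrC.
split => //; rewrite -[LHS]fixX /Phi; congr (_ + Q); apply/funext => x.
by rewrite !sub_opE /= E add_opE (boD bG) opprD addrA.
Qed.

End Step.

(** For large k, Phi maps the ball of radius hsn e Q + 1 into itself and contracts
    it by one half. *)
Lemma fixed_point Q (eta : R) : HS e Q -> 0 < eta -> exists k0, forall k, (k0 <= k)%N ->
  (forall X, HS e X -> HS e (Phi P lam Q k X)) /\ exists Xs,
  [/\ HS e Xs, Phi P lam Q k Xs = Xs,
      exists c : R, forall n, HS e (iter n (Phi P lam Q k) 0) /\
        hsn e (iter n (Phi P lam Q k) 0 - Xs) <= c * 2^-1 ^+ n,
      hsn e (Xs - Q) <= eta & hsn e (Gk k Xs) <= eta].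
Proof.
move=> hQ eta0.
pose q := hsn e Q; have q0 : 0 <= q := hsn_ge0 e Q.
pose r := q + 1; have r0 : 0 < r by rewrite ltr_wpDl.
pose c0 := (2 + 2 * D * r) * (1 + r).
have Dr : 0 <= D * r by rewrite mulr_ge0// ltW.
have c00 : 0 < c0 by rewrite /c0 -mulrA; apply: mulr_gt0; lra.
pose eta1 := Num.min 2^-1 (eta / 2 / (D + 1)).
have p1 : 0 < D + 1 by rewrite ltr_wpDl.
have eta10 : 0 < eta1 by rewrite lt_min invr_gt0 ltr0n !divr_gt0.
pose g := Num.min (eta / 2) (eta1 / c0).
have g0 : 0 < g by rewrite lt_min !divr_gt0.
have gc : g * c0 <= eta1 by rewrite -ler_pdivlMr// ge_min lexx orbT.
have eta1h : eta1 <= 2^-1 by rewrite ge_min lexx.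
have eta1e : (D + 1) * eta1 <= eta / 2.
  by rewrite mulrC -ler_pdivlMr// ge_min lexx orbT.
have [k0 hk0] := Gamma_small hQ g0; exists k0 => k /hk0[nGQ hg].
have near X : HS e X -> hsn e X <= r -> hsn e (Phi P lam Q k X - Q) <= eta1.
  move=> hX Xr; have x0 := hsn_ge0 e X; apply: le_trans (Phi_near_Q hQ hg hX) _.
  apply: le_trans gc; rewrite -mulrA ler_pM2l// /c0.
  have Dx : D * hsn e X <= D * r by rewrite ler_wpM2l.
  have Dx0 : 0 <= D * hsn e X by rewrite mulr_ge0.
  apply: ler_pM => //; rewrite ?addr_ge0 -?mulrA; lra.
have ball X : HS e X -> hsn e X <= r -> hsn e (Phi P lam Q k X) <= r.
  move=> hX Xr; have hP := Phi_HS hQ hg hX.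
  have [hPQ _] := HSB hP hQ; have [_] := HSD hPQ hQ; rewrite subrK => /le_trans; apply.
  by rewrite /r addrC lerD2l (le_trans (near X hX Xr))// (le_trans eta1h)//; lra.
have contr X Y : HS e X -> HS e Y -> hsn e X <= r -> hsn e Y <= r ->
    hsn e (Phi P lam Q k X - Phi P lam Q k Y) <= 2^-1 * hsn e (X - Y).
  move=> hX hY Xr Yr; apply: le_trans (Phi_contracts hQ hg hX hY) _.
  rewrite ler_wpM2r ?hsn_ge0//; apply: le_trans eta1h; apply: le_trans gc.
  rewrite ler_pM2l//.
  have Dx : D * hsn e X <= D * r by rewrite ler_wpM2l.
  have Dy : D * hsn e Y <= D * r by rewrite ler_wpM2l.
  rewrite /c0 -[leLHS]mulr1; apply: ler_pM; rewrite -?mulrA; try lra.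
  by rewrite !addr_ge0 ?mulr_ge0 ?hsn_ge0.
pose u n := iter n (Phi P lam Q k) 0.
have hu n : HS e (u n) /\ hsn e (u n) <= r.
  elim: n => [|n [IH1 IH2]].
    by have [h0 n0] := HS0 e; split => //; rewrite /u /= n0 ltW.
  by split; [exact: (Phi_HS hQ hg IH1)|exact: ball].
have du n : hsn e (u n.+1 - u n) <= hsn e (u 1%N - u 0%N) * 2^-1 ^+ n.
  elim: n => [|n IH]; first by rewrite expr0 mulr1.
  have [[h1 n1] [h2 n2]] := (hu n.+1, hu n).
  apply: le_trans (contr _ _ h1 h2 n1 n2) _.
  by rewrite exprS mulrCA ler_wpM2l// invr_ge0.
have half01 : 0 <= (2^-1 : R) < 1 by apply/andP; split; lra.
have [Xs [hXs nXs]] := hs_complete ip_norm resP fr half01 (fun n => (hu n).1) du.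
pose c := hsn e (u 1%N - u 0%N) / (1 - 2^-1).
have cu n : hsn e (u n - Xs) <= c * 2^-1 ^+ n by rewrite /c mulrAC; exact: nXs.
have small (t : R) : 0 < t -> exists n, c * 2^-1 ^+ n < t.
  by move=> t0; have [n hn] := geometric_small c half01 t0; exists n; exact: hn.
have Xsr : hsn e Xs <= r.
  apply/ler_addgt0Pr => t /small[n hn]; have [h1 n1] := hu n.
  have [hB _] := HSB hXs h1; have [_] := HSD hB h1; rewrite subrK => /le_trans; apply.
  by rewrite addrC lerD// hsn_dist (le_trans (cu n))// ltW.
have fixXs : Phi P lam Q k Xs = Xs.
  have hP := Phi_HS hQ hg hXs; have [hPX _] := HSB hP hXs.
  apply/eqP; rewrite -subr_eq0; apply/eqP/(hsn_eq0 ip_norm resP fr hPX).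
  apply/eqP; rewrite eq_le hsn_ge0 andbT; apply/ler_addgt0Pr => t t0; rewrite add0r.
  have [n hn] := small (t / 2) (divr_gt0 t0 (ltr0Sn R 1)); have [h1 n1] := hu n.
  have [h2 n2] := hu n.+1.
  have [hB1 _] := HSB hP h2; have [hB2 _] := HSB h2 hXs.
  have -> : Phi P lam Q k Xs - Xs = (Phi P lam Q k Xs - u n.+1) + (u n.+1 - Xs).
    by rewrite addrA subrK.
  have [_ /le_trans] := HSD hB1 hB2; apply.
  have e1 : hsn e (Phi P lam Q k Xs - u n.+1) <= t / 2.
    apply: le_trans (contr _ _ hXs h1 Xsr n1) _; rewrite hsn_dist.
    have := cu n; have := hsn_ge0 e (u n - Xs); lra.
  rewrite (splitr t) lerD// (le_trans (cu n.+1))//.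
  have c0' : 0 <= c * 2^-1 ^+ n := le_trans (hsn_ge0 _ _) (cu n).
  rewrite exprS mulrCA; lra.
have nXQ : hsn e (Xs - Q) <= eta1 by rewrite -{1}fixXs; exact: near.
split; first by move=> X hX; exact: (Phi_HS hQ hg hX).
exists Xs; split => //.
- by exists c => n; have [h1 _] := hu n; split => //; exact: cu.
- have := mulr_ge0 D0 (ltW eta10); lra.
- have [hB _] := HSB hXs hQ.
  have [hG nG _] := Gammat_spec ip_norm hA fr del0 gapP k hB.
  have [hGQ _ _] := Gammat_spec ip_norm hA fr del0 gapP k hQ.
  have -> : Gk k Xs = Gk k (Xs - Q) + Gk k Q.
    by rewrite (GammatB ip_norm hA fr del0 gapP k hXs hQ) subrK.
  have [_ /le_trans] := HSD hG hGQ; apply.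
  rewrite (splitr eta) lerD//; last by rewrite (le_trans nGQ)// ge_min lexx.
  apply: le_trans nG _; apply: le_trans eta1e.
  apply: ler_pM => //; first exact: hsn_ge0.
  by rewrite lerDl.
Qed.

End FixedPoint.

(** * Contour integrals of a reduced resolvent *)

Section RootsOfUnity.
Context {R : realType}.

Definition cis (t : R) : R[i] := cos t +i* sin t.

Lemma cisD s t : cis (s + t) = cis s * cis t.
Proof.
apply/eqP; rewrite eq_complex /cis /= cosD sinD; apply/andP; split; apply/eqP => //.
by rewrite addrC.
Qed.

Lemma cis0 : cis 0 = 1.
Proof. by rewrite /cis cos0 sin0. Qed.

Lemma cisX t n : cis t ^+ n = cis (n%:R * t).
Proof.
elim: n => [|n IH]; first by rewrite expr0 mul0r cis0.
by rewrite exprS IH -cisD -[in RHS]natr1 mulrDl mul1r addrC.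
Qed.

Lemma cis2pi : cis (2 * pi) = 1.
Proof.
have -> : 2 * pi = pi + pi :> R by rewrite mulr_natl mulr2n.
by rewrite cisD /cis cospi sinpi; apply/eqP; rewrite eq_complex /=; apply/andP; split; apply/eqP; ring.
Qed.

Lemma nm_cis t : nm (cis t) = 1.
Proof. by rewrite /nm /cis normc_def /= cos2Dsin2 sqrtr1. Qed.

Lemma cis_neq1 (n j : nat) : (0 < j < n)%N -> cis (2 * pi / n%:R) ^+ j != 1.
Proof.
move=> /andP[j0 jn]; rewrite cisX.
have n0 : 0 < n%:R :> R by rewrite ltr0n (leq_trans _ jn).
pose x : R := j%:R * pi / n%:R.
have -> : j%:R * (2 * pi / n%:R) = x + x by rewrite /x; field; rewrite gt_eqF.
have x0 : 0 < x by rewrite divr_gt0// mulr_gt0 ?ltr0n ?pi_gt0.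
have x1 : x < pi by rewrite ltr_pdivrMr// mulrC ltr_pM2l ?pi_gt0// ltr_nat.
have sx : 0 < sin x by apply: sin_gt0_pi; rewrite x0 x1.
apply/negP; rewrite eq_complex /= cosD => /andP[/eqP c _].
have := cos2Dsin2 x; nra.
Qed.

Definition circle_pt (r : R) (n k : nat) : R[i] :=
  r%:C * cis (2 * pi * k%:R / n.+1%:R).

Lemma circle_ptE r n k : circle_pt r n k = r%:C * cis (2 * pi / n.+1%:R) ^+ k.
Proof. by rewrite /circle_pt cisX; congr (_ * cis _); ring. Qed.

Lemma circle_pt_pow r n k : circle_pt r n k ^+ n.+1 = (r ^+ n.+1)%:C.
Proof.
rewrite circle_ptE exprMn rmorphXn /= -exprM mulnC exprM cisX.
rewrite (_ : n.+1%:R * _ = 2 * pi); first by rewrite cis2pi expr1n mulr1.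
by field; rewrite nat1r.
Qed.

Lemma sum_unit_pow (z : R[i]) n : z ^+ n = 1 -> z != 1 -> \sum_(k < n) z ^+ k = 0.
Proof.
move=> zn z1; have := subrX1 z n; rewrite zn subrr => /esym/eqP.
by rewrite mulf_eq0 subr_eq0 (negbTE z1) => /eqP.
Qed.

Lemma cis_root n : cis (2 * pi / n.+1%:R) ^+ n.+1 = 1.
Proof.
rewrite cisX (_ : n.+1%:R * _ = 2 * pi) ?cis2pi//.
by field; rewrite nat1r.
Qed.

Lemma circle_sum_pow r n j : (0 < j < n.+1)%N ->
  \sum_(k < n.+1) circle_pt r n k ^+ j = 0.
Proof.
move=> jn; under eq_bigr do rewrite circle_ptE exprMn exprAC.
rewrite -mulr_sumr sum_unit_pow ?mulr0// ?cis_neq1//.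
by rewrite exprAC cis_root expr1n.
Qed.

Lemma circle_sum_inv r n j : (0 < j < n.+1)%N ->
  \sum_(k < n.+1) (circle_pt r n k)^-1 ^+ j = 0.
Proof.
move=> jn; under eq_bigr do rewrite circle_ptE invfM exprMn -exprVn exprAC.
rewrite -mulr_sumr sum_unit_pow ?mulr0//.
  by rewrite exprAC exprVn cis_root invr1 expr1n.
by rewrite exprVn invr_eq1 cis_neq1.
Qed.

End RootsOfUnity.

(** Riesz projections from a reduced resolvent: E is the projection onto the
    root subspace at z0, Nl is the nilpotent part of T - z0 there, and S inverts
    T - z0 on the complement. The Riemann sums over n equal arcs are finite
    Laurent sums: the powers of Nl other than the zeroth average out, and the
    complement contributes r^n S^n (1 - r^n S^n)^-1. *)
Section RieszProjection.
Context {R : realType} {H : completeNormedModType R[i]}.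
Variables (D : set H) (T : H -> H) (lin : linear_on D T).
Variables (z0 : R[i]) (E Nl S : H -> H) (d : nat).
Hypothesis (bE : bounded_op E) (bN : bounded_op Nl) (bS : bounded_op S).
Hypothesis (EE : forall x, E (E x) = E x).
Hypothesis (TE : forall x, D (E x) /\ T (E x) = z0 *: E x + Nl x).
Hypothesis (EN : forall x, E (Nl x) = Nl x) (NE : forall x, Nl (E x) = Nl x).
Hypothesis (Nd : forall x, iter d.+1 Nl x = 0).
Hypothesis (TS : forall x, D (S x) /\ T (S x) = z0 *: S x + x - E x).
Hypothesis (ST : forall x, D x -> S (T x - z0 *: x) = x - E x).
Hypothesis (ES : forall x, E (S x) = 0) (SE : forall x, S (E x) = 0).
Implicit Types (x y : H) (w : R[i]).

Lemma resolvent_of_reduced : (forall x, E x = 0) -> is_resolvent D T z0 S.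
Proof.
move=> E0; split => // x.
  by have [Dx ->] := TS x; split => //; rewrite E0 subr0 addrC addKr.
by move=> /ST ->; rewrite E0 subr0.
Qed.

Variables (s : R) (s0 : 0 <= s) (hs : forall x, nm (S x) <= s * nm x).

Lemma neumann_scaled w : exists Qw, nm w * s <= 2^-1 ->
  [/\ bounded_op Qw, forall x, Qw x = x + w *: S (Qw x) &
    forall x, Qw (x - w *: S x) = x].
Proof.
case: (leP (nm w * s) 2^-1) => hw; last by exists 0.
have b : bounded_op ((- w) *: S) by exact: bo_scale.
have q01 : 0 <= (2^-1 : R) < 1 by apply/andP; split; lra.
have [|Y [bY WY YW]] := neumann_small b q01.
  move=> x; rewrite scale_opE nmZ nmN (le_trans (ler_wpM2l (nm_ge0 _) (hs x)))//.
  by rewrite mulrA ler_wpM2r ?nm_ge0.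
exists Y => _; split => // x.
  have := YW x; rewrite add_opE scale_opE /= scaleNr => h.
  by apply/eqP; rewrite -subr_eq h.
by have := WY x; rewrite add_opE scale_opE /= scaleNr.
Qed.

Lemma D_iter j x : D (iter j Nl (E x)) /\
  T (iter j Nl (E x)) = z0 *: iter j Nl (E x) + iter j.+1 Nl (E x).
Proof.
have h : E (iter j Nl (E x)) = iter j Nl (E x) by case: j => [|j] /=; rewrite ?EE ?EN.
by rewrite -h; have [Dx ->] := TE (iter j Nl (E x)); split => //; rewrite h iterS.
Qed.

(** The Laurent expansion of the resolvent at z0: its principal part is the finite
    sum, and S (1 - w S)^-1 is its regular part. *)
Definition reduced_res w (Qw : H -> H) x :=
  - (\sum_(j < d.+1) w^-1 ^+ j.+1 *: iter j Nl (E x)) + S (Qw x).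

Lemma reduced_res_bo w Qw : bounded_op Qw -> bounded_op (reduced_res w Qw).
Proof.
move=> bQ; rewrite (_ : reduced_res w Qw =
  - (\sum_(j < d.+1) w^-1 ^+ j.+1 *: (iter j Nl \o E)) + (S \o Qw)).
  apply: bo_add; last exact: (bo_comp bS bQ).
  apply: bo_opp; apply: bo_sum => j _; apply: bo_scale.
  exact: (bo_comp (bo_iter j bN) bE).
by apply/funext => x; rewrite add_opE opp_opE fct_sumE.
Qed.

Lemma reduced_res_right w Qw x : w != 0 -> (forall x, Qw x = x + w *: S (Qw x)) ->
  D (reduced_res w Qw x) /\
  T (reduced_res w Qw x) - (z0 + w) *: reduced_res w Qw x = x.
Proof.
move=> w0 hQ; pose v := \sum_(j < d.+1) w^-1 ^+ j.+1 *: iter j Nl (E x).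
have Dj (j : 'I_d.+1) : D (w^-1 ^+ j.+1 *: iter j Nl (E x)).
  by apply: (onZ_dom lin); case: (D_iter j x).
have Tj (j : 'I_d.+1) : T (w^-1 ^+ j.+1 *: iter j Nl (E x)) =
    z0 *: (w^-1 ^+ j.+1 *: iter j Nl (E x)) + w^-1 ^+ j.+1 *: iter j.+1 Nl (E x).
  have [D1 T1] := D_iter j x.
  by rewrite (onZ lin)// T1 scalerDr !scalerA mulrC.
have [Dv Tv] : D v /\ T v = z0 *: v + w *: v - E x.
  split; first by apply: (on_sum_dom lin) => j _; exact: Dj.
  rewrite /v (on_sum lin) => [|j _]; last exact: Dj.
  rewrite (eq_bigr _ (fun j _ => Tj j)) big_split /= -scaler_sumr -addrA; congr (_ + _).
  rewrite big_ord_recr /= -iterS.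
  have -> : iter d.+1 Nl (E x) = 0 by exact: Nd.
  rewrite scaler0 addr0 [in RHS]big_ord_recl /= scalerDr expr1 scalerA mulfV// scale1r.
  rewrite addrAC subrr add0r scaler_sumr; apply: eq_bigr => j _.
  by rewrite scalerA /bump /= add1n exprS [in RHS]exprS !mulrA mulfV// mul1r -exprS.
have [DS TSQ] := TS (Qw x).
have EQ : E (Qw x) = E x by rewrite hQ (boD bE) (boZ bE) ES scaler0 addr0.
rewrite /reduced_res -/v; split; first by apply: (onD_dom lin) => //; exact: (onN_dom lin).
rewrite (onD lin)//; last exact: (onN_dom lin).
rewrite (onN lin)// Tv TSQ EQ scalerDr scalerN !scalerDl.
set p := z0 *: v + w *: v; set c := z0 *: S _; set f := w *: S _.
have -> : Qw x = x + f by exact: hQ.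
rewrite opprB (addrC (E x - p)) addrA subrK (addrCA c x f).
clearbody p; by rewrite opprD opprK (addrA (_ - p)) subrK addrK.
Qed.

(** On the range of E the operator T - z0 is nilpotent and w is not zero; on the
    complement S inverts T - z0 and w S is small. *)
Lemma reduced_injective w x : w != 0 -> nm w * s <= 2^-1 -> D x ->
  T x = (z0 + w) *: x -> x = 0.
Proof.
move=> w0 hw Dx Tx; have [Qw /(_ hw)[bQ hQ QK]] := neumann_scaled w.
have h1 : w *: S x = x - E x.
  by rewrite -(ST Dx) Tx scalerDl addrAC subrr add0r (boZ bS).
have xE : x = E x.
  rewrite -[LHS](QK x) h1 opprB addrC subrK.
  by rewrite -{1}[E x](subr0 _) -(scaler0 _ w) -(SE x) QK.
have Nx : Nl x = w *: x.
  have [_] := TE x; rewrite -xE Tx scalerDl => /addrI //.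
have := Nd x; rewrite (_ : iter d.+1 Nl x = w ^+ d.+1 *: x).
  by move/eqP; rewrite scaler_eq0 expf_eq0 (negbTE w0) andbF => /eqP.
elim: d.+1 => [|n IH]; first by rewrite expr0 scale1r.
by rewrite iterS IH (boZ bN) Nx scalerA -exprSr.
Qed.

Lemma reduced_resolvent w Qw : w != 0 -> nm w * s <= 2^-1 -> bounded_op Qw ->
  (forall x, Qw x = x + w *: S (Qw x)) ->
  is_resolvent D T (z0 + w) (reduced_res w Qw).
Proof.
move=> w0 hw bQ hQ; have r := fun x => reduced_res_right x w0 hQ.
have bR := reduced_res_bo w bQ.
split => // x Dx; apply/eqP; rewrite -subr_eq0; apply/eqP.
have [Dr Tr] := r (T x - (z0 + w) *: x).
apply: (reduced_injective w0 hw); first exact: (onB_dom lin).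
rewrite (onB lin)// scalerBr; set b := _ *: reduced_res _ _ _ in Tr *.
set c := _ *: x in Tr *; set a := T (reduced_res _ _ _) in Tr *.
have -> : a = T x - c + b by rewrite -Tr subrK.
by rewrite addrAC [T x - c]addrC addrK addrC.
Qed.

Lemma riesz_projection_of_reduced : riesz_projection D T z0 E.
Proof.
(* on the circle of radius r the Neumann series for (1 - w S)^-1 has ratio 1/2 *)
pose r := (2 * (s + 1))^-1.
have p1 : 0 < 2 * (s + 1) by rewrite mulr_gt0// ltr_wpDl.
have r0 : 0 < r by rewrite invr_gt0.
have rs : r * s <= 2^-1.
  by rewrite /r mulrC ler_pdivrMr// mulrA mulVf// mul1r lerDl.
have rs0 : 0 <= r * s by rewrite mulr_ge0// ltW.
have small w : nm w <= r -> nm w * s <= 2^-1.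
  by move=> h; apply: le_trans rs; rewrite ler_wpM2r.
pose Qf w := projT1 (cid (neumann_scaled w)).
have hQf w : nm w <= r -> [/\ bounded_op (Qf w), forall x, Qf w x = x + w *: S (Qf w x) &
    forall x, Qf w (x - w *: S x) = x].
  by move=> /small; exact: (projT2 (cid (neumann_scaled w))).
have res w : w != 0 -> nm w <= r -> is_resolvent D T (z0 + w) (reduced_res w (Qf w)).
  move=> w0 wr; have [b1 b2 _] := hQf w wr.
  exact: (reduced_resolvent w0 (small w wr) b1 b2).
exists r => //; split.
  move=> z /andP[z1 z2]; exists (reduced_res (z - z0) (Qf (z - z0))).
  rewrite -{1}(subrK z0 z) addrC; apply: res => //.
  by rewrite -nm_eq0 gt_eqF.
exists (fun z => reduced_res (z - z0) (Qf (z - z0))); split.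
  move=> z zr; rewrite -{1}(subrK z0 z) addrC; apply: res; last by rewrite zr.
  by rewrite -nm_eq0 zr gt_eqF.
move=> x; apply/cvg_nmP => eps eps0.
pose u n := n.+1%:R^-1 *: \sum_(k < n.+1) circle_pt r n k *: S (Qf (circle_pt r n k) x).
have wn n k : nm (circle_pt r n k) = r.
  by rewrite /circle_pt nmM nm_cis mulr1 nmC gtr0_norm.
have wneq0 n k : circle_pt r n k != 0 by rewrite -nm_eq0 wn gt_eqF.
have Nneq0 n : n.+1%:R != 0 :> R[i] by rewrite pnatr_eq0.
have cE n : (d <= n)%N -> contour_sum (fun z => reduced_res (z - z0) (Qf (z - z0))) z0 r n x - E x = - u n.
  move=> dn.
  have term (k : 'I_n.+1) : (circle_pt r n k / n.+1%:R) *: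
      (- reduced_res (z0 + circle_pt r n k - z0) (Qf (z0 + circle_pt r n k - z0)) x) =
      n.+1%:R^-1 *: (\sum_(j < d.+1) (circle_pt r n k)^-1 ^+ j *: iter j Nl (E x)) -
      n.+1%:R^-1 *: (circle_pt r n k *: S (Qf (circle_pt r n k) x)).
    rewrite (addrC z0) addrK /reduced_res opprD opprK mulrC -scalerA scalerBr scalerBr.
    congr (_ *: _ - _); rewrite scaler_sumr; apply: eq_bigr => j _.
    by rewrite scalerA exprS mulrA mulfV ?mul1r.
  rewrite /contour_sum (eq_bigr _ (fun k _ => term k)) sumrB -!scaler_sumr -/(u n).
  have inner (j : 'I_d.+1) : \sum_(k < n.+1) (circle_pt r n k)^-1 ^+ j *: iter j Nl (E x) =
      if j == ord0 then n.+1%:R *: E x else 0.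
    rewrite -scaler_suml; case: eqVneq => [->|jn].
      under eq_bigr do rewrite expr0.
      by rewrite sumr_const card_ord.
    rewrite circle_sum_inv ?scale0r// lt0n (leq_trans (ltn_ord j)) ?andbT ?ltnS//.
  rewrite exchange_big /= (eq_bigr _ (fun j _ => inner j)) -big_mkcond big_pred1_eq.
  by rewrite scalerA mulVf// scale1r addrAC subrr add0r.
have ub n : nm (u n) <= 2 * (2^-1 ^+ n.+1 * nm x).
  pose y (k : 'I_n.+1) := circle_pt r n k *: S (Qf (circle_pt r n k) x).
  (* the partial Neumann expansion, whose middle terms average out over the circle *)
  have Qit (k : 'I_n.+1) m : Qf (circle_pt r n k) x =
      circle_pt r n k ^+ m *: iter m S (Qf (circle_pt r n k) x) +
      \sum_(j < m) circle_pt r n k ^+ j *: iter j S x.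
    have wr : nm (circle_pt r n k) <= r by rewrite wn.
    have [_ hQ _] := hQf _ wr.
    elim: m => [|m IH]; first by rewrite big_ord0 addr0 expr0 scale1r.
    have step : circle_pt r n k ^+ m *: iter m S (Qf (circle_pt r n k) x) =
        circle_pt r n k ^+ m *: iter m S x +
        circle_pt r n k ^+ m.+1 *: iter m.+1 S (Qf (circle_pt r n k) x).
      rewrite [in LHS]hQ (boD (bo_iter m bS)) (boZ (bo_iter m bS)) scalerDr scalerA.
      by rewrite -exprSr -iterSr.
    rewrite [LHS]IH step big_ord_recr /=.
    by rewrite (addrC (_ *: iter m S x)) -addrA (addrC (_ *: iter m S x)).
  have yE (k : 'I_n.+1) : y k = (r ^+ n.+1)%:C *: iter n.+1 S (y k) +
      \sum_(j < n.+1) circle_pt r n k ^+ j.+1 *: iter j.+1 S x.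
    rewrite /y {1}(Qit k n.+1) (boD bS) (bo_sumE bS) scalerDr scaler_sumr; congr (_ + _).
      rewrite circle_pt_pow (boZ bS) (boZ (bo_iter n.+1 bS)) !scalerA mulrC.
      by rewrite -iterS iterSr.
    by apply: eq_bigr => j _; rewrite (boZ bS) scalerA exprS.
  (* hence the average u n solves u n = r^(n+1) S^(n+1) (u n + x) *)
  have uE : u n = (r ^+ n.+1)%:C *: iter n.+1 S (u n) + (r ^+ n.+1)%:C *: iter n.+1 S x.
    rewrite {1}/u (eq_bigr _ (fun k _ => yE k)) big_split scalerDr.
    congr (_ + _).
      rewrite /u -/(\sum_(k < n.+1) y k) -scaler_sumr (boZ (bo_iter n.+1 bS)) (bo_sumE (bo_iter n.+1 bS)).
      by rewrite !scalerA mulrC.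
    have inner (j : 'I_n.+1) : \sum_(k < n.+1) circle_pt r n k ^+ j.+1 *: iter j.+1 S x =
        if j == ord_max then (n.+1%:R * (r ^+ n.+1)%:C) *: iter n.+1 S x else 0.
      rewrite -scaler_suml; case: eqVneq => [->|jn].
        under eq_bigr do rewrite circle_pt_pow.
        by rewrite sumr_const card_ord mulr_natl.
      rewrite circle_sum_pow ?scale0r//=; have := ltn_ord j.
      rewrite ltnS leq_eqVlt => /orP[/eqP jn'|//].
      by move: jn; rewrite -(inj_eq val_inj) /= jn' eqxx.
    rewrite exchange_big /= (eq_bigr _ (fun j _ => inner j)) -big_mkcond big_pred1_eq.
    by rewrite scalerA mulrA mulVf// mul1r.
  have nit (v : H) : nm ((r ^+ n.+1)%:C *: iter n.+1 S v) <= 2^-1 ^+ n.+1 * nm v.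
    have hit m : nm (iter m S v) <= s ^+ m * nm v.
      elim: m => [|m IH]; first by rewrite expr0 mul1r.
      by rewrite iterS (le_trans (hs _))// exprS -mulrA ler_wpM2l.
    rewrite nmZ nmC ger0_norm ?exprn_ge0 ?(ltW r0)//.
    rewrite (le_trans (ler_wpM2l _ (hit n.+1)))// ?exprn_ge0 ?(ltW r0)//.
    rewrite mulrA -exprMn ler_wpM2r ?nm_ge0// lerXn2r// nnegrE.
    by rewrite invr_ge0.
  have : nm (u n) <= 2^-1 ^+ n.+1 * nm (u n) + 2^-1 ^+ n.+1 * nm x.
    by rewrite {1}uE (le_trans (nmD _ _))// lerD.
  have : 2^-1 ^+ n.+1 * nm (u n) <= 2^-1 * nm (u n).
    by rewrite ler_wpM2r ?nm_ge0// exprS ler_piMr// exprn_ile1//; lra.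
  lra.
have half01 : 0 <= (2^-1 : R) < 1 by apply/andP; split; lra.
have [N hN] := geometric_small (2 * nm x) half01 eps0.
exists (maxn d N) => // n /=; rewrite geq_max => /andP[dn Nn].
rewrite cE// nmN (le_lt_trans (ub n))// (le_lt_trans _ (hN n Nn))//.
rewrite mulrA mulrAC ler_wpM2l ?mulr_ge0 ?nm_ge0//.
by rewrite exprS ler_piMl ?exprn_ge0//; lra.
Qed.

End RieszProjection.

(** * Spectral theory in finite dimension *)

Section RootSplitting.
Context {F : fieldType}.
Implicit Types (z : F) (rs : seq F) (f : {poly F}).

Definition roots_poly rs : {poly F} := \prod_(rho <- rs) ('X - rho%:P).
Definition other_roots z rs : {poly F} := \prod_(rho <- rs | rho != z) ('X - rho%:P).

Lemma roots_polyE z rs :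
  roots_poly rs = ('X - z%:P) ^+ (count_mem z rs) * other_roots z rs.
Proof.
rewrite /roots_poly (bigID (fun rho => rho == z)) /=; congr (_ * _).
rewrite (eq_bigr (fun=> 'X - z%:P)) => [|rho /eqP -> //].
by rewrite big_const_seq iter_mulr_1.
Qed.

Lemma other_roots_coprime z rs n : coprimep (('X - z%:P) ^+ n) (other_roots z rs).
Proof.
apply: coprimep_expl; rewrite coprimep_sym /other_roots.
elim/big_rec : _ => [|rho g rz cg]; first exact: coprime1p.
by rewrite coprimepMl cg andbT coprimep_XsubC2// subr_eq0 eq_sym.
Qed.

Lemma roots_poly_dvd rs f :
  (forall z, z \in rs -> ('X - z%:P) ^+ (count_mem z rs) %| f) -> roots_poly rs %| f.
Proof.
move=> h; rewrite /roots_poly -big_undup_iterop_count.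
have : forall z, z \in undup rs -> ('X - z%:P) ^+ (count_mem z rs) %| f.
  by move=> z; rewrite mem_undup; exact: h.
elim: (undup rs) (undup_uniq rs) => [|z s IH] /= us hs; first by rewrite big_nil dvd1p.
move: us => /andP[zs us]; rewrite big_cons Gauss_dvdp.
  rewrite hs ?mem_head//= IH// => w ws; apply: hs; by rewrite inE ws orbT.
rewrite big_seq; elim/big_rec : _ => [|w g ws cg]; first by rewrite coprimep1.
rewrite coprimepMr cg andbT; apply: coprimep_expl; apply: coprimep_expr.
by apply: coprimep_XsubC2; rewrite subr_eq0; apply: contraNneq zs => <-.
Qed.

(** The idempotent of the root z in the quotient by roots_poly rs, and the
    inverse of 'X - z on the complementary factor. *)
Lemma root_idempotent rs z : exists ev : {poly F} * {poly F},
  [/\ roots_poly rs %| ev.1 * (1 - ev.1),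
      roots_poly rs %| ('X - z%:P) ^+ (count_mem z rs) * ev.1,
      roots_poly rs %| ('X - z%:P) * ev.2 - (1 - ev.1),
      roots_poly rs %| ev.1 * ev.2 &
      ('X - z%:P) ^+ (count_mem z rs) %| ev.1 - 1 /\ other_roots z rs %| ev.1].
Proof.
have /Bezout_eq1_coprimepP[[u v] /= uv] := other_roots_coprime z rs (count_mem z rs).+1.
set a := count_mem z rs in uv *; set q := other_roots z rs in uv *.
have pE := roots_polyE z rs; rewrite -/a -/q in pE.
set x := 'X - z%:P in uv pE *.
have e1 : 1 - v * q = u * x ^+ a.+1 by rewrite -uv addrK.
exists (v * q, u * x ^+ a * (1 - v * q)); rewrite /= pE; split.
- by rewrite e1 exprS; apply/dvdpP; exists (u * v * x); ring.
- by apply/dvdpP; exists v; ring.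
- have -> : x * (u * x ^+ a * (1 - v * q)) - (1 - v * q) = (1 - v * q) * (u * x ^+ a.+1 - 1).
    by rewrite exprS; ring.
  have e2 : u * x ^+ a.+1 - 1 = - (v * q) by rewrite -e1; ring.
  by rewrite e2 e1 exprS; apply/dvdpP; exists (- (u * v * x)); ring.
- by rewrite e1 exprS; apply/dvdpP; exists (u * u * v * x * x ^+ a); ring.
- split; last exact: dvdp_mulIr.
  rewrite -opprB dvdpNr e1 exprSr mulrA mulrAC.
  exact: dvdp_mulIr.
Qed.

Lemma other_roots_dvd z w rs : z != w ->
  ('X - w%:P) ^+ (count_mem w rs) %| other_roots z rs.
Proof.
move=> zw; rewrite -(@Gauss_dvdpr _ _ (('X - z%:P) ^+ (count_mem z rs))).
  rewrite -roots_polyE (roots_polyE w); exact: dvdp_mulIl.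
apply: coprimep_expl; apply: coprimep_expr.
by apply: coprimep_XsubC2; rewrite subr_eq0.
Qed.

(** The difference is divisible by every primary factor. *)
Lemma root_idempotents_sum rs (ev : F -> {poly F}) :
  (forall z, ('X - z%:P) ^+ (count_mem z rs) %| ev z - 1 /\ other_roots z rs %| ev z) ->
  roots_poly rs %| \sum_(z <- undup rs) ev z - 1.
Proof.
move=> h; apply: roots_poly_dvd => w wrs.
rewrite (bigD1_seq w) ?mem_undup ?undup_uniq//= addrAC dvdp_addr; last by case: (h w).
rewrite big_seq_cond; elim/big_rec : _ => [|z g /andP[_ zw] hg]; first exact: dvdp0.
rewrite dvdp_addr// ; apply: dvdp_trans (h z).2.
exact: other_roots_dvd.
Qed.

End RootSplitting.

Section OperatorPolynomials.
Context {R : realType} {H : completeNormedModType R[i]}.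
Variables (M : H -> H) (bM : bounded_op M).
Implicit Types (p q : {poly R[i]}) (x y : H).

(** Evaluation of a polynomial at an operator which is not an element of a
    ring. *)
Definition opoly p x : H := \sum_(i < size p) p`_i *: iter i M x.

Lemma opoly_bo p : bounded_op (opoly p).
Proof.
rewrite (_ : opoly p = \sum_(i < size p) p`_i *: iter i M).
  by apply: bo_sum => i _; apply: bo_scale; exact: bo_iter.
by apply/funext => x; rewrite fct_sumE.
Qed.

Lemma opoly_wide n p x : (size p <= n)%N -> opoly p x = \sum_(i < n) p`_i *: iter i M x.
Proof.
move=> sn; rewrite /opoly (big_ord_widen n (fun i => p`_i *: iter i M x))//.
rewrite big_mkcond; apply: eq_bigr => i _; case: ltnP => // h.
by rewrite nth_default// scale0r.
Qed.

Lemma opolyD p q x : opoly (p + q) x = opoly p x + opoly q x.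
Proof.
pose n := maxn (size p) (size q).
rewrite !(@opoly_wide n) ?leq_maxl ?leq_maxr//; last exact: (leq_trans (size_polyD p q)).
by rewrite -big_split /=; apply: eq_bigr => i _; rewrite coefD scalerDl.
Qed.

Lemma opolyC c x : opoly c%:P x = c *: x.
Proof. by rewrite (@opoly_wide 1) ?size_polyC_leq1// big_ord1 coefC. Qed.

Lemma opoly0 x : opoly 0 x = 0.
Proof. by rewrite /opoly size_poly0 big_ord0. Qed.

Lemma opolyMX p x : opoly (p * 'X) x = opoly p (M x).
Proof.
rewrite (@opoly_wide (size p).+1); last first.
  by rewrite (leq_trans (size_polyMleq _ _))// size_polyX addn2.
rewrite big_ord_recl coefMX eqxx scale0r add0r; apply: eq_bigr => i _.
by rewrite coefMX /= -iterS iterSr.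
Qed.

Lemma opolyM p q x : opoly (p * q) x = opoly p (opoly q x).
Proof.
have comm y : M (opoly q y) = opoly q (M y).
  rewrite /opoly (bo_sumE bM); apply: eq_bigr => i _.
  by rewrite (boZ bM) -iterS iterSr.
elim/poly_ind: p x => [|p c IH] x; first by rewrite mul0r !opoly0.
rewrite mulrDl mulrAC !opolyD !opolyMX IH -comm; congr (_ + _).
rewrite mul_polyC opolyC; rewrite (opoly_wide x (size_scale_leq c q)) /opoly scaler_sumr.
by apply: eq_bigr => i _; rewrite coefZ scalerA.
Qed.

Lemma opoly1 x : opoly 1 x = x.
Proof. by rewrite opolyC scale1r. Qed.

Lemma opolyN p x : opoly (- p) x = - opoly p x.
Proof.
by apply: (addIr (opoly p x)); rewrite -opolyD addNr opoly0 addNr.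
Qed.

Lemma opolyB p q x : opoly (p - q) x = opoly p x - opoly q x.
Proof. by rewrite opolyD opolyN. Qed.

Lemma opolyXsubC z x : opoly ('X - z%:P) x = M x - z *: x.
Proof. by rewrite opolyB -['X]mul1r opolyMX opoly1 opolyC. Qed.

Lemma opoly_eigen p z x : M x = z *: x -> opoly p x = p.[z] *: x.
Proof.
move=> Mx; elim/poly_ind: p => [|p c IH]; first by rewrite opoly0 horner0 scale0r.
by rewrite opolyD opolyMX Mx (boZ (opoly_bo p)) IH opolyC hornerMXaddC scalerDl scalerA mulrC.
Qed.

Lemma opolyX p n x : opoly (p ^+ n) x = iter n (opoly p) x.
Proof.
elim: n => [|n IH]; first by rewrite expr0 opoly1.
by rewrite exprS opolyM IH.
Qed.

(** Cayley-Hamilton for any matrix of M on the spanning vectors. *)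
Lemma annihilating_roots (Pi : H -> H) d (v : 'I_d -> H) :
  (forall x, Pi (M x) = M x) ->
  (forall x, exists c : 'I_d -> R[i], Pi x = \sum_i c i *: v i) ->
  exists rs, size rs = d /\ forall x, opoly (roots_poly rs) (Pi x) = 0.
Proof.
move=> PM hv; case: d v hv => [|n] v hv.
  exists [::]; split => // x; rewrite /roots_poly big_nil opoly1.
  by have [c ->] := hv x; rewrite big_ord0.
have exa j : exists c : 'I_n.+1 -> R[i], M (v j) = \sum_i c i *: v i.
  by rewrite -PM; exact: hv.
pose a : 'M[R[i]]_n.+1 := \matrix_(j, i) projT1 (cid (exa j)) i.
have Mv j : M (v j) = \sum_i a j i *: v i.
  by rewrite (projT2 (cid (exa j))); apply: eq_bigr => i _; rewrite mxE.
pose L (c : 'rV[R[i]]_n.+1) : H := \sum_i c 0 i *: v i.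
have ML c : M (L c) = L (c *m a).
  rewrite /L (bo_sumE bM).
  under eq_bigr do rewrite (boZ bM) Mv scaler_sumr.
  rewrite exchange_big; apply: eq_bigr => i _; rewrite mxE scaler_suml.
  by apply: eq_bigr => j _; rewrite scalerA.
have LD c c' : L (c + c') = L c + L c'.
  by rewrite /L -big_split; apply: eq_bigr => i _; rewrite mxE scalerDl.
have LZ z c : L (z *: c) = z *: L c.
  by rewrite /L scaler_sumr; apply: eq_bigr => i _; rewrite mxE scalerA.
have pL p c : opoly p (L c) = L (c *m horner_mx a p).
  elim/poly_ind: p c => [|p z IH] c.
    rewrite opoly0 rmorph0 mulmx0 /L big1// => i _; by rewrite mxE scale0r.
  rewrite opolyD opolyMX ML IH opolyC mulrC rmorphD rmorphM /= horner_mx_X horner_mx_C.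
  by rewrite mulmxDr LD -mulmxA mul_mx_scalar LZ.
have [rs rsE] := closed_field_poly_normal (char_poly a).
have {}rsE : char_poly a = roots_poly rs.
  by rewrite rsE (monicP (char_poly_monic a)) scale1r.
exists rs; split.
  have := size_char_poly a; rewrite rsE /roots_poly size_prod_XsubC => -[->] //.
move=> x; have [c ->] := hv x.
have -> : \sum_i c i *: v i = L (\row_i c i) by apply: eq_bigr => i _; rewrite mxE.
rewrite pL -rsE Cayley_Hamilton mulmx0 /L big1// => i _; by rewrite mxE scale0r.
Qed.

(** The polynomials root_idempotent evaluated at M give the projections E z and
    the reduced inverses S z. *)
Lemma finite_rank_spectral (Pi : H -> H) d (v : 'I_d -> H) :
  bounded_op Pi -> (forall x, Pi (Pi x) = Pi x) ->
  (forall x, Pi (M x) = M x) -> (forall x, M (Pi x) = M x) ->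
  (forall x, exists c : 'I_d -> R[i], Pi x = \sum_i c i *: v i) ->
  exists (s : seq R[i]) (E S : R[i] -> H -> H) (a : R[i] -> nat),
  [/\ uniq s /\ (size s <= d)%N,
      forall z, z \in s <-> exists2 y, y <> 0 & Pi y = y /\ M y = z *: y,
      forall x, Pi x = \sum_(z <- s) E z x,
      forall z, [/\ bounded_op (E z) /\ bounded_op (S z),
        forall x, E z (E z x) = E z x, forall x, Pi (E z x) = E z x,
        forall x, E z (Pi x) = E z x & forall x, E z (M x) = M (E z x)] &
      forall z, [/\ forall x, iter (a z).+1 (fun y => M y - z *: y) (E z x) = 0,
        forall x, Pi (S z x) = S z x,
        forall x, M (S z x) - z *: S z x = Pi x - E z x,
        forall x, S z (M x) - z *: S z x = Pi x - E z x &
        [/\ forall x, E z (S z x) = 0, forall x, S z (E z x) = 0,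
            forall x, S z (Pi x) = S z x & z \notin s -> forall x, E z x = 0]]].
Proof.
move=> bPi PiPi PiM MPi hv.
have [rs [rs_size rs0]] := annihilating_roots PiM hv.
have oPi p x : Pi (opoly p (Pi x)) = opoly p (Pi x).
  rewrite /opoly (bo_sumE bPi); apply: eq_bigr => i _; rewrite (boZ bPi).
  by case: (nat_of_ord i) => [|j] /=; rewrite ?PiPi ?PiM.
have oM p x : opoly p (M x) = M (opoly p x).
  by rewrite -opolyMX mulrC opolyM -[X in opoly X (opoly _ _)]mul1r opolyMX opoly1.
have dvd0 f x : roots_poly rs %| f -> opoly f (Pi x) = 0.
  by move=> /dvdpP[g ->]; rewrite opolyM rs0 (bo0 (opoly_bo g)).
have eqm f g x : roots_poly rs %| f - g -> opoly f (Pi x) = opoly g (Pi x).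
  by move=> /(dvd0 _ x); rewrite opolyB => /eqP; rewrite subr_eq0 => /eqP.
pose ev z := projT1 (cid (root_idempotent rs z)).
have evP z : [/\ roots_poly rs %| (ev z).1 * (1 - (ev z).1),
      roots_poly rs %| ('X - z%:P) ^+ (count_mem z rs) * (ev z).1,
      roots_poly rs %| ('X - z%:P) * (ev z).2 - (1 - (ev z).1),
      roots_poly rs %| (ev z).1 * (ev z).2 &
      ('X - z%:P) ^+ (count_mem z rs) %| (ev z).1 - 1 /\ other_roots z rs %| (ev z).1].
  exact: (projT2 (cid (root_idempotent rs z))).
pose E z x := opoly (ev z).1 (Pi x).
pose S z x := opoly (ev z).2 (Pi x).
pose eig z := exists2 y, y <> 0 & Pi y = y /\ M y = z *: y.
have nilp z x : iter (count_mem z rs).+1 (fun y => M y - z *: y) (E z x) = 0.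
  have itE n y : iter n (fun y => M y - z *: y) y = opoly (('X - z%:P) ^+ n) y.
    rewrite opolyX; elim: n => //= n ->; by rewrite opolyXsubC.
  rewrite itE exprS opolyM /E -(opolyM (('X - z%:P) ^+ _)) dvd0; last by case: (evP z).
  by rewrite (bo0 (opoly_bo _)).
have PiE z x : Pi (E z x) = E z x by exact: oPi.
have noeig z : ~ eig z -> forall x, E z x = 0.
  move=> hz x; have := nilp z x.
  elim: (count_mem z rs).+1 => [//|n IH]; rewrite iterS => h; apply: IH.
  apply: contrapT => y0; apply: hz; eexists; first exact: y0.
  split; last by apply/eqP; rewrite -subr_eq0 h.
  elim: n {h y0} => [|n IH] /=; first exact: PiE.
  by rewrite (boB bPi) (boZ bPi) PiM IH.
exists [seq z <- undup rs | `[< eig z >]], E, S, (fun z => count_mem z rs); split.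
- split; first by rewrite filter_uniq ?undup_uniq.
  by rewrite size_filter (leq_trans (count_size _ _))// (leq_trans (size_undup rs)) ?rs_size.
- move=> z; rewrite mem_filter mem_undup; split; first by move=> /andP[/asboolP].
  move=> hz; rewrite asboolT//=; have [y y0 [Py My]] := hz.
  have := rs0 y; rewrite Py (opoly_eigen _ My) => /eqP; rewrite scaler_eq0.
  by rewrite (introF eqP y0) orbF -[_ == 0]/(root _ _) root_prod_XsubC.
- move=> x; rewrite big_filter.
  have -> : \sum_(z <- undup rs | `[< eig z >]) E z x = \sum_(z <- undup rs) E z x.
    rewrite [RHS](bigID (fun z => `[< eig z >])) /= [X in _ + X]big1 ?addr0// => z.
    by move=> /asboolPn hz; exact: noeig.
  have hev z : ('X - z%:P) ^+ (count_mem z rs) %| (ev z).1 - 1 /\ other_roots z rs %| (ev z).1.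
    by case: (evP z).
  have := eqm _ _ x (root_idempotents_sum hev).
  rewrite opoly1 => <-; elim: (undup rs) => [|z s IH]; first by rewrite !big_nil opoly0.
  by rewrite !big_cons opolyD IH.
- move=> z; split.
  + split; apply: (@bo_comp _ _ (opoly _) Pi) => //; exact: opoly_bo.
  + move=> x; rewrite /E oPi -opolyM; apply: eqm; have [h _ _ _ _] := evP z.
    by rewrite -dvdpNr opprB -{1}[(ev z).1]mulr1 -mulrBr.
  + exact: PiE.
  + by move=> x; rewrite /E PiPi.
  + by move=> x; rewrite /E PiM -(MPi x) oM.
move=> z; have [h1 h2 h3 h4 h5] := evP z; split.
- exact: nilp.
- move=> x; exact: oPi.
- move=> x; rewrite -opolyXsubC /S -opolyM (eqm _ _ x h3) opolyB opoly1//.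
- move=> x; rewrite /S PiM -(MPi x) oM -opolyXsubC -opolyM (eqm _ _ x h3) opolyB opoly1//.
split.
- by move=> x; rewrite /E /S oPi -opolyM dvd0.
- by move=> x; rewrite /E /S oPi -opolyM mulrC dvd0.
- by move=> x; rewrite /S PiPi.
- move=> hz; apply: noeig => -[y y0 [Py My]]; move: hz; rewrite mem_filter mem_undup asboolT/=; last by exists y.
  have := rs0 y; rewrite Py (opoly_eigen _ My) => /eqP; rewrite scaler_eq0.
  by rewrite (introF eqP y0) orbF -[_ == 0]/(root _ _) root_prod_XsubC => ->.
Qed.

End OperatorPolynomials.

(** * Spectral theory of a block-diagonal perturbation *)

Section ReducedData.
Context {R : realType} {H : completeNormedModType R[i]}.
Variable D : set H.

(** At z, T is the sum of z + Nl with Nl nilpotent on the range of E, and of an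
    operator with T - z invertible, by S, on the complement. *)
Definition reduced_data (T : H -> H) (z : R[i]) (E Nl S : H -> H) (d : nat) :=
  [/\ [/\ bounded_op E, bounded_op Nl & bounded_op S],
      forall x, E (E x) = E x,
      forall x, D (E x) /\ T (E x) = z *: E x + Nl x,
      [/\ forall x, E (Nl x) = Nl x, forall x, Nl (E x) = Nl x &
          forall x, iter d.+1 Nl x = 0] &
      [/\ forall x, D (S x) /\ T (S x) = z *: S x + x - E x,
          forall x, D x -> S (T x - z *: x) = x - E x,
          forall x, E (S x) = 0 & forall x, S (E x) = 0]].

Lemma reduced_riesz T z E Nl S d : linear_on D T ->
  reduced_data T z E Nl S d -> riesz_projection D T z E.
Proof.
move=> lin [[bE bN bS] EE TE [EN NE Nd] [TS ST ES SE]].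
have [s s0 hs] := bo_bound bS.
exact: (riesz_projection_of_reduced lin bE bN bS EE TE EN Nd TS ST ES SE s0 hs).
Qed.

Lemma reduced_is_resolvent T z E Nl S d : reduced_data T z E Nl S d ->
  (forall x, E x = 0) -> resolvent_set D T z.
Proof.
move=> [[bE bN bS] EE TE [EN NE Nd] [TS ST ES SE]] E0; exists S.
exact: (resolvent_of_reduced bS TS ST E0).
Qed.

Lemma reduced_transport T T1 W Wi z E Nl S d : is_inverse W Wi -> bounded_op W ->
  (forall x, D (W x) <-> D x) -> (forall x, D x -> T1 (W x) = W (T x)) ->
  reduced_data T z E Nl S d ->
  reduced_data T1 z (W \o E \o Wi) (W \o Nl \o Wi) (W \o S \o Wi) d.
Proof.
move=> [bWi WK KW] bW DW TW [[bE bN bS] EE TE [EN NE Nd] [TS ST ES SE]].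
have bc X : bounded_op X -> bounded_op (W \o X \o Wi).
  by move=> bX; exact: (bo_comp (bo_comp bW bX) bWi).
split; first by split; exact: bc.
- by move=> x /=; rewrite WK EE.
- move=> x /=; have [D1 T1E] := TE (Wi x); split; first exact/DW.
  by rewrite TW// T1E (boD bW) (boZ bW).
- split; [by move=> x /=; rewrite WK EN|by move=> x /=; rewrite WK NE|].
  move=> x; suff h n : iter n (W \o Nl \o Wi) x = W (iter n Nl (Wi x)).
    by rewrite h Nd (bo0 bW).
  by elim: n => [|n IH] /=; rewrite ?KW// IH /= WK.
split.
- move=> x /=; have [D1 T1E] := TS (Wi x); split; first exact/DW.
  by rewrite TW// T1E (boB bW) (boD bW) (boZ bW) KW.
- move=> x Dx /=.
  have DWi : D (Wi x) by apply/DW; rewrite KW.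
  have -> : T1 x - z *: x = W (T (Wi x) - z *: Wi x).
    by rewrite (boB bW) (boZ bW) -TW// KW.
  by rewrite WK ST// (boB bW) KW.
- by move=> x /=; rewrite WK ES (bo0 bW).
- by move=> x /=; rewrite WK SE (bo0 bW).
Qed.

End ReducedData.

Section BlockSpectral.
Context {R : realType} {H : completeNormedModType R[i]}.
Variables (ip : {dot H for Num.conj}) (ip_norm : scalar_product_norm ip).
Variables (DA : set H) (A : H -> H) (lam : int -> R[i]) (mult : int -> nat).
Variables (P : int -> H -> H) (hA : unperturbed ip DA A lam mult P).
Variables (e : int * nat -> H) (fr : adapted_frame ip P mult e).
Variables (k : nat) (V : H -> H) (bV : bounded_op V) (dV : block_diagonal P k V).
Implicit Types (x y : H) (i j : int) (N : nat) (z : R[i]).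

Let lin := unp_linear hA.
Let resP := unp_resolution hA.
Local Notation T := (A - V).

Lemma T_linear : linear_on DA T.
Proof.
split=> [|a x y|a x y Dx Dy]; [exact: (on0 lin)|exact: (on_dom lin)|].
by rewrite !sub_opE (onE lin)// (boP bV) scalerBr opprD addrACA.
Qed.

Lemma Pb_dom N x : DA (Pblock P N x).
Proof. by rewrite PblockE; apply: (on_sum_dom lin) => n _; exact: (P_dom hA). Qed.

Lemma Pb_V N x : (k <= N)%N -> Pblock P N (V x) = V (Pblock P N x).
Proof.
move=> kN; have bPb := Pb_bo resP N.
suff E : Pblock P N \o V = V \o Pblock P N by exact: (congr1 (fun f => f x) E).
apply: (entry_inj resP (bo_comp bPb bV) (bo_comp bV bPb)) => i j; apply/funext => y.
rewrite !entryE /= (P_Pb resP) (Pb_P resP).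
case: (boolP (blk k i j)) => b; last first.
  rewrite dV// if_same; case: ifP => _; first by rewrite dV.
  by rewrite (bo0 bV) (bo0 (P_bo resP i)).
case/orP: b => [/andP[hi hj]|/eqP ->].
  by rewrite (leq_trans hi kN) (leq_trans hj kN).
by case: ifP => // _; rewrite (bo0 bV) (bo0 (P_bo resP j)).
Qed.

Lemma P_V n x : (k < `|n|)%N -> P n (V x) = V (P n x).
Proof.
move=> kn; suff E : P n \o V = V \o P n by exact: (congr1 (fun f => f x) E).
have bP := P_bo resP n.
apply: (entry_inj resP (bo_comp bP bV) (bo_comp bV bP)) => i j; apply/funext => y.
rewrite !entryE /= !(PP resP).
have nk m : blk k n m = (n == m) by rewrite /blk leqNgt kn.
case: (eqVneq i n) => [->|ni]; case: (eqVneq n j) => [nj|nj] //.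
- by rewrite nj.
- by rewrite dV ?(bo0 bV) ?(bo0 bP)// nk.
- by rewrite dV// blk_sym nk eq_sym.
- by rewrite (bo0 bV) (bo0 (P_bo resP i)).
Qed.

Lemma A_Pb N x : DA x -> A (Pblock P N x) = Pblock P N (A x).
Proof.
move=> Dx; rewrite !PblockE (on_sum lin) => [|n _]; last exact: (P_dom hA).
by apply: eq_bigr => n _; rewrite (A_P hA) (P_A hA).
Qed.

Lemma T_Pb N x : (k <= N)%N -> DA x -> T (Pblock P N x) = Pblock P N (T x).
Proof. by move=> kN Dx; rewrite !sub_opE A_Pb// (boB (Pb_bo resP N)) Pb_V. Qed.

Lemma TPb_bo N : bounded_op (T \o Pblock P N).
Proof.
rewrite (_ : T \o _ = (\sum_(n <- irange N) lam n *: P n) - (V \o Pblock P N)).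
  apply: bo_sub; last exact: (bo_comp bV (Pb_bo resP N)).
  by apply: bo_sum => n _; apply: bo_scale; exact: (P_bo resP).
apply/funext => x; rewrite /= !sub_opE fct_sumE PblockE (on_sum lin).
  by congr (_ - _); [apply: eq_bigr => n _; rewrite (A_P hA) scale_opE|rewrite /= PblockE].
by move=> n _; exact: (P_dom hA).
Qed.

(** Beyond a large N the diagonal operator A - z dominates V, and a Neumann series
    inverts A - V - z on the complement of the first N blocks. *)
Lemma tail_resolvent z N0 : exists N (S : H -> H), [/\ (N0 <= N)%N, bounded_op S,
  forall x, DA (S x) /\ T (S x) = z *: S x + x - Pblock P N x,
  forall x, DA x -> S (T x - z *: x) = x - Pblock P N x &
  (forall x, Pblock P N (S x) = 0) /\ (forall x, S (Pblock P N x) = 0)].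
Proof.
have [v v0 hv] := bo_bound bV.
pose L := 2 * (v + 1); have L0 : 0 < L by rewrite mulr_gt0// ltr_wpDl.
have [N1 hN1] := lam_far_from hA z L.
pose N := maxn N1 (maxn N0 k).
have kN : (k <= N)%N by rewrite !leq_max leqnn !orbT.
have NN0 : (N0 <= N)%N by rewrite !leq_max leqnn !orbT.
have far j : (N < `|j|)%N -> L < nm (lam j - z).
  by move=> h; apply: hN1; apply: leq_ltn_trans h; rewrite leq_max leqnn.
(* the reduced inverse of A - z, cut off at N *)
pose mu j : R[i] := if (`|j| <= N)%N then 0 else (lam j - z)^-1.
have muL j : nm (mu j) <= L^-1.
  rewrite /mu; case: leqP => [_|/far h]; first by rewrite nm0 invr_ge0 ltW.
  by rewrite nmV lef_pV2 ?posrE// ?ltW// (lt_trans L0).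
have Li0 : 0 <= L^-1 by rewrite invr_ge0 ltW.
have [Dg [bD hD PD]] := diag_op ip_norm resP Li0 muL.
have bDV : bounded_op (- (Dg \o V)) by apply: bo_opp; exact: (bo_comp bD bV).
have q01 : 0 <= (2^-1 : R) < 1 by apply/andP; split; lra.
have [|Y [bY YK KY]] := neumann_small bDV q01.
  move=> x; rewrite opp_opE nmN /= (le_trans (hD _))//.
  rewrite (le_trans (ler_wpM2l Li0 (hv x)))// mulrA ler_wpM2r ?nm_ge0//.
  by rewrite mulrC ler_pdivrMr// /L mulrA mulVf// mul1r lerDl.
have YE x : Y (Dg x) = Dg (V (Y (Dg x))) + Dg x.
  have := KY (Dg x); rewrite add_opE opp_opE /= => h.
  by rewrite addrC; apply/eqP; rewrite -subr_eq; apply/eqP.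
have PY j x : P j (Y (Dg x)) = mu j *: P j (V (Y (Dg x)) + x).
  by rewrite YE (boD (P_bo resP j)) !PD -scalerDr -(boD (P_bo resP j)) -YE.
exists N, (Y \o Dg); split => //.
- exact: (bo_comp bY bD).
- move=> x /=; set y := Y (Dg x).
  have Py0 : Pblock P N y = 0.
    apply: (P_ext resP) => j; rewrite (P_Pb resP) (bo0 (P_bo resP j)).
    by case: ifP => // h; rewrite /y PY /mu h scale0r.
  have [Dy Ay] : DA y /\ A y = z *: y + (V y + x) - Pblock P N (V y + x).
    apply: (in_dom hA) => j; have := PY j x; rewrite -/y; set u := V y + x; clearbody u.
    rewrite (boB (P_bo resP j)) (P_Pb resP) (boD (P_bo resP j)). rewrite (boZ (P_bo resP j)).
    move=> ->; rewrite /mu; case: (leqP (absz j) N) => h.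
      by rewrite scale0r !scaler0 add0r subrr.
    rewrite subr0; set w := P j u; rewrite -{2}[w]scale1r !scalerA -scalerDl; congr (_ *: _).
    have nz : lam j - z != 0 by rewrite -nm_eq0 gt_eqF// (lt_trans L0)// far.
    by apply: (mulIf nz); rewrite mulrDl -!mulrA mulVf//; ring.
  split => //; rewrite sub_opE Ay (boD (Pb_bo resP N)) Pb_V// Py0 (bo0 bV) add0r.
  by rewrite !addrA [LHS](ACl (1*3*4*(2*5))%AC) /= subrr addr0.
- move=> x Dx /=; pose y := x - Pblock P N x.
  have : Dg (T x - z *: x) = y - Dg (V y).
    apply: (P_ext resP) => j; rewrite (boB (P_bo resP j)) !PD /y /mu.
    rewrite (boB (P_bo resP j)) (P_Pb resP) (boB bV) (boB (P_bo resP j)) -Pb_V// (P_Pb resP).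
    case: (leqP (absz j) N) => h; first by rewrite !scale0r !subrr.
    have nz : lam j - z != 0 by rewrite -nm_eq0 gt_eqF// (lt_trans L0)// far.
    rewrite !subr0 sub_opE (boB (P_bo resP j)) (boB (P_bo resP j)) (P_A hA)// (boZ (P_bo resP j)).
    rewrite addrAC -scalerBl scalerBr scalerA mulVf// scale1r //.
  move=> ->; by have := YK y; rewrite add_opE opp_opE.
- split=> [x|x] /=.
    apply: (P_ext resP) => j; rewrite (P_Pb resP) (bo0 (P_bo resP j)).
    by case: ifP => // h; rewrite PY /mu h scale0r.
  rewrite (_ : Dg (Pblock P N x) = 0) ?(bo0 bY)//.
  apply: (P_ext resP) => j; rewrite PD (P_Pb resP) (bo0 (P_bo resP j)) /mu.
  by case: ifP => h; rewrite ?scale0r ?scaler0.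
Qed.

Local Notation idx := (option {n : int | (k < `|n|)%N}).
Local Notation Co := (coarse P k).

Definition co_size (o : idx) : nat :=
  if o is Some n then mult (val n) else \sum_(n <- irange k) mult n.

Lemma co_bo (o : idx) : bounded_op (Co o).
Proof. by case: o => [n|]; [exact: (P_bo resP)|exact: (Pb_bo resP)]. Qed.

Lemma co_idem (o : idx) x : Co o (Co o x) = Co o x.
Proof. by case: o => [n|] /=; [rewrite (P_idem resP)|rewrite (Pb_Pb resP)]. Qed.

Lemma co_orth (o o' : idx) x : o <> o' -> Co o (Co o' x) = 0.
Proof.
case: o => [[n hn]|]; case: o' => [[n' hn']|] //= ne.
- rewrite (PP resP); case: eqP => // nn; case: ne; congr Some.
  exact: val_inj.
- by rewrite (P_Pb resP) leqNgt hn.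
- by rewrite (Pb_P resP) leqNgt hn'.
Qed.

Lemma co_dom (o : idx) x : DA (Co o x).
Proof. by case: o => [n|]; [exact: (P_dom hA)|exact: Pb_dom]. Qed.

Lemma co_T (o : idx) x : DA x -> T (Co o x) = Co o (T x).
Proof.
case: o => [[n hn]|] Dx /=; last exact: T_Pb.
by rewrite !sub_opE (A_P hA) -(P_A hA)// (boB (P_bo resP n)) P_V.
Qed.

Lemma co_sa (o : idx) x y : ip (Co o x) y = ip x (Co o y).
Proof. by case: o => [n|] /=; [exact: (P_sa resP)|exact: (Pb_sa resP)]. Qed.

Lemma co_Pb (o : idx) : exists N0, forall N, (N0 <= N)%N ->
  (forall x, Pblock P N (Co o x) = Co o x) /\ (forall x, Co o (Pblock P N x) = Co o x).
Proof.
case: o => [[n hn]|] /=.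
  exists `|n|%N => N h; split=> x; first by rewrite (Pb_P resP) h.
  by rewrite (P_Pb resP) h.
by exists k => N h; split=> x; [rewrite (Pb_Pb resP)|rewrite (Pb_Pb' resP)].
Qed.

Lemma co_separate x : (forall o : idx, Co o x = 0) -> x = 0.
Proof.
move=> h; apply: (P_ext resP) => n; rewrite (bo0 (P_bo resP n)).
case: (leqP (absz n) k) => hn; last exact: (h (Some (exist _ n hn))).
by have := congr1 (P n) (h None); rewrite /= (P_Pb resP) hn (bo0 (P_bo resP n)).
Qed.

Lemma span_of_seq (I : eqType) (r : seq I) (w : I -> H) (c : H -> I -> R[i]) (Pi : H -> H) :
  (forall x, Pi x = \sum_(t <- r) c x t *: w t) ->
  exists v : 'I_(size r) -> H, forall x, exists a : 'I_(size r) -> R[i],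
    Pi x = \sum_t a t *: v t.
Proof.
move=> h; exists (fun t : 'I_(size r) => w (tnth (in_tuple r) t)) => x.
exists (fun t : 'I_(size r) => c x (tnth (in_tuple r) t)).
by rewrite h big_tnth.
Qed.

Lemma Pb_span N : exists v : 'I_(\sum_(n <- irange N) mult n) -> H,
  forall x, exists c : 'I_(\sum_(n <- irange N) mult n) -> R[i], Pblock P N x = \sum_t c t *: v t.
Proof.
pose r := [seq (n, t) | n <- irange N, t <- iota 0 (mult n)].
have <- : size r = (\sum_(n <- irange N) mult n)%N.
  rewrite size_allpairs_dep sumnE big_map; apply: eq_bigr => n _.
  by rewrite size_iota.
apply: (@span_of_seq _ r e (fun x t => ip x (e t))) => x.
rewrite PblockE /r big_allpairs_dep; apply: eq_bigr => n _.
rewrite (P_coord fr) -(big_mkord xpredT (fun t => ip x (e (n, t)) *: e (n, t))).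
by rewrite /index_iota subn0.
Qed.

Lemma co_span (o : idx) : exists v : 'I_(co_size o) -> H,
  forall x, exists c : 'I_(co_size o) -> R[i], Co o x = \sum_t c t *: v t.
Proof.
case: o => [n|]; last exact: Pb_span.
exists (fun t => e (val n, t : nat)) => x.
by exists (fun t => ip x (e (val n, t : nat))); exact: (P_coord fr).
Qed.

Definition eig (o : idx) z := exists2 y, y <> 0 & Co o y = y /\ T y = z *: y.

(** The reduced resolvent at z is put together from three invertible parts: the
    complement of the root space in the block o, the other blocks with index at
    most N, and the tail. *)
Lemma block_spectral (o : idx) : exists (s : seq R[i]) (E : R[i] -> H -> H),
  [/\ uniq s /\ (size s <= co_size o)%N,
      forall z, z \in s <-> eig o z,
      forall x, Co o x = \sum_(z <- s) E z x,
      forall z, z \notin s -> forall x, E z x = 0 &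
      forall z, (forall o', o' <> o -> ~ eig o' z) ->
        exists Nl S d, reduced_data DA T z (E z) Nl S d].
Proof.
have [N0 hN0] := co_Pb o; have [v1 hv1] := co_span o.
have bCo := co_bo o.
have bM N : (N0 <= N)%N -> bounded_op (T \o Co o).
  move=> /hN0[h _]; rewrite (_ : T \o Co o = (T \o Pblock P N) \o Co o).
    exact: (bo_comp (TPb_bo N) bCo).
  by apply/funext => x /=; rewrite h.
have bM1 := bM N0 (leqnn N0).
have CM x : Co o ((T \o Co o) x) = (T \o Co o) x.
  by rewrite /= -co_T ?co_idem//; exact: co_dom.
have MC x : (T \o Co o) (Co o x) = (T \o Co o) x by rewrite /= co_idem.
have [s [E [S1 [a [[us sz] sE sumE hE hS]]]]] := finite_rank_spectral bM1 bCo (co_idem o) CM MC hv1.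
exists s, E; split => //.
- move=> z; split.
    by move=> /sE[y y0 [Cy Ty]]; exists y => //; split => //; move: Ty; rewrite /= Cy.
  by move=> [y y0 [Cy Ty]]; apply/sE; exists y => //; split => //; rewrite /= Cy.
- by move=> z zs x; have [_ _ _ _ [_ _ _ h]] := hS z; exact: h.
move=> z hz.
have [N [S3 [NN bS3 TS3 ST3 [PS3 SP3]]]] := tail_resolvent z (maxn N0 k).
have kN : (k <= N)%N by apply: leq_trans NN; rewrite leq_maxr.
have [PC CP] := hN0 N (leq_trans (leq_maxl _ _) NN).
have bPb := Pb_bo resP N.
pose Pi2 := Pblock P N - Co o.
have bPi2 : bounded_op Pi2 by exact: bo_sub.
have Pi2E x : Pi2 x = Pblock P N x - Co o x by [].
have Pi2Pi2 x : Pi2 (Pi2 x) = Pi2 x.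
  rewrite [LHS]Pi2E Pi2E (boB bPb) (boB bCo) (Pb_Pb resP)// PC CP co_idem.
  by rewrite subrr subr0.
have CoPi2 x : Co o (Pi2 x) = 0 by rewrite Pi2E (boB bCo) CP co_idem subrr.
have Pi2Co x : Pi2 (Co o x) = 0 by rewrite Pi2E PC co_idem subrr.
have PbPi2 x : Pblock P N (Pi2 x) = Pi2 x.
  by rewrite Pi2E (boB bPb) (Pb_Pb resP)// PC.
have Pi2Pb x : Pi2 (Pblock P N x) = Pi2 x by rewrite !Pi2E (Pb_Pb resP)// CP.
have Pi2_dom x : DA (Pi2 x) by rewrite -PbPi2; exact: Pb_dom.
have Pi2T x : DA x -> T (Pi2 x) = Pi2 (T x).
  move=> Dx; rewrite !Pi2E (onB T_linear) ?T_Pb ?co_T//; [exact: Pb_dom|exact: co_dom].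
have bM2 : bounded_op (T \o Pi2).
  rewrite (_ : T \o Pi2 = (T \o Pblock P N) \o Pi2); first exact: (bo_comp (TPb_bo N) bPi2).
  by apply/funext => x /=; rewrite PbPi2.
have CM2 x : Pi2 ((T \o Pi2) x) = (T \o Pi2) x by rewrite /= -Pi2T ?Pi2Pi2//.
have MC2 x : (T \o Pi2) (Pi2 x) = (T \o Pi2) x by rewrite /= Pi2Pi2.
have [v2 hv2] : exists v : 'I_(\sum_(n <- irange N) mult n) -> H,
    forall x, exists c : 'I_(\sum_(n <- irange N) mult n) -> R[i], Pi2 x = \sum_t c t *: v t.
  have [v hv] := Pb_span N; exists (fun t => Pi2 (v t)) => x.
  have [c hc] := hv x; exists c; rewrite -Pi2Pb hc (bo_sumE bPi2).
  by apply: eq_bigr => t _; rewrite (boZ bPi2).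
have [s2 [E2 [S2 [a2 [_ s2E _ hE2 hS2]]]]] :=
  finite_rank_spectral bM2 bPi2 Pi2Pi2 CM2 MC2 hv2.
have zs2 : z \notin s2.
  apply/negP => /s2E[y y0 [Py Ty]].
  have Dy : DA y by rewrite -Py; exact: Pi2_dom.
  have {}Ty : T y = z *: y by move: Ty; rewrite /= Py.
  have [ o2 ho2] : exists o' : idx, Co o' y <> 0.
    apply: contrapT => h; apply: y0; apply: co_separate => o'.
    by apply: contrapT => h'; apply: h; exists o'.
  apply: (hz o2).
    by move=> oo2; apply: ho2; rewrite oo2 -Py CoPi2.
  exists (Co o2 y) => //; split; first exact: co_idem.
  by rewrite co_T// Ty (boZ (co_bo o2)).
have [[bE bS1] EE CE EC EM] := hE z.
have [nil CS MS SM [ES SE SC _]] := hS z.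
have [[_ bS2] _ _ _ _] := hE2 z.
have [_ CS2 MS2 SM2 [_ _ SC2 E20]] := hS2 z.
have {}E20 := E20 zs2.
have DE x : DA (E z x) by rewrite -CE; exact: co_dom.
have TE x : (T \o Co o) (E z x) = T (E z x) by rewrite /= CE.
pose Nl := ((T \o Co o) \o E z) - z *: E z.
have NlE x : Nl x = T (E z x) - z *: E z x by rewrite [LHS]sub_opE scale_opE /= CE.
have ENl x : E z (Nl x) = Nl x.
  by rewrite NlE (boB bE) (boZ bE) EE -TE EM EE TE.
have S1E x : DA (S1 z x) by rewrite -CS; exact: co_dom.
have S2E x : DA (S2 z x) by rewrite -CS2; exact: Pi2_dom.
have T1 x : T (S1 z x) - z *: S1 z x = Co o x - E z x by rewrite -MS /= CS.
have T2 x : T (S2 z x) - z *: S2 z x = Pi2 x.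
  by have := MS2 x; rewrite /= CS2 E20 subr0.
have Ssum x : (S1 z + S2 z + S3) x = S1 z x + S2 z x + S3 x by [].
exists Nl, (S1 z + S2 z + S3), (a z); split.
- split => //; first by apply: bo_sub; [exact: (bo_comp bM1 bE)|exact: bo_scale].
  by apply: bo_add => //; exact: bo_add.
- exact: EE.
- by move=> x; split => //; rewrite NlE [RHS]addrC subrK.
- split => //; first by move=> x; rewrite !NlE EE.
  move=> x; rewrite -(nil x).
  have h n : iter n.+1 Nl x = iter n.+1 (fun y => (T \o Co o) y - z *: y) (E z x).
    elim: n => [|n IH]; first by rewrite /= NlE CE.
    rewrite iterS [in RHS]iterS -IH.
    have -> : iter n.+1 Nl x = E z (iter n.+1 Nl x) by rewrite iterS ENl.
    by rewrite NlE EE TE.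
  exact: h.
split.
- move=> x; have [D3 T3] := TS3 x; split.
    by apply: (onD_dom lin) => //; apply: (onD_dom lin).
  rewrite Ssum (onD T_linear) ?(onD T_linear)//; last exact: (onD_dom lin).
  have -> : T (S1 z x) = z *: S1 z x + (Co o x - E z x) by rewrite -T1 [RHS]addrC subrK.
  have -> : T (S2 z x) = z *: S2 z x + Pi2 x by rewrite -T2 [RHS]addrC subrK.
  rewrite T3 !scalerDr Pi2E.
  set p := z *: _; set q := z *: S2 _ _; set r := z *: S3 _.
  set c := Co o x; set b := Pblock P N x; set f := E z x.
  clearbody p q r c b f; rewrite !addrA.
  by rewrite [LHS](ACl (1*4*7*8*3*(2*6)*(5*9))%AC) /= !subrr !addr0.
- move=> x Dx; rewrite Ssum.
  have h1 : S1 z (T x - z *: x) = Co o x - E z x.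
    rewrite -(SM x) -(SC (T x - z *: x)) (boB bCo) (boZ bCo) -co_T//.
    by rewrite (boB bS1) (boZ bS1) [S1 z (Co o x)]SC.
  have h2 : S2 z (T x - z *: x) = Pi2 x.
    have := SM2 x; rewrite E20 subr0 => <-.
    rewrite -(SC2 (T x - z *: x)) (boB bPi2) (boZ bPi2) -Pi2T//.
    by rewrite (boB bS2) (boZ bS2) [S2 z (Pi2 x)]SC2.
  rewrite h1 h2 ST3// Pi2E !addrA.
  by rewrite [LHS](ACl (5*2*(1*4)*(3*6))%AC) /= !subrr !addr0.
- move=> x; rewrite Ssum !(boD bE) ES add0r.
  have -> : E z (S2 z x) = 0 by rewrite -EC -CS2 CoPi2 (bo0 bE).
  by rewrite add0r -EC -CP PS3 (bo0 bCo) (bo0 bE).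
- move=> x; rewrite Ssum SE add0r.
  have -> : S2 z (E z x) = 0 by rewrite -SC2 -CE Pi2Co (bo0 bS2).
  by rewrite add0r -CE -PC SP3.
Qed.

End BlockSpectral.

(** * Nuclear operators *)

Section Padding.
Context {R : realType} {V : normedModType R[i]}.
Variables (I J : choiceType) (h : I -> J) (g : J -> option I).
Hypotheses (hK : pcancel h g) (gK : forall j i, g j = Some i -> h i = j).

Let pre (F : {fset J}) : {fset I} := [fset i in pmap g F]%fset.

Lemma mem_pre F i : (i \in pre F) = (h i \in F).
Proof.
rewrite inE /= mem_pmap; apply/mapP/idP => [[j jF E]|iF].
  by rewrite (gK (esym E)).
by exists (h i); rewrite ?hK.
Qed.

Lemma sum_pre (W : nmodType) (f : I -> W) (F : {fset J}) :
  \sum_(j <- F) oapp f 0 (g j) = \sum_(i <- pre F) f i.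
Proof.
have -> : \sum_(i <- pre F) f i = \sum_(i <- pmap g F) f i.
  apply: perm_big; apply: uniq_perm; first exact: fset_uniq.
    apply: (@map_uniq _ _ h); apply: (subseq_uniq _ (fset_uniq F)).
    suff -> : map h (pmap g F) = [seq j <- F | g j] by apply: seq.filter_subseq.
    elim: (F : seq J) => //= j s IH; case E : (g j) => [i|] //=.
    by rewrite IH (gK E).
  by move=> i; rewrite /pre inE.
elim: (F : seq J) => [|j s IH] /=; first by rewrite !big_nil.
by rewrite big_cons IH; case: (g j) => [i|] /=; rewrite ?big_cons ?add0r.
Qed.

(** Reindexing along an injection, with zeros off its image. It serves to pass
    from any countable index type to nat, to add two expansions on a sum type,
    and to restrict a double family to one row. *)
Lemma hassum_pad (f : I -> V) s :
  hassum f s <-> hassum (fun j => oapp f 0 (g j)) s.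
Proof.
split=> /hassum_nmP hs; apply/hassum_nmP => eps /hs[A hA].
  exists (h @` A)%fset => F AF; rewrite sum_pre; apply: hA.
  apply/fsubsetP => i iA; rewrite mem_pre; apply: (fsubsetP AF).
  exact: in_imfset.
exists (pre A) => F AF; have := hA (h @` F `|` A)%fset (fsubsetUr _ _).
rewrite sum_pre; suff -> : pre (h @` F `|` A)%fset = F by [].
apply/fsetP => i; rewrite mem_pre in_fsetU; apply/orP/idP => [[|]|iF].
- by move=> /imfsetP[i' /= i'F /(pcan_inj hK) ->].
- by rewrite -mem_pre => /(fsubsetP AF).
- by left; exact: in_imfset.
Qed.

End Padding.

Section TraceClass.
Context {R : realType} {H : completeNormedModType R[i]}.
Variables (ip : {dot H for Num.conj}) (ip_norm : scalar_product_norm ip).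

(** Unlike the series of the definition of nuclear operators these expansions are
    indexed by arbitrary types and summed unconditionally, which makes them easy
    to add and to compress. *)
Definition nuclear_family (I : choiceType) (a b : I -> H) (X : H -> H) :=
  (exists c : R, forall F : {fset I}, \sum_(i <- F) nm (a i) * nm (b i) <= c) /\
  forall x, hassum (fun i => ip x (b i) *: a i) (X x).

Definition trace_class X := exists a b : nat -> H, nuclear_family a b X.

Lemma nuclear_pad (I J : choiceType) (h : I -> J) (g : J -> option I) a b X :
  pcancel h g -> (forall j i, g j = Some i -> h i = j) ->
  nuclear_family a b X ->
  nuclear_family (fun j => oapp a 0 (g j)) (fun j => oapp b 0 (g j)) X.
Proof.
move=> hK gK [[c hc] hX]; split.
  exists c => F; apply: le_trans (hc [fset i in pmap g F]%fset).
  rewrite -(sum_pre gK (fun i => nm (a i) * nm (b i))).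
  by apply: ler_sum => j _; case: (g j) => [i|] /=; rewrite ?nm0 ?mulr0.
move=> x; have /(hassum_pad hK gK) := hX x; congr (hassum _ _).
by apply/funext => j; case: (g j) => [i|] //=; rewrite scaler0.
Qed.

Lemma family_trace_class (I : countType) (a b : I -> H) X :
  nuclear_family a b X -> trace_class X.
Proof.
move=> hX; exists (fun j => oapp a 0 (@pickle_inv I j)), (fun j => oapp b 0 (@pickle_inv I j)).
have := @nuclear_pad I nat choice.pickle (@pickle_inv I) a b X (@pickleK_inv I) _ hX; apply.
by move=> j i E; have := @pickle_invK I j; rewrite /ocancel E.
Qed.

Lemma trace_classD X Y : trace_class X -> trace_class Y -> trace_class (X + Y).
Proof.
move=> [a [b hX]] [a' [b' hY]].
pose gl (j : nat + nat) := if j is inl i then Some i else None.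
pose gr (j : nat + nat) := if j is inr i then Some i else None.
have hl : nuclear_family (fun j => oapp a 0 (gl j)) (fun j => oapp b 0 (gl j)) X.
  by apply: (@nuclear_pad nat (nat + nat)%type inl gl a b X _ _ hX) => // -[j|j] i //= [->].
have hr : nuclear_family (fun j => oapp a' 0 (gr j)) (fun j => oapp b' 0 (gr j)) Y.
  by apply: (@nuclear_pad nat (nat + nat)%type inr gr a' b' Y _ _ hY) => // -[j|j] i //= [->].
apply: (@family_trace_class (nat + nat)%type
  (fun j => oapp a 0 (gl j) + oapp a' 0 (gr j)) (fun j => oapp b 0 (gl j) + oapp b' 0 (gr j))).
case: hl hr => [[c hc] hl] [[c' hc'] hr]; split.
  exists (c + c') => F; apply: le_trans (lerD (hc F) (hc' F)).
  rewrite -big_split /=; apply: ler_sum => -[j|j] _ /=.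
    by rewrite !addr0 nm0 mulr0 addr0.
  by rewrite !add0r nm0 mulr0 add0r.
move=> x; have := hassumD (hl x) (hr x); congr (hassum _ _).
by apply/funext => -[j|j] /=; rewrite ?addr0 ?add0r ?scaler0 ?addr0 ?add0r.
Qed.

Lemma trace_class_nuclear X : trace_class X -> nuclear ip X.
Proof.
move=> [a [b [[c hc] hX]]]; exists a, b; split.
  apply: (@le_lt_trans _ _ c%:E); last exact: ltry.
  by apply/esum_le_fset => // i; rewrite mulr_ge0 ?nm_ge0.
move=> x; apply/cvg_nmP => eps e0.
have /hassum_nmP/(_ eps e0)[F hF] := hX x.
exists (\max_(n <- F) n).+1 => // N /= hN.
have -> : series (fun n => ip x (b n) *: a n) N
    = \sum_(n <- [fset n in iota 0 N]%fset) ip x (b n) *: a n.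
  rewrite seriesEnat /= /index_iota subn0; apply: perm_big; apply: uniq_perm.
  - exact: iota_uniq.
  - exact: fset_uniq.
  - by move=> n; rewrite inE.
apply: hF; apply/fsubsetP => n nF; rewrite inE /= mem_iota /= add0n.
apply: leq_trans hN; rewrite ltnS (big_rem n)//= leq_maxl //.
Qed.

Variables (P : int -> H -> H) (resP : resolution_of_identity ip P).
Variables (d : int -> nat) (e : int * nat -> H) (fr : adapted_frame ip P d e).

Lemma sq_sum_bound (I : choiceType) (u v : I -> H) (c c' : R) :
  (\esum_(i in [set: I]) (nm (u i) ^+ 2)%:E <= c%:E)%E ->
  (\esum_(i in [set: I]) (nm (v i) ^+ 2)%:E <= c'%:E)%E ->
  forall F : {fset I}, \sum_(i <- F) nm (u i) * nm (v i) <= c + c'.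
Proof.
have g0 (w : I -> H) i : 0 <= nm (w i) ^+ 2 by exact: sqr_ge0.
move=> /(esum_le_fset _ (g0 u)) hu /(esum_le_fset _ (g0 v)) hv F.
apply: le_trans (lerD (hu F) (hv F)); rewrite -big_split /=.
by apply: ler_sum => i _; have := nm_ge0 (u i); have := nm_ge0 (v i); nra.
Qed.

(** Expand Y x in the frame: its coefficients are ip x (b k) for the adjoint
    vectors b k of Y. *)
Lemma HS_product_expansion X Y : HS e X -> HS e Y -> exists b : int * nat -> H,
  (\esum_(k in [set: int * nat]) (nm (b k) ^+ 2)%:E = hs2 e Y)%E /\
  forall x, hassum (fun k => ip x (b k) *: X (e k)) (X (Y x)).
Proof.
move=> hX hY; have [b [bE bs]] := adjoint_vectors ip_norm resP fr (HS_bo hY).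
exists b; split => // x.
have := frame_hassum ip_norm (e_orth fr) (e_unit fr) (e_total resP fr) (Y x).
move=> /(bo_hassum (HS_bo hX)); congr (hassum _ _).
by apply/funext => k; rewrite (boZ (HS_bo hX)) bE.
Qed.

Lemma HS_product_trace_class X Y : HS e X -> HS e Y -> trace_class (X \o Y).
Proof.
move=> hX hY; have [b [bs hb]] := HS_product_expansion hX hY.
apply: (@family_trace_class _ (X \o e) b); split => //.
exists (hsn e X ^+ 2 + hsn e Y ^+ 2); apply: sq_sum_bound.
  by rewrite -[leLHS]/(hs2 e X) hs2_hsn.
by rewrite bs hs2_hsn.
Qed.

(** Compressing the expansion of X Y by every P n gives a family indexed by pairs
    (n, k). By Parseval in n the square sums of its vectors are those of the
    original expansion. *)
Lemma diagonal_HS_product_trace_class X Y D : HS e X -> HS e Y -> bounded_op D ->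
  (forall i j x, P i (D (P j x)) = if i == j then P i (X (Y (P j x))) else 0) ->
  trace_class D.
Proof.
move=> hX hY bD hD; have [b [bs hb]] := HS_product_expansion hX hY.
pose a' (nk : int * (int * nat)) := P nk.1 (X (e nk.2)).
pose b' (nk : int * (int * nat)) := P nk.1 (b nk.2).
have sq (w : int * nat -> H) :
    (\esum_(nk in [set: int * (int * nat)]) (nm (P nk.1 (w nk.2)) ^+ 2)%:E =
     \esum_(k in [set: int * nat]) (nm (w k) ^+ 2)%:E)%E.
  rewrite -(@esum_pair _ _ _ (fun n k => (nm (P n (w k)) ^+ 2)%:E)); last first.
    by move=> n k; rewrite lee_fin sqr_ge0.
  rewrite esum_swap; last by move=> n k; rewrite lee_fin sqr_ge0.
  by apply: eq_esum => k _; exact: (P_sq ip_norm resP).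
have bound : exists c : R, forall F : {fset int * (int * nat)},
    \sum_(i <- F) nm (a' i) * nm (b' i) <= c.
  exists (hsn e X ^+ 2 + hsn e Y ^+ 2); apply: sq_sum_bound.
    by rewrite [leLHS](sq (X \o e)) -[leLHS]/(hs2 e X) hs2_hsn.
  by rewrite [leLHS](sq b) bs hs2_hsn.
apply: (@family_trace_class _ a' b'); split => // x.
have [c hc] := bound.
have fin : (\esum_(i in [set: int * (int * nat)]) (nm (a' i) * nm (b' i))%:E < +oo)%E.
  apply: (@le_lt_trans _ _ c%:E); last exact: ltry.
  by apply/esum_le_fset => // i; rewrite mulr_ge0 ?nm_ge0.
have [s hs] : exists s, hassum (fun i => ip x (b' i) *: a' i) s.
  apply: cauchy_hassum => eps e0.
  have p : 0 < nm x + 1 by rewrite ltr_wpDl ?nm_ge0.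
  have [|A hA] := esum_tail _ fin (divr_gt0 e0 p).
    by move=> i; rewrite mulr_ge0 ?nm_ge0.
  exists A => F /hA; rewrite ltr_pdivlMr// => h; apply: le_lt_trans h.
  apply: le_trans (nm_sum _ _ _) _; rewrite mulr_suml; apply: ler_sum => i _.
  rewrite nmZ; have := nm_ip ip_norm x (b' i) => h.
  have n1 := nm_ge0 (a' i); have n2 := nm_ge0 (b' i); have n3 := nm_ge0 x.
  by rewrite (le_trans (ler_wpM2r n1 h))//; nra.
suff <- : s = D x by [].
(* both s and D x have the m-th coordinate given by the m-th row of the family *)
apply: (P_ext resP) => m; have bP := P_bo resP m.
pose g (nk : int * (int * nat)) := if nk.1 == m then Some nk.2 else None.
have gK nk k : g nk = Some k -> (m, k) = nk.
  by case: nk => n k'; rewrite /g /=; case: eqP => // -> [->].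
have hK : pcancel (fun k : int * nat => (m, k)) g by move=> k; rewrite /g /= eqxx.
have h1 : hassum (fun k => ip x (P m (b k)) *: P m (X (e k))) (P m s).
  apply/(hassum_pad hK gK); have := bo_hassum bP hs; congr (hassum _ _).
  apply/funext => -[n k]; rewrite /g /= (boZ bP) /a' /b' /= (PP resP) eq_sym.
  by case: eqP => [->|_] //=; rewrite scaler0.
have h2 : hassum (fun k => ip x (P m (b k)) *: P m (X (e k))) (P m (X (Y (P m x)))).
  have := bo_hassum bP (hb (P m x)); congr (hassum _ _).
  by apply/funext => k; rewrite (boZ bP) (P_sa resP).
rewrite (hassum_unique h1 h2).
apply: (hassum_unique (f := fun j => P m (D (P j x)))); last first.
  have := bo_hassum (bo_comp bP bD) (P_hassum resP x) => //.
have := @hassum_fin _ _ _ (fun j => P m (D (P j x))) [fset m]%fset.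
rewrite big_seq_fset1 hD eqxx; apply => j; rewrite inE => jm.
by rewrite hD eq_sym (negbTE jm).
Qed.

End TraceClass.

(** * Disjointness of the spectra of the blocks *)

Lemma near_far_arith {R : realType} (t q d : R) :
  0 < d -> 5 * (q + 1) + d < t -> 5 * (q + 1) <= t - d / 6.
Proof. by move=> d0 h; lra. Qed.

Lemma near_near_arith {R : realType} (d : R) : 0 < d -> d <= d / 6 + d / 6 -> False.
Proof. by move=> d0 h; lra. Qed.

Section DisjointBlocks.
Context {R : realType} {H : completeNormedModType R[i]}.
Variables (ip : {dot H for Num.conj}) (ip_norm : scalar_product_norm ip).
Variables (DA : set H) (A : H -> H) (lam : int -> R[i]) (mult : int -> nat).
Variables (P : int -> H -> H) (hA : unperturbed ip DA A lam mult P).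
Variables (e : int * nat -> H) (fr : adapted_frame ip P mult e).
Variables (del : R) (del0 : 0 < del).
Hypothesis gapP : forall i j, i != j -> del <= nm (lam i - lam j).

Let lin := unp_linear hA.
Let resP := unp_resolution hA.

(** For an eigenvector y one has (lam n - z) y = P_n V y. *)
Lemma eig_block_near (k : nat) V n z (c : R) : bounded_op V -> block_diagonal P k V ->
  (forall y, nm (P (val n) (V y)) <= c * nm y) ->
  eig A P V (Some n : option {n : int | (k < `|n|)%N}) z -> nm (lam (val n) - z) <= c.
Proof.
case: n => n hn bV dV hc [y y0 [/= Py Ty]].
have E : (lam n - z) *: y = P n (V y).
  have Ay : A y = lam n *: y by rewrite -{1}Py (A_P hA) Py.
  have -> : V y = A y - z *: y by rewrite -Ty sub_opE opprB addrC subrK.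
  by rewrite Ay -scalerBl (boZ (P_bo resP n)) Py.
have ny : 0 < nm y by rewrite lt_neqAle nm_ge0 andbT eq_sym nm_eq0; apply/eqP.
by rewrite -(ler_pM2r ny) -nmZ E.
Qed.

(** For large k the eigenvalues of the single blocks stay near their lam n. An
    eigenvector of the central block whose eigenvalue were near some lam n would
    be small both on the first N coordinates, from which lam n is far, and on the
    others, where V is small. *)
Lemma blocks_disjoint Q : HS e Q -> exists2 eta : R, 0 < eta & exists K, forall k V,
  (K <= k)%N -> HS e V -> block_diagonal P k V -> hsn e (V - Jt P k Q) <= eta ->
  forall (o o' : option {n : int | (k < `|n|)%N}) z, o <> o' ->
    eig A P V o z -> eig A P V o' z -> False.
Proof.
(* V differs from J_k Q by eta and J_k Q from its first N rows by eta, so the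
   eigenvalues of the single blocks are within del / 6 of their lam n *)
move=> hQ; pose eta := del / 12; have eta0 : 0 < eta by rewrite divr_gt0.
have [N hN] := hs_tail ip_norm resP fr hQ eta0.
pose q := hsn e Q + eta; have q0 : 0 <= q by rewrite addr_ge0 ?hsn_ge0// ltW.
(* distance that makes the first N coordinates at most a fifth of the vector *)
pose L := 5 * (q + 1) + del.
have [K hK] := lam_far_block hA N L.
exists eta => //; exists (maxn N K) => k V kNK hV dV hVQ.
have kN : (N <= k)%N by apply: leq_trans kNK; rewrite leq_maxl.
have kK : (K <= k)%N by apply: leq_trans kNK; rewrite leq_maxr.
have bV := HS_bo hV; have bPb := Pb_bo resP N.
have [hJ hJn] := Jt_HS ip_norm hA fr k hQ.
have bJ := HS_bo hJ.
have hVn y : nm (V y) <= q * nm y.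
  rewrite (le_trans (op_hs ip_norm resP fr y hV))// ler_wpM2r ?nm_ge0//.
  have [hD _] := HSB hV hJ; have [_] := HSD hD hJ.
  rewrite subrK => /le_trans; apply; rewrite addrC /q; exact: lerD.
have tail y : nm (V y - Pblock P N (V y)) <= (del / 6) * nm y.
  pose Y := idfun - Pblock P N.
  have YE x : Y x = x - Pblock P N x by [].
  have bY : bounded_op Y by apply: bo_sub => //; exact: bo_id.
  have Y1 x : nm (Y x) <= 1 * nm x by rewrite mul1r YE; exact: (Pb_compl_le ip_norm resP).
  have [hD _] := HSB hV hJ.
  have h1 : nm (Y ((V - Jt P k Q) y)) <= eta * nm y.
    rewrite (le_trans (Y1 _))// mul1r (le_trans (op_hs ip_norm resP fr y hD))//.
    by rewrite ler_wpM2r ?nm_ge0.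
  have [|||hYJ hYJn] := hN (Y \o Jt P k Q) 1; rewrite ?ler01//.
  - exact: (bo_comp bY bJ).
  - move=> i j x; rewrite /= YE (boB (P_bo resP i)) (P_Pb resP).
    rewrite (Jt_entry ip_norm hA k (HS_bo hQ)).
    case: (leqP (absz i) N) => hi /=.
      by rewrite subrr nm0; case: ifP => _; rewrite ?mul0r ?mul1r// nm_ge0.
    by rewrite subr0 mul1r; case: ifP => // _; rewrite nm0 nm_ge0.
  have h2 : nm (Y (Jt P k Q y)) <= eta * nm y.
    rewrite (le_trans (op_hs ip_norm resP fr y hYJ))// ler_wpM2r ?nm_ge0//.
    by rewrite -[leRHS]mul1r.
  have -> : V y - Pblock P N (V y) = Y ((V - Jt P k Q) y) + Y (Jt P k Q y).
    by rewrite -(boD bY) sub_opE subrK.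
  rewrite (le_trans (nmD _ _))// (le_trans (lerD h1 h2))// -mulrDl ler_wpM2r ?nm_ge0//.
  by rewrite /eta; lra.
have near n z : eig A P V (Some n : option {n : int | (k < `|n|)%N}) z ->
    nm (lam (val n) - z) <= del / 6.
  apply: eig_block_near => // y.
  apply: le_trans (tail y); apply: le_trans (P_le ip_norm resP (val n) _).
  rewrite (boB (P_bo resP _)) (P_Pb resP); case: leqP => [h|_]; last by rewrite subr0.
  by have := valP n; rewrite /= ltnNge (leq_trans h kN).
have far n z : (k < `|n|)%N -> nm (lam n - z) <= del / 6 ->
    eig A P V (None : option {n : int | (k < `|n|)%N}) z -> False.
  move=> kn nz [y y0 [/= Py Ty]].
  have PiV i : P i (V y) = (lam i - z) *: P i y.
    have Dy : DA y by rewrite -Py; exact: (Pb_dom hA).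
    have -> : V y = A y - z *: y by rewrite -Ty sub_opE opprB addrC subrK.
    by rewrite (boB (P_bo resP i)) (boZ (P_bo resP i)) (P_A hA)// scalerBl.
  have ny : 0 < nm y by rewrite lt_neqAle nm_ge0 andbT eq_sym nm_eq0; apply/eqP.
  have tri i : nm (lam i - lam n) - del / 6 <= nm (lam i - z).
    rewrite lerBlDr; have -> : lam i - lam n = (lam i - z) - (lam n - z) by ring.
    by rewrite (le_trans (nmBD _ _))// lerD2l.
  have L0 : 0 < 5 * (q + 1) by rewrite mulr_gt0// ltr_wpDl.
  have h1 : nm (Pblock P N y) <= (5 * (q + 1))^-1 * nm (V y).
    apply: (P_dominated ip_norm resP); first by rewrite invr_ge0 ltW.
    move=> i; rewrite (P_Pb resP); case: leqP => hi; last by rewrite nm0 mulr_ge0 ?invr_ge0 ?nm_ge0// ltW.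
    rewrite PiV nmZ mulrA ler_peMl ?nm_ge0// mulrC ler_pdivlMr// mul1r.
    have h : 5 * (q + 1) <= nm (lam i - lam n) - del / 6.
      exact: (near_far_arith del0 (hK i n hi (leq_ltn_trans kK kn))).
    exact: le_trans h (tri i).
  have h2 : nm (y - Pblock P N y) <= (5 * del / 6)^-1 * nm (V y - Pblock P N (V y)).
    have d0 : 0 < 5 * del / 6 by rewrite divr_gt0// mulr_gt0.
    apply: (P_dominated ip_norm resP); first by rewrite invr_ge0 ltW.
    move=> i; rewrite !(boB (P_bo resP i)) !(P_Pb resP); case: leqP => hi.
      by rewrite !subrr nm0 mulr0.
    rewrite !subr0 PiV nmZ mulrA; case: (leqP (absz i) k) => hik; last first.
      by rewrite -Py (P_Pb resP) leqNgt hik /= nm0 mulr0.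
    rewrite ler_peMl ?nm_ge0// mulrC ler_pdivlMr// mul1r.
    have /gapP h : i != n by apply: contraTneq hik => ->; rewrite -ltnNge.
    have {}h : 5 * del / 6 <= nm (lam i - lam n) - del / 6 by lra.
    exact: le_trans h (tri i).
  have h3 : nm y <= nm (Pblock P N y) + nm (y - Pblock P N y).
    by rewrite -[X in nm X <= _](subrK (Pblock P N y)) addrC (le_trans (nmD _ _))// addrC.
  have h4 : nm (Pblock P N y) <= 5^-1 * nm y.
    apply: le_trans h1 _; rewrite invfM -mulrA ler_wpM2l ?invr_ge0//.
    by rewrite mulrC ler_pdivrMr ?ltr_wpDl// (le_trans (hVn y))// mulrC ler_wpM2l ?nm_ge0// lerDl.
  have h5 : nm (y - Pblock P N y) <= 5^-1 * nm y.
    apply: le_trans h2 _; rewrite mulrC ler_pdivrMr ?divr_gt0 ?mulr_gt0//.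
    by apply: le_trans (tail y) _; rewrite (_ : 5^-1 * _ * _ = del / 6 * nm y)//; field.
  by lra.
move=> [n|] [n'|] z ne; last by case: ne.
- move=> /near h /near h'; have nn : val n != val n'.
    by apply/eqP => E; apply: ne; congr Some; exact: val_inj.
  have := gapP nn; have -> : lam (val n) - lam (val n') = (lam (val n) - z) - (lam (val n') - z) by ring.
  move=> /le_trans /(_ (nmBD _ _)) h2; have h3 := le_trans h2 (lerD h h').
  exact: near_near_arith del0 h3.
- by move=> /near h; apply: (far (val n)) => //; exact: (valP n).
- by move=> h1 /near h; apply: (far (val n')) h1 => //; exact: (valP n').
Qed.

End DisjointBlocks.

(** * Transport by a similarity *)

Section PulledBackProduct.
Context {R : realType} {H : completeNormedModType R[i]}.
Variables (ip : {dot H for Num.conj}) (ip_norm : scalar_product_norm ip).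

(** The hypotheses on Y are arguments of the definition so that the form is a
    scalar product without further conditions. *)
Definition pullback_product (Y : H -> H) of bounded_op Y & injective Y :=
  fun x y : H => ip (Y x) (Y y).

Variables (Y : H -> H) (bY : bounded_op Y) (injY : injective Y).

HB.instance Definition _ := bilinear_isBilinear.Build R[i] H H R[i]
  ( *%R ) (Num.conj \; *%R) (pullback_product bY injY)
  ((fun z a x y => etrans (congr1 (ip^~ (Y z)) (boP bY a x y))
      (etrans (ipDl ip _ _ _) (congr1 (fun w => w + _) (ipZl ip _ _ _)))),
   (fun z a x y => etrans (congr1 (ip (Y z)) (boP bY a x y))
      (etrans (ipDr ip _ _ _) (congr1 (fun w => w + _) (ipZr ip _ _ _))))).

Lemma pullback_hermitian x y :
  pullback_product bY injY x y = (-1) ^+ false * Num.conj (pullback_product bY injY y x).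
Proof. by rewrite expr0 mul1r /pullback_product -ipC. Qed.

HB.instance Definition _ := isHermitianSesquilinear.Build R[i] H false Num.conj
  (pullback_product bY injY) pullback_hermitian.

Lemma pullback_gt0 x : x != 0 -> 0 < pullback_product bY injY x x.
Proof.
move=> x0; rewrite /pullback_product (ip_nm ip_norm) ltcR exprn_gt0//.
rewrite lt_neqAle nm_ge0 andbT eq_sym nm_eq0; apply: contraNneq x0.
by move=> h; apply/eqP/injY; rewrite h (bo0 bY).
Qed.

HB.instance Definition _ := isDotProduct.Build R[i] H (pullback_product bY injY) pullback_gt0.

Definition pullback_dot : {dot H for Num.conj} := pullback_product bY injY.

End PulledBackProduct.

Section TransportedResolution.
Context {R : realType} {H : completeNormedModType R[i]}.
Variables (ip : {dot H for Num.conj}) (ip_norm : scalar_product_norm ip).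
Variables (DA : set H) (A : H -> H) (lam : int -> R[i]) (mult : int -> nat).
Variables (P : int -> H -> H) (hA : unperturbed ip DA A lam mult P).
Variable k : nat.
Local Notation idx := (option {n : int | (k < `|n|)%N}).
Local Notation Co := (coarse P k).
Let resP := unp_resolution hA.

(** The coarse projections are orthogonal; the sum of the projections of x exists
    by Pythagoras and all its coarse coordinates are those of x. *)
Lemma co_hassum x : hassum (fun o : idx => Co o x) x.
Proof.
have cob := @co_bo _ _ _ _ _ _ _ _ hA k.
have coo o o' : o != o' -> ip (Co o x) (Co o' x) = 0.
  move=> ne; rewrite (co_sa hA) (co_orth hA) ?ip0r//; exact/eqP.
have sums F : \sum_(o <- (F : {fset idx})) nm (Co o x) ^+ 2 <= nm x ^+ 2.
  have E := nm2_sum_orth ip_norm (fset_uniq F) coo.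
  rewrite -E; set p := \sum_(o <- F) Co o x; rewrite ler_sqr ?nnegrE ?nm_ge0//.
  have h : nm p ^+ 2 <= nm x * nm p.
    apply: le_trans (nm_ip ip_norm x p); rewrite E.
    suff -> : ip x p = (\sum_(o <- F) nm (Co o x) ^+ 2)%:C.
      rewrite nmC ger0_norm// sumr_ge0// => o _; exact: sqr_ge0.
    rewrite /p ip_sumr rmorph_sum /=; apply: eq_bigr => o _.
    by rewrite -(co_idem hA) -(co_sa hA) (co_idem hA) (ip_nm ip_norm).
  have := nm_ge0 p; rewrite le_eqVlt => /predU1P[<-|p0]; first exact: nm_ge0.
  by rewrite -(ler_pM2r p0) -expr2.
have [s hs] : exists s, hassum (fun o : idx => Co o x) s.
  apply: (ortho_hassum ip_norm coo).
  apply: (@le_lt_trans _ _ (nm x ^+ 2)%:E); last exact: ltry.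
  by apply/esum_le_fset => // o; exact: sqr_ge0.
suff E : x - s = 0 by rewrite -[X in hassum _ X](subrK s) E add0r.
apply: (co_separate hA (k := k)) => o1; rewrite (boB (cob o1)); apply/eqP; rewrite subr_eq0; apply/eqP.
apply: (hassum_unique (f := fun o : idx => Co o1 (Co o x))); last exact: (bo_hassum (cob o1) hs).
have := @hassum_fin _ _ _ (fun o : idx => Co o1 (Co o x)) [fset o1]%fset.
rewrite big_seq_fset1 (co_idem hA); apply => o2; rewrite inE => /eqP ne.
by rewrite (co_orth hA)// => E; apply: ne; rewrite E.
Qed.

Variables (W Wi : H -> H) (bW : bounded_op W) (iW : is_inverse W Wi).

(** For the scalar product pulled back by W^-1 the operator W becomes unitary. *)
Lemma transported_resolution : exists ip' : {dot H for Num.conj},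
  equivalent_scalar_products ip ip' /\
  resolution_of_identity ip' (fun o : idx => W \o Co o \o Wi).
Proof.
have [bWi WK KW] := iW; have injWi : injective Wi by exact: (can_inj KW).
have cob := @co_bo _ _ _ _ _ _ _ _ hA k.
exists (pullback_dot ip_norm bWi injWi); split.
  have [c1 c10 h1] := bo_bound bWi; have [c2 c20 h2] := bo_bound bW.
  have p : 0 < 1 + c1 ^+ 2 + c2 ^+ 2 by rewrite !ltr_wpDr ?sqr_ge0.
  exists (1 + c1 ^+ 2 + c2 ^+ 2)^-1; first by rewrite invr_gt0.
  move=> x; rewrite -[pullback_dot _ _ _ x x]/(ip (Wi x) (Wi x)) !(ip_nm ip_norm).
  have n0 := nm_ge0 x; have m0 := nm_ge0 (Wi x).
  have le1 : nm (Wi x) ^+ 2 <= c1 ^+ 2 * nm x ^+ 2.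
    by rewrite -exprMn ler_sqr ?nnegrE ?mulr_ge0.
  have le2 : nm x ^+ 2 <= c2 ^+ 2 * nm (Wi x) ^+ 2.
    by rewrite -exprMn ler_sqr ?nnegrE ?mulr_ge0// -[X in nm X](KW x).
  rewrite -!rmorphM /= !lecR invrK; split.
    by rewrite mulrC ler_pdivrMr//; have := sqr_ge0 (nm (Wi x)); have := sqr_ge0 c1; nra.
  by have := sqr_ge0 (nm x); have := sqr_ge0 c2; nra.
split; first split.
- by move=> o; exact: (bo_comp (bo_comp bW (cob o)) bWi).
- by move=> o; apply/funext => x /=; rewrite WK (co_idem hA).
- by move=> o o' ne; apply/funext => x /=; rewrite WK (co_orth hA)// (bo0 bW).
- move=> x; have := bo_hassum bW (co_hassum (Wi x)); rewrite KW => -[]; exact.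
move=> o; split; first by apply/funext => x /=; rewrite WK (co_idem hA).
move=> x y; rewrite -[LHS]/(ip (Wi (W (Co o (Wi x)))) (Wi y)).
by rewrite -[RHS]/(ip (Wi x) (Wi (W (Co o (Wi y))))) !WK (co_sa hA).
Qed.

End TransportedResolution.

Section TransportedSpectrum.
Context {R : realType} {H : completeNormedModType R[i]}.
Variables (ip : {dot H for Num.conj}) (ip_norm : scalar_product_norm ip).
Variables (DA : set H) (A : H -> H) (lam : int -> R[i]) (mult : int -> nat).
Variables (P : int -> H -> H) (hA : unperturbed ip DA A lam mult P).
Variables (e : int * nat -> H) (fr : adapted_frame ip P mult e).
Variables (k : nat) (V : H -> H) (bV : bounded_op V) (dV : block_diagonal P k V).
Local Notation idx := (option {n : int | (k < `|n|)%N}).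
Local Notation Co := (coarse P k).
Hypothesis disj : forall (o o' : idx) z, o <> o' -> eig A P V o z -> eig A P V o' z -> False.
Variables (T1 W Wi : H -> H) (lin1 : linear_on DA T1).
Hypotheses (bW : bounded_op W) (iW : is_inverse W Wi).
Hypotheses (DW : forall x, DA (W x) <-> DA x).
Hypothesis TW : forall x, DA x -> T1 (W x) = W ((A - V) x).

Let resP := unp_resolution hA.

Lemma eig_spectrum (o : idx) z : eig A P V o z -> spectrum DA T1 z.
Proof.
have [bWi WK KW] := iW; move=> [y y0 [Cy Ty]] [S [bS _ ST]].
have Dy : DA y by rewrite -Cy; exact: (co_dom hA).
have := ST (W y) ((DW y).2 Dy).
rewrite TW// Ty (boZ bW) subrr (bo0 bS) -(bo0 bW) => /(can_inj WK) E.
by apply: y0.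
Qed.

Let reduced z (E Nl S : H -> H) d := @reduced_transport _ _ DA (A - V) T1 W Wi z E Nl S d iW bW DW TW.

(** If z is an eigenvalue of no block then its root projection vanishes and the
    reduced resolvent is a resolvent. *)
Lemma spectrum_eig z : spectrum DA T1 z <-> exists o : idx, eig A P V o z.
Proof.
split=> [|[ o1]]; last exact: eig_spectrum.
move=> hz; apply: contrapT => ne; apply: hz.
have [s [E [_ sE _ E0 hE]]] := block_spectral ip_norm hA fr bV dV (None : idx).
have [|Nl [S [d hd]]] := hE z; first by move=> o1 _ ho; apply: ne; exists o1.
apply: (reduced_is_resolvent (reduced hd)) => x /=; rewrite E0 ?(bo0 bW)//.
by apply/negP => /sE h; apply: ne; exists None.
Qed.

Lemma transported_spectral_projection (o : idx) :
  spectral_projection DA T1 (W \o Co o \o Wi).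
Proof.
have [s [E [[us _] sE sumE E0 hE]]] := block_spectral ip_norm hA fr bV dV o.
exists s, (fun z => W \o E z \o Wi); split => //.
  move=> z zs; have ez : eig A P V o z by exact/sE.
  split; first exact: (eig_spectrum ez).
  have [|Nl [S [d hd]]] := hE z; last exact: (reduced_riesz lin1 (reduced hd)).
  by move=> o' ne h; apply: (disj ne h ez).
by apply/funext => x; rewrite /= fct_sumE sumE (bo_sumE bW).
Qed.

Lemma semisimple_vector (T : H -> H) z d : linear_on DA T ->
  semisimple_eigenvalue DA T z d -> exists x, x <> 0 /\ DA x /\ T x = z *: x.
Proof.
move=> lin [d0 [v hv] _].
have T0 : T 0 = z *: 0.
  by have [D0 _ h] := lin; have := h (-1) 0 0 D0 D0; rewrite !scaler0 add0r scaleN1r addNr.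
have [c0 [_ uniq0]] := (hv 0).1 (conj (on0 lin) T0).
have free0 c : 0 = \sum_(t < d) c t *: v t -> c = fun=> 0.
  move=> h; rewrite -(uniq0 _ h); apply: uniq0.
  by rewrite big1// => t _; rewrite scale0r.
pose t0 := Ordinal d0; pose dl (t : 'I_d) : R[i] := (t == t0)%:R.
have vE : v t0 = \sum_(t < d) dl t *: v t.
  rewrite (bigD1 t0)//= /dl eqxx scale1r big1 ?addr0// => t /negbTE ->.
  by rewrite scale0r.
exists (v t0); split.
  move=> h; have := free0 dl; rewrite -vE h => /(_ erefl) /(congr1 (@^~ t0)).
  by rewrite /dl eqxx => /eqP; rewrite oner_eq0.
apply/hv; exists dl; split => // c hc; apply/funext => t.
have /free0/(congr1 (@^~ t)) : 0 = \sum_(t < d) (dl t - c t) *: v t.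
  by under eq_bigr do rewrite scalerBl; rewrite sumrB -vE -hc subrr.
by move=> /eqP; rewrite subr_eq0 => /eqP.
Qed.

(** A block has at least one eigenvalue because the root projections sum to a
    nonzero projection. *)
Lemma block_eigenvalues (o : idx) : exists s : seq R[i],
  [/\ uniq s, (0 < size s <= co_size mult o)%N & forall z, z \in s <-> eig A P V o z].
Proof.
have [s [E [[us sz] sE sumE _ _]]] := block_spectral ip_norm hA fr bV dV o.
exists s; split => //; rewrite sz andbT lt0n size_eq0; apply/eqP => s0.
have Co0 x : Co o x = 0 by rewrite sumE s0 big_nil.
have [n hn] : exists n : int, forall x, Co o (P n x) = P n x.
  case: o Co0 {sumE sE sz} => [n|] _ /=.
    by exists (val n) => x; exact: (P_idem resP).
  by exists 0 => x; rewrite (Pb_P resP).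
have [x [x0 [Dx Ax]]] := semisimple_vector (unp_linear hA) (unp_semisimple hA n).
by apply: x0; rewrite -(eigenvector_P hA Dx Ax) -hn Co0.
Qed.

End TransportedSpectrum.

(** * The weights alpha *)

Section WeightedTails.
Context {R : realType}.
Variables (a : int -> R) (a0 : forall n, 0 <= a n).
Hypothesis fin : (\esum_(n in [set: int]) (a n)%:E < +oo)%E.

Definition tail_sum (l : nat) : R :=
  fine (\esum_(n in [set n : int | (l <= `|n|)%N]) (a n)%:E).

Lemma esum_restrict (D : set int) :
  (\esum_(n in D) (a n)%:E = \esum_(n in [set: int]) (if n \in D then a n else 0)%:E)%E.
Proof. by rewrite esum_mkcond; apply: eq_esum => n _; case: ifP. Qed.

Lemma sub_sumE (D : set int) :
  (\esum_(n in D) (a n)%:E = (fine (\esum_(n in D) (a n)%:E))%:E)%E.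
Proof.
have ge0 : (0 <= \esum_(n in D) (a n)%:E)%E by apply: esum_ge0 => n _; rewrite lee_fin.
rewrite fineK// ge0_fin_numE//; apply: le_lt_trans fin.
rewrite esum_restrict; apply: le_esum => n _; rewrite lee_fin.
by case: ifP.
Qed.

Lemma sub_sum_le (D : set int) (F : {fset int}) :
  \sum_(n <- F | n \in D) a n <= fine (\esum_(n in D) (a n)%:E).
Proof.
have : (\esum_(n in D) (a n)%:E <= (fine (\esum_(n in D) (a n)%:E))%:E)%E by rewrite -sub_sumE.
rewrite [X in (X <= _)%E]esum_restrict => /esum_le_fset h.
rewrite big_mkcond; apply: h => n; by case: ifP.
Qed.

Lemma tail_sum_ge0 l : 0 <= tail_sum l.
Proof. by apply: fine_ge0; apply: esum_ge0 => n _; rewrite lee_fin. Qed.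

Lemma le_tail_sum n : a n <= tail_sum `|n|.
Proof.
have := sub_sum_le [set m : int | (`|n| <= `|m|)%N] [fset n]%fset.
by rewrite big_mkcond big_seq_fset1 mem_set//=.
Qed.

Lemma tail_sumS l :
  tail_sum l = fine (\esum_(n in [set n : int | `|n|%N = l]) (a n)%:E) + tail_sum l.+1.
Proof.
apply/eqP; rewrite -eqe EFinD /tail_sum -!sub_sumE.
rewrite (esumID [set n : int | `|n|%N = l])//; last by move=> n _; rewrite lee_fin.
apply/eqP; congr (_ + _)%E; congr (esum _ _); apply/seteqP; split => n /=.
- by case.
- by move=> ->.
- by case=> h h'; rewrite ltn_neqAle h andbT; apply/eqP => E; apply: h'.
- by move=> h; split; [exact: ltnW|move=> E; move: h; rewrite E ltnn].
Qed.

(** Telescoping, since (T - T') / sqrt T <= 2 (sqrt T - sqrt T') for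
    T >= T' >= 0. *)
Lemma sum_div_sqrt_tail (F : {fset int}) :
  \sum_(n <- F) a n / Num.sqrt (tail_sum `|n|) <= 2 * Num.sqrt (tail_sum 0).
Proof.
have step l : (\sum_(n <- F | `|n|%N == l) a n / Num.sqrt (tail_sum `|n|)) <=
    2 * (Num.sqrt (tail_sum l) - Num.sqrt (tail_sum l.+1)).
  have -> : \sum_(n <- F | `|n|%N == l) a n / Num.sqrt (tail_sum `|n|) =
      (\sum_(n <- F | `|n|%N == l) a n) / Num.sqrt (tail_sum l).
    by rewrite mulr_suml; apply: eq_bigr => n /eqP ->.
  have h : \sum_(n <- F | `|n|%N == l) a n <= tail_sum l - tail_sum l.+1.
    rewrite (tail_sumS l) addrK; have := sub_sum_le [set n : int | `|n|%N = l] F.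
    apply: le_trans; rewrite le_eqVlt; apply/orP; left; apply/eqP.
    by apply: eq_bigl => n; apply/eqP/idP => [h|/set_mem]; first exact: mem_set.
  have t0 := tail_sum_ge0 l; have t1 := tail_sum_ge0 l.+1.
  have s0 := sqrtr_ge0 (tail_sum l); have s1 := sqrtr_ge0 (tail_sum l.+1).
  have e0 := sqr_sqrtr t0; have e1 := sqr_sqrtr t1.
  have le : Num.sqrt (tail_sum l.+1) <= Num.sqrt (tail_sum l).
    by rewrite ler_sqrt// (tail_sumS l) lerDr fine_ge0// esum_ge0// => n _; rewrite lee_fin.
  have [s|s] := eqVneq (Num.sqrt (tail_sum l)) 0.
    by rewrite s invr0 mulr0 mulr_ge0// subr_ge0 -s.
  have p : 0 < Num.sqrt (tail_sum l) by rewrite lt_def s.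
  by rewrite ler_pdivrMr//; nra.
have partial l : \sum_(n <- F | (`|n| < l)%N) a n / Num.sqrt (tail_sum `|n|) <=
    2 * (Num.sqrt (tail_sum 0) - Num.sqrt (tail_sum l)).
  elim: l => [|l IH]; first by rewrite big_pred0// subrr mulr0.
  have h := lerD (step l) IH.
  rewrite (bigID (fun n : int => `|n|%N == l)) /=.
  rewrite [X in X + _ <= _](eq_bigl (fun n : int => `|n|%N == l)); last first.
    by move=> n /=; rewrite ltnS andbC; case: eqP => //= ->; rewrite leqnn.
  rewrite [X in _ + X <= _](eq_bigl (fun n : int => (`|n| < l)%N)); last first.
    by move=> n /=; rewrite ltnS ltn_neqAle andbC.
  by apply: le_trans h _; rewrite -mulrDr ler_wpM2l//; lra.
have [L hL] := fset_irange F.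
have -> : \sum_(n <- F) a n / Num.sqrt (tail_sum `|n|) =
    \sum_(n <- F | (`|n| < L.+1)%N) a n / Num.sqrt (tail_sum `|n|).
  rewrite big_seq_cond [RHS]big_seq_cond; apply: eq_bigl => n.
  by rewrite andbT; case: (boolP (n \in _)) => //= /hL.
by apply: le_trans (partial _) _; rewrite ler_wpM2l// lerBlDr lerDl sqrtr_ge0.
Qed.

End WeightedTails.

Section OperatorWeights.
Context {R : realType} {H : completeNormedModType R[i]}.
Variables (ip : {dot H for Num.conj}) (ip_norm : scalar_product_norm ip).
Variables (P : int -> H -> H) (resP : resolution_of_identity ip P).
Variables (d : int -> nat) (e : int * nat -> H) (fr : adapted_frame ip P d e).
Variables (Q : H -> H) (hQ : HS e Q).

Let q i j : R := opnorm (entry P Q i j) ^+ 2.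

Lemma opnorm0 : opnorm (0 : H -> H) = 0 :> R.
Proof.
apply/le_anti; rewrite (opnorm_ge0 (@bo_zero _ _)) andbT.
by apply: opnorm_le => // x; rewrite nm0 mul0r.
Qed.

Lemma Q_entry_HS i j : HS e (entry P Q i j).
Proof.
have hP : HS e (Q \o P j) by apply: (HS_P ip_norm resP fr); exact: (bo_comp (HS_bo hQ) (P_bo resP j)).
rewrite /entry; have P1 x : nm (P i x) <= 1 * nm x by rewrite mul1r (P_le ip_norm resP).
by have [] := HS_comp (P_bo resP i) ler01 P1 hP.
Qed.

Lemma q_ge0 i j : 0 <= q i j. Proof. exact: sqr_ge0. Qed.

Lemma q_summable : (\esum_(ij in [set: int * int]) (q ij.1 ij.2)%:E < +oo)%E.
Proof.
apply: (@le_lt_trans _ _ (hs2 e Q)); last by case: hQ.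
rewrite -(hs2_entries ip_norm resP fr (HS_bo hQ)); apply: le_esum => -[i j] _ /=.
have hE := Q_entry_HS i j; rewrite (hs2_hsn hE) lee_fin ler_sqr ?nnegrE ?hsn_ge0//.
  by apply: opnorm_le => [|x]; [exact: hsn_ge0|exact: (op_hs ip_norm resP fr)].
exact: (opnorm_ge0 (HS_bo hE)).
Qed.

Lemma normP2_rowE n : (normP2 P (P n \o Q) = \esum_(j in [set: int]) (q n j)%:E)%E.
Proof.
rewrite /normP2 -(@esum_pair _ _ _ (fun i j => ((opnorm (entry P (P n \o Q) i j)) ^+ 2)%:E)).
  rewrite esum_swap => [|i j]; last by rewrite lee_fin sqr_ge0.
  apply: eq_esum => j _.
  rewrite (@esum_single _ _ (fun i => opnorm (entry P (P n \o Q) i j) ^+ 2) n).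
  - by congr ((opnorm _ ^+ 2)%:E); apply/funext => x; rewrite !entryE /= (P_idem resP).
  - move=> i ni; rewrite (_ : entry _ _ _ _ = 0) ?opnorm0 ?expr0n//.
    by apply/funext => x; rewrite entryE /= (PP resP) (negbTE ni).
  - exact: sqr_ge0.
by move=> i j; rewrite lee_fin sqr_ge0.
Qed.

Lemma normP2_colE n : (normP2 P (Q \o P n) = \esum_(i in [set: int]) (q i n)%:E)%E.
Proof.
rewrite /normP2 -(@esum_pair _ _ _ (fun i j => ((opnorm (entry P (Q \o P n) i j)) ^+ 2)%:E)).
  apply: eq_esum => i _.
  rewrite (@esum_single _ _ (fun j => opnorm (entry P (Q \o P n) i j) ^+ 2) n).
  - by congr ((opnorm _ ^+ 2)%:E); apply/funext => x; rewrite !entryE /= (P_idem resP).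
  - move=> j nj; rewrite (_ : entry _ _ _ _ = 0) ?opnorm0 ?expr0n//.
    apply/funext => x; rewrite entryE /= (PP resP) eq_sym (negbTE nj).
    by rewrite (bo0 (HS_bo hQ)) (bo0 (P_bo resP i)).
  - exact: sqr_ge0.
by move=> i j; rewrite lee_fin sqr_ge0.
Qed.

Let row n : R := fine (normP2 P (P n \o Q)).
Let col n : R := fine (normP2 P (Q \o P n)).

Lemma normP2_fin : (normP2 P Q < +oo)%E. Proof. exact: q_summable. Qed.

Lemma sum_rows : (\esum_(n in [set: int]) normP2 P (P n \o Q) = normP2 P Q)%E.
Proof.
rewrite /normP2 -(@esum_pair _ _ _ (fun i j => (q i j)%:E)) => [|i j]; last by rewrite lee_fin q_ge0.
by apply: eq_esum => n _; exact: normP2_rowE.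
Qed.

Lemma sum_cols : (\esum_(n in [set: int]) normP2 P (Q \o P n) = normP2 P Q)%E.
Proof.
rewrite /normP2 -(@esum_pair _ _ _ (fun i j => (q i j)%:E)) => [|i j]; last by rewrite lee_fin q_ge0.
rewrite esum_swap => [|i j]; last by rewrite lee_fin q_ge0.
by apply: eq_esum => n _; exact: normP2_colE.
Qed.

Lemma normP2_ge0 X : (0 <= normP2 P X)%E.
Proof. by apply: esum_ge0 => ij _; rewrite lee_fin sqr_ge0. Qed.

Lemma term_fin (f : int -> \bar R) n : (forall m, 0 <= f m)%E ->
  (\esum_(m in [set: int]) f m < +oo)%E -> (f n = (fine (f n))%:E)%E.
Proof.
move=> f0 ff; rewrite fineK// ge0_fin_numE//; apply: le_lt_trans ff.
have := @esum_set1 R int n f (f0 n) => <-.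
by rewrite esum_mkcond; apply: le_esum => m _; case: ifP.
Qed.

Lemma rowE n : (normP2 P (P n \o Q) = (row n)%:E)%E.
Proof. by apply: (@term_fin (fun n => normP2 P (P n \o Q))) => [m|]; rewrite ?normP2_ge0 ?sum_rows ?normP2_fin. Qed.

Lemma colE n : (normP2 P (Q \o P n) = (col n)%:E)%E.
Proof. by apply: (@term_fin (fun n => normP2 P (Q \o P n))) => [m|]; rewrite ?normP2_ge0 ?sum_cols ?normP2_fin. Qed.

Lemma row_ge0 n : 0 <= row n. Proof. exact: (fine_ge0 (normP2_ge0 _)). Qed.
Lemma col_ge0 n : 0 <= col n. Proof. exact: (fine_ge0 (normP2_ge0 _)). Qed.

Lemma q_row i j : q i j <= row i.
Proof.
have := rowE i; rewrite normP2_rowE => h.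
have : (\esum_(j in [set: int]) (q i j)%:E <= (row i)%:E)%E by rewrite h.
move=> /(esum_le_fset _ (q_ge0 i))/(_ [fset j]%fset).
by rewrite big_seq_fset1.
Qed.

Lemma q_col i j : q i j <= col j.
Proof.
have := colE j; rewrite normP2_colE => h.
have : (\esum_(i in [set: int]) (q i j)%:E <= (col j)%:E)%E by rewrite h.
move=> /(esum_le_fset _ (q_ge0^~ j))/(_ [fset i]%fset).
by rewrite big_seq_fset1.
Qed.

(** Cauchy-Schwarz over the blocks of the row. *)
Lemma row_bound n x : nm (P n (Q x)) <= Num.sqrt (row n) * nm x.
Proof.
have := bo_hassum (bo_comp (P_bo resP n) (HS_bo hQ)) (P_hassum resP x) => hs.
apply: (hassum_le hs) => F; apply: le_trans (nm_sum _ _ _) _.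
have o0 j : 0 <= opnorm (entry P Q n j) by exact: (opnorm_ge0 (HS_bo (Q_entry_HS n j))).
apply: (@le_trans _ _ (\sum_(j <- F) opnorm (entry P Q n j) * nm (P j x))).
  apply: ler_sum => j _; have := opnormP (P j x) (HS_bo (Q_entry_HS n j)).
  by rewrite entryE (P_idem resP).
have h1 : \sum_(j <- F) opnorm (entry P Q n j) ^+ 2 <= Num.sqrt (row n) ^+ 2.
  have := rowE n; rewrite normP2_rowE (sqr_sqrtr (row_ge0 n)) => h.
  have : (\esum_(j in [set: int]) (q n j)%:E <= (row n)%:E)%E by rewrite h.
  by move=> /(esum_le_fset _ (q_ge0 n)); apply.
have h2 : \sum_(j <- F) nm (P j x) ^+ 2 <= nm x ^+ 2.
  have := P_sq ip_norm resP x => h.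
  have : (\esum_(n in [set: int]) (nm (P n x) ^+ 2)%:E <= (nm x ^+ 2)%:E)%E by rewrite h.
  by move=> /esum_le_fset; apply => j; exact: sqr_ge0.
by apply: (cauchy_schwarz_fin o0 _ (sqrtr_ge0 _) (nm_ge0 x) h1 h2) => j; exact: nm_ge0.
Qed.

Lemma rows_summable : (\esum_(n in [set: int]) (row n)%:E < +oo)%E.
Proof.
apply: le_lt_trans normP2_fin; rewrite -sum_rows.
by apply: le_esum => n _; rewrite rowE.
Qed.

Lemma cols_summable : (\esum_(n in [set: int]) (col n)%:E < +oo)%E.
Proof.
apply: le_lt_trans normP2_fin; rewrite -sum_cols.
by apply: le_esum => n _; rewrite colE.
Qed.

Let N2 := fine (normP2 P Q).

Lemma alphaE n : alpha P Q n = Num.sqrt N2 `^ (- 2^-1) *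
  Num.max (tail_sum row `|n| `^ 4^-1) (tail_sum col `|n| `^ 4^-1).
Proof.
rewrite /alpha /tail_sum; congr (_ * Num.max (fine _ `^ _) (fine _ `^ _)).
  by apply: eq_esum => j _; rewrite rowE.
by apply: eq_esum => j _; rewrite colE.
Qed.

(** If the n-th tails of the rows and of the columns vanish then Q lives in the
    central block of size n. *)
Lemma alpha_neq0 : (forall l, Q <> Pblock P l \o Q \o Pblock P l) ->
  N2 != 0 /\ forall n, alpha P Q n <> 0.
Proof.
move=> ne; have bQ := HS_bo hQ.
have corner l : (forall i j, (l < `|i|)%N || (l < `|j|)%N -> q i j = 0) -> False.
  move=> h; apply: (ne l).
  have bPb := Pb_bo resP l.
  apply: (entry_inj resP bQ (bo_comp (bo_comp bPb bQ) bPb)) => i j.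
  apply/funext => x; rewrite !entryE /= (P_Pb resP) (Pb_P resP).
  have z : (l < `|i|)%N || (l < `|j|)%N -> P i (Q (P j x)) = 0.
    move=> /h/eqP; rewrite sqrf_eq0 => /eqP o0; apply/eqP; rewrite -nm_eq0 eq_le nm_ge0 andbT.
    by rewrite -entryE (le_trans (opnormP x (HS_bo (Q_entry_HS i j))))// o0 mul0r.
  case: (leqP (absz i) l) => hi; last by rewrite z ?hi.
  case: (leqP (absz j) l) => hj //.
  by rewrite z ?hj ?orbT// (bo0 bQ) (bo0 (P_bo resP i)).
have N20 : N2 != 0.
  apply/eqP => E; apply: (corner 0%N) => i j _.
  have : (\esum_(ij in [set: int * int]) (q ij.1 ij.2)%:E <= 0%:E)%E.
    rewrite -[leLHS]/(normP2 P Q) -E fineK// ge0_fin_numE ?normP2_ge0 ?normP2_fin//.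
  move=> /(esum_le_fset _ (fun ij => q_ge0 ij.1 ij.2))/(_ [fset (i, j)]%fset).
  by rewrite big_seq_fset1 /= => h; apply/le_anti; rewrite h q_ge0.
split => // n; rewrite alphaE => /eqP; rewrite mulf_eq0 powR_eq0 sqrtr_eq0.
have N2p : 0 < N2 by rewrite lt_def N20 fine_ge0// normP2_ge0.
rewrite leNgt N2p /= => /eqP m0; apply: (corner `|n|%N) => i j ij.
have le0 x y : Num.max (x `^ 4^-1) (y `^ 4^-1) = 0 -> x = 0 :> R /\ y = 0 :> R.
  move=> h; have hx : x `^ 4^-1 <= 0 by rewrite -h le_max lexx.
  have hy : y `^ 4^-1 <= 0 by rewrite -h le_max lexx orbT.
  by split; apply: (@powR_eq0_eq0 _ _ 4^-1); apply/le_anti; rewrite ?hx ?hy powR_ge0.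
have [r0 c0] := le0 _ _ m0.
have tail0 (a : int -> R) m : (forall n, 0 <= a n) -> (\esum_(n in [set: int]) (a n)%:E < +oo)%E ->
    tail_sum a `|n| = 0 -> (`|n| < `|m|)%N -> a m = 0.
  move=> a0 fa t0 nm'; apply/le_anti; rewrite a0 andbT -t0.
  have := sub_sum_le a0 fa [set m : int | (`|n| <= `|m|)%N] [fset m]%fset.
  by rewrite big_mkcond big_seq_fset1 mem_set//= ltnW.
apply/le_anti; rewrite q_ge0 andbT; case/orP: ij => h.
  by rewrite -(tail0 _ _ row_ge0 rows_summable r0 h) q_row.
by rewrite -(tail0 _ _ col_ge0 cols_summable c0 h) q_col.
Qed.

Lemma alpha_sq_ge n : (Num.sqrt N2)^-1 * Num.sqrt (tail_sum row `|n|) <= alpha P Q n ^+ 2.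
Proof.
have sqE (x y : R) : (x `^ y) ^+ 2 = x `^ (y * 2).
  by rewrite -powR_mulrn ?powR_ge0// -powRrM.
have t0 := tail_sum_ge0 row_ge0 `|n|.
rewrite alphaE exprMn sqE mulNr mulVf// powRN powRr1 ?sqrtr_ge0//.
rewrite ler_wpM2l ?invr_ge0 ?sqrtr_ge0// -powR12_sqrt//.
have -> : (2^-1 : R) = 4^-1 * 2 by field.
rewrite -[leLHS]sqE; have := powR_ge0 (tail_sum row `|n|) 4^-1.
move: (tail_sum row _ `^ _) (tail_sum col _ `^ _) => u v u0.
have uM : u <= Num.max u v by rewrite le_max lexx.
by apply: lerXn2r => //; rewrite nnegrE// (le_trans u0).
Qed.

(** The finitely many indices up to k are harmless; beyond them the shifts are
    dominated by the rows. *)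
Lemma weighted_summable (t : int -> R) (C : R) (k : nat) : N2 != 0 ->
  (forall n, alpha P Q n <> 0) -> 0 <= C -> (forall n, 0 <= t n) ->
  (forall n, (k < `|n|)%N -> t n <= C * row n) ->
  (\esum_(n in [set: int]) (t n * (alpha P Q n) ^- 2)%:E < +oo)%E.
Proof.
move=> N20 al0 C0 t0 ht.
have N2p : 0 < N2 by rewrite lt_def N20 fine_ge0// normP2_ge0.
have s0 : 0 < Num.sqrt N2 by rewrite sqrtr_gt0.
have w0 n : 0 <= t n * (alpha P Q n) ^- 2 by rewrite mulr_ge0// invr_ge0 sqr_ge0.
(* c0 bounds the central part, c1 the telescoping part *)
pose c0 := \sum_(n <- irange k) t n * (alpha P Q n) ^- 2.
pose c1 := C * Num.sqrt N2 * (2 * Num.sqrt (tail_sum row 0)).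
apply: (@le_lt_trans _ _ (c0 + c1)%:E); last exact: ltry.
apply/esum_le_fset => // F.
rewrite (bigID (fun n : int => (`|n| <= k)%N)) /=; apply: lerD.
  have -> : c0 = \sum_(n <- (seq_fset tt (irange k))) t n * (alpha P Q n) ^- 2.
    apply: perm_big; apply: uniq_perm; [exact: irange_uniq|exact: fset_uniq|].
    by move=> n; rewrite seq_fsetE.
  rewrite -big_filter; apply: (@le_trans _ _ (\sum_(n <- [fset n in F | (`|n| <= k)%N]%fset) t n * (alpha P Q n) ^- 2)).
    rewrite le_eqVlt; apply/orP; left; apply/eqP; apply: perm_big; apply: uniq_perm.
    - by rewrite filter_uniq// fset_uniq.
    - exact: fset_uniq.
    - by move=> n; rewrite mem_filter !inE /= andbC.
  rewrite (@big_fset_sub _ _ _ [fset n in F | (`|n| <= k)%N]%fset (seq_fset tt (irange k))).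
    by rewrite lerDl sumr_ge0.
  apply/fsubsetP => n; rewrite seq_fsetE mem_irange.
  by rewrite !inE /= => /andP[_ h].
have g0 n : 0 <= row n / Num.sqrt (tail_sum row `|n|).
  by rewrite divr_ge0 ?row_ge0 ?sqrtr_ge0.
have cs0 : 0 <= C * Num.sqrt N2 := mulr_ge0 C0 (ltW s0).
apply: (@le_trans _ _ (C * Num.sqrt N2 * \sum_(n <- F) row n / Num.sqrt (tail_sum row `|n|))); last first.
  exact: (ler_wpM2l cs0 (sum_div_sqrt_tail row_ge0 rows_summable F)).
rewrite mulr_sumr [leRHS](bigID (fun n : int => (`|n| <= k)%N)) /= ler_wpDl//.
  by apply: sumr_ge0 => n _; exact: (mulr_ge0 cs0 (g0 n)).
apply: ler_sum => n; rewrite -ltnNge => kn.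
have := alpha_sq_ge n; have := al0 n; move=> /eqP; rewrite -sqrf_eq0 => a2 hal.
have a2p : 0 < alpha P Q n ^+ 2 by rewrite lt_def a2 sqr_ge0.
rewrite ler_pdivrMr//; apply: le_trans (ht n kn) _.
have [r0|r0] := eqVneq (row n) 0; first by rewrite r0 !mul0r !mulr0 mul0r.
have rp : 0 < row n by rewrite lt_def r0 row_ge0.
have Tp : 0 < Num.sqrt (tail_sum row `|n|).
  by rewrite sqrtr_gt0 (lt_le_trans rp)// (le_tail_sum row_ge0 rows_summable).
have -> : C * Num.sqrt N2 * (row n / Num.sqrt (tail_sum row `|n|)) * alpha P Q n ^+ 2 =
    C * row n * (alpha P Q n ^+ 2 / ((Num.sqrt N2)^-1 * Num.sqrt (tail_sum row `|n|))).
  by field; rewrite !gt_eqF.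
rewrite ler_peMr ?mulr_ge0 ?row_ge0// ler_pdivlMr ?mul1r// mulr_gt0// invr_gt0//.
Qed.

End OperatorWeights.

(** * Enumeration of the eigenvalues *)

Section Enumeration.
Context {R : realType}.
Variables (lam : int -> R[i]) (mult : int -> nat) (k : nat).
Local Notation idx := (option {n : int | (k < `|n|)%N}).

(** A block with d coordinates has at most d eigenvalues: they are listed along the
    pairs (n, i) of the block, the first one being repeated if they are fewer. *)
Lemma enumerate_blocks (ev : idx -> seq R[i]) :
  (forall o, 0 < size (ev o) <= co_size mult o)%N ->
  exists b : int -> nat -> R[i],
    [set z | exists o, z \in ev o] =
      [set lam ni.1 - b ni.1 ni.2 | ni in [set ni : int * nat | (ni.2 < mult ni.1)%N]] /\
    forall (n : {n : int | (k < `|n|)%N}) t, lam (val n) - b (val n) t \in ev (Some n).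
Proof.
move=> hs; pose pick o t := nth 0 (ev o) (if (t < size (ev o))%N then t else 0%N).
have pickP o t : pick o t \in ev o.
  have /andP[h _] := hs o; rewrite /pick mem_nth//; by case: ifP.
have pickE o z : z \in ev o -> pick o (index z (ev o)) = z.
  by move=> h; rewrite /pick index_mem h nth_index.
pose r := [seq (n, t) | n <- irange k, t <- iota 0 (mult n)].
have ur : uniq r.
  apply: allpairs_uniq_dep => [|n _|[n t] [n' t'] _ _ /= [-> ->]] //.
    exact: irange_uniq.
  exact: iota_uniq.
have sr : size r = co_size mult (None : idx).
  rewrite size_allpairs_dep sumnE big_map; apply: eq_bigr => n _.
  by rewrite size_iota.
(* the pairs of the central block are numbered by their position in r *)
pose val_at n t : R[i] := if insub n is Some m then pick (Some m) t else pick None (index (n, t) r).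
exists (fun n t => lam n - val_at n t); split; last first.
  by move=> n t; rewrite subKr /val_at valK.
apply/seteqP; split => z /=; last first.
  move=> [[n t] /= _ <-]; rewrite subKr /val_at.
  by case: (insub n) => [m|]; [exists (Some m)|exists None].
move=> [[m|] hz].
  have lt : (index z (ev (Some m)) < mult (val m))%N.
    by have /andP[_] := hs (Some m); apply: leq_trans; rewrite index_mem.
  exists (val m, index z (ev (Some m))) => //=.
  by rewrite subKr /val_at valK pickE.
have lt : (index z (ev None) < size r)%N.
  by rewrite sr; have /andP[_] := hs None; apply: leq_trans; rewrite index_mem.
case E : (nth (0, 0%N) r (index z (ev None))) => [n t].
have := mem_nth (0, 0%N) lt; rewrite E => /allpairsPdep[n' [t' [hn ht [nE tE]]]].
exists (n, t) => /=; first by rewrite nE tE; move: ht; rewrite mem_iota add0n.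
rewrite subKr /val_at insubF; last by rewrite nE ltnNge -mem_irange hn.
by rewrite -E index_uniq// pickE.
Qed.

End Enumeration.

(** * The two similarities *)

Section TwoSteps.
Context {R : realType} {H : completeNormedModType R[i]}.
Variables (ip : {dot H for Num.conj}) (ip_norm : scalar_product_norm ip).
Variables (DA : set H) (A B : H -> H) (lam : int -> R[i]) (mult : int -> nat).
Variables (P : int -> H -> H) (hA : unperturbed ip DA A lam mult P).
Variables (hB : perturbation ip DA A B lam P).
Variables (e : int * nat -> H) (fr : adapted_frame ip P mult e).

Let lin := unp_linear hA.
Let linB := per_linear hB.
Let resP := unp_resolution hA.

Lemma perturbed_linear : linear_on DA (A - B).
Proof.
split=> [|a x y|a x y Dx Dy]; [exact: (on0 lin)|exact: (on_dom lin)|].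
by rewrite !sub_opE (onE lin)// (onE linB)// scalerBr opprD addrACA.
Qed.

Lemma first_algebra (G BG J B0 : H -> H) x : bounded_op G ->
  (forall x, B0 x = BG x - G (J x) - G (B0 x)) -> DA x -> DA (G x) ->
  A (G x) = G (A x) + (B - J) x -> BG x = B (G x) ->
  (A - B) (x + G x) = (A - (J + B0)) x + G ((A - (J + B0)) x).
Proof.
move=> bG B0E Dx DG AG BGE.
rewrite ![(A - _) _]sub_opE (onD lin)// (onD linB)// AG -BGE.
rewrite ![(_ + B0) _]add_opE ![(B - J) _]sub_opE !(boB bG) (boD bG).
have := B0E x; move: (B0 x) => b b0.
have -> : G b = BG x - G (J x) - b by rewrite [in RHS]b0 opprB addrC subrK.
rewrite !opprD !opprK !addrA.
move: (A x) (G (A x)) (B x) (J x) (BG x) (G (J x)) => a1 a2 a3 a4 a5 a6.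
rewrite [LHS](ACl (1*2*4*6*(3*5))%AC) /= subrr addr0.
by rewrite [RHS](ACl (1*4*2*6*(7*5)*(8*3))%AC) /= !subrr !addr0.
Qed.

Lemma second_algebra (G V Q X : H -> H) x : bounded_op G -> bounded_op Q ->
  X x = Q (G x) - G (V x) + Q x -> DA x -> DA (G x) ->
  A (G x) = G (A x) + (X - V) x ->
  (A - Q) (x + G x) = (A - V) x + G ((A - V) x).
Proof.
move=> bG bQ XE Dx DG AG.
rewrite ![(A - _) _]sub_opE (onD lin)// AG (boD bQ) ![(X - V) _]sub_opE (boB bG) XE.
move: (A x) (G (A x)) (Q (G x)) (G (V x)) (Q x) (V x) => a1 a2 a3 a4 a5 a6.
rewrite !opprD !addrA.
by rewrite [LHS](ACl (1*6*2*4*(3*8)*(5*7))%AC) /= !subrr !addr0.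
Qed.

Section First.
Variable m : nat.
Local Notation G := (Gammat P lam m B).
Local Notation J := (Jt P m B).
Local Notation BG := (bounded_extension DA (B \o G)).
Local Notation B0 := (inv_op (idfun + G) \o (BG - (G \o J))).

Lemma first_domain : (forall x, nm (G x) <= 4^-1 * nm x) ->
  cont_invertible (idfun + G) /\ forall x, DA (x + G x) <-> DA x.
Proof.
move=> G4; have q0 : 0 < (4^-1 : R) by rewrite invr_gt0.
have [z [S [C [rS C0 hC]]]] := BJ_relative_bound ip_norm hA hB fr m q0.
have [hG _] := GB_spec ip_norm hA hB fr m.
apply: (domain_bijection hA (HS_bo hG) G4 (BJ_linear ip_norm hA hB fr m) _ rS C0 hC).
exact: (GB_intertwine ip_norm hA hB fr m).
Qed.

Lemma BG_spec : HS e BG /\ forall x, DA x -> BG x = B (G x).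
Proof.
have [Z [hZ ZE]] := BG_exists ip_norm hA hB fr m.
by rewrite (bounded_extensionE hA (HS_bo hZ) ZE).
Qed.

Hypothesis inv1 : cont_invertible (idfun + G).

(** The equation is (1 + G) B0 = BG - G J, solved for B0. *)
Lemma B0_spec : HS e B0 /\ forall x, B0 x = BG x - G (J x) - G (B0 x).
Proof.
have [hBG _] := BG_spec; have [hG _] := GB_spec ip_norm hA hB fr m.
have hJ := JB_HS ip_norm hA hB fr m.
have [bY YK KY] := inv_opP inv1.
have [hGJ _] := HSM ip_norm resP fr hG hJ.
have [hD _] := HSB hBG hGJ.
split.
  have [c c0 hc] := bo_bound bY.
  by have [] := HS_comp bY c0 hc hD.
move=> x; have := KY ((BG - (G \o J)) x).
move=> h; apply/eqP; rewrite eq_sym subr_eq; apply/eqP.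
exact: (esym h).
Qed.

(** With A G = G A + B - J, all terms cancel exactly when (1 + G) B0 = BG - G J. *)
Lemma first_similarity x : DA x ->
  (A - B) (x + G x) = (A - (J + B0)) x + G ((A - (J + B0)) x).
Proof.
move=> Dx; have [DG AG] := GB_intertwine ip_norm hA hB fr m Dx.
have [_ BGE] := BG_spec; have [_ B0E] := B0_spec.
have [hG _] := GB_spec ip_norm hA hB fr m.
exact: (first_algebra (HS_bo hG) B0E Dx DG AG (BGE x Dx)).
Qed.

End First.

Section Second.
Variables (k : nat) (del : R) (del0 : 0 < del).
Hypothesis gapP : forall i j, i != j -> del <= nm (lam i - lam j).
Variables (Q Xs : H -> H) (hQ : HS e Q) (hX : HS e Xs).
Local Notation GX := (Gammat P lam k Xs).
Local Notation V := (Jt P k Xs).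
Hypothesis fixX : Phi P lam Q k Xs = Xs.

Lemma second_fixed : V = Jt P k Q + Jt P k (Q \o GX) /\ Xs = (Q \o GX) - (GX \o V) + Q.
Proof.
apply: (fixed_point_V ip_norm hA fr del0 gapP hQ (g := hsn e Q * del^-1)) => // X hX1.
have [hGX nGX _] := Gammat_spec ip_norm hA fr del0 gapP k hX1.
have [hJ nJ] := Jt_HS ip_norm hA fr k hQ.
have q0 := hsn_ge0 e Q.
have [_ n1] := HSM ip_norm resP fr hQ hGX; have [_ n2] := HSM ip_norm resP fr hGX hJ.
split; first by rewrite (le_trans n1)// -mulrA ler_wpM2l.
rewrite (le_trans n2)// mulrC -mulrA; apply: ler_pM => //; exact: hsn_ge0.
Qed.

Lemma GX_intertwine x : DA x -> DA (GX x) /\ A (GX x) = GX (A x) + (Xs - V) x.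
Proof.
have [hGX _ eGX] := Gammat_spec ip_norm hA fr del0 gapP k hX.
have [hV _] := Jt_HS ip_norm hA fr k hX.
move=> Dx.
have cM : A_continuous DA P (Xs - V).
  exact: (bo_A_continuous hA (bo_sub (HS_bo hX) (HS_bo hV))).
exact: (intertwine hA (HS_bo hGX) cM (gam_intertwine ip_norm hA (HS_bo hX) eGX) Dx).
Qed.

Lemma second_domain : (forall x, nm (GX x) <= 4^-1 * nm x) ->
  cont_invertible (idfun + GX) /\ forall x, DA (x + GX x) <-> DA x.
Proof.
move=> G4; have q0 : 0 < (4^-1 : R) by rewrite invr_gt0.
have [z [S [_ [rS _ _]]]] := BJ_relative_bound ip_norm hA hB fr 0 q0.
have [hGX _ _] := Gammat_spec ip_norm hA fr del0 gapP k hX.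
have [hV _] := Jt_HS ip_norm hA fr k hX.
have bM := bo_sub (HS_bo hX) (HS_bo hV).
have [c c0 hc] := bo_bound bM.
have c1 : 0 < c + 1 by rewrite ltr_wpDl.
apply: (domain_bijection hA (HS_bo hGX) G4 _ GX_intertwine rS c1).
  by split=> [|a x y|a x y _ _]; [exact: (on0 lin)|exact: (on_dom lin)|exact: (boP bM)].
move=> x; rewrite (le_trans (hc _))//.
have := nm_ge0 (S x); have := nm_ge0 x; move: (nm _) (nm _) => u v u0 v0.
by rewrite mulrDl mul1r; have := mulr_ge0 (ltW q0) u0; lra.
Qed.

(** With A GX = GX A + Xs - V, all terms cancel exactly when
    Xs = Q GX - GX V + Q. *)
Lemma second_similarity x : DA x ->
  (A - Q) (x + GX x) = (A - V) x + GX ((A - V) x).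
Proof.
move=> Dx; have [DG AG] := GX_intertwine Dx.
have [_ XE] := second_fixed.
have [hGX _ _] := Gammat_spec ip_norm hA fr del0 gapP k hX.
apply: (second_algebra (HS_bo hGX) (HS_bo hQ) _ Dx DG AG).
by rewrite {1}XE.
Qed.

End Second.

Lemma composed_similarity (G GX Q V : H -> H) :
  bounded_op G -> bounded_op GX ->
  cont_invertible (idfun + G) -> cont_invertible (idfun + GX) ->
  (forall x, DA (x + G x) <-> DA x) -> (forall x, DA (x + GX x) <-> DA x) ->
  (forall x, DA x -> (A - B) (x + G x) = (A - Q) x + G ((A - Q) x)) ->
  (forall x, DA x -> (A - Q) (x + GX x) = (A - V) x + GX ((A - V) x)) ->
  let W := idfun + (G + GX + (G \o GX)) in
  [/\ cont_invertible W, forall x, DA (W x) <-> DA x &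
      forall x, DA x -> (A - B) (W x) = W ((A - V) x)].
Proof.
move=> bG bX i1 i2 D1 D2 T1 T2 W.
have WE x : W x = (x + GX x) + G (x + GX x).
  rewrite (boD bG) /W !add_opE /= !addrA.
  by rewrite [LHS](ACl (1*3*2*4)%AC).
have DW x : DA (W x) <-> DA x by rewrite WE; split=> [/D1/D2|/D2/D1].
split => //.
- have bW : bounded_op W by apply: bo_add; [exact: bo_id|apply: bo_add; [exact: bo_add|exact: bo_comp]].
  split => //.
  have [bY1 YK1 KY1] := inv_opP i1; have [bY2 YK2 KY2] := inv_opP i2.
  exists (inv_op (idfun + GX) \o inv_op (idfun + G)); split.
  + exact: (bo_comp bY2 bY1).
  + move=> x; rewrite WE.
    exact: (etrans (congr1 (inv_op (idfun + GX)) (YK1 ((idfun + GX) x))) (YK2 x)).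
  + move=> x; rewrite WE.
    exact: (etrans (congr1 (idfun + G) (KY2 (inv_op (idfun + G) x))) (KY1 x)).
- by move=> x Dx; rewrite !WE T1 ?T2//; exact/D2.
Qed.

End TwoSteps.

(** * The principal part of V *)

Section DiagonalPart.
Context {R : realType} {H : completeNormedModType R[i]}.
Variables (ip : {dot H for Num.conj}) (ip_norm : scalar_product_norm ip).
Variables (DA : set H) (A B : H -> H) (lam : int -> R[i]) (mult : int -> nat).
Variables (P : int -> H -> H) (hA : unperturbed ip DA A lam mult P).
Variables (hB : perturbation ip DA A B lam P).
Variables (e : int * nat -> H) (fr : adapted_frame ip P mult e).

Let lin := unp_linear hA.
Let linB := per_linear hB.
Let resP := unp_resolution hA.

Lemma GB_entries m i j : entry P (Gammat P lam m B) i j =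
  if i == j then 0 else (lam i - lam j)^-1 *: entry P (B - Jt P m B) i j.
Proof.
have [_ eG] := GB_spec ip_norm hA hB fr m; apply/funext => x.
rewrite entryE eG /gam; case: eqVneq => [->|ij]; first by rewrite blk_diag scale0r.
rewrite scale_opE entryE sub_opE (boB (P_bo resP i)) (JB_entry ip_norm hA hB fr).
by case: ifP => _; rewrite ?subrr ?subr0 ?scale0r ?scaler0.
Qed.

Lemma Pb_HS N : HS e (Pblock P N).
Proof.
rewrite (_ : Pblock P N = \sum_(n <- irange N) P n).
  apply: HS_sum => n _; exact: (HS_P ip_norm resP fr (X := idfun) (P_bo resP n)).
by apply/funext => x; rewrite PblockE fct_sumE.
Qed.

Lemma diagonal_product_trace_class X Y : HS e X -> HS e Y ->
  trace_class ip (Jt P 0 (X \o Y)).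
Proof.
move=> hX hY; have [hXY _] := HSM ip_norm resP fr hX hY.
apply: (diagonal_HS_product_trace_class ip_norm resP fr hX hY (Jt_bo ip_norm hA 0 (HS_bo hXY))).
move=> i j x; rewrite (Jt_entry ip_norm hA 0 (HS_bo hXY)) /=.
suff -> : blk 0 i j = (i == j) by [].
rewrite /blk !leqn0 !absz_eq0; case: eqVneq => [->|_] /=; last by [].
by rewrite eq_sym orbb.
Qed.

(** The difference lives in the central block, so it is P_(k) times itself, a
    product of two Hilbert-Schmidt operators. *)
Lemma central_trace_class k Y : HS e Y -> trace_class ip (Jt P k Y - Jt P 0 Y).
Proof.
move=> hY; have [h1 _] := Jt_HS ip_norm hA fr k hY.
have [h2 _] := Jt_HS ip_norm hA fr 0 hY; have [hD _] := HSB h1 h2.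
suff -> : Jt P k Y - Jt P 0 Y = Pblock P k \o (Jt P k Y - Jt P 0 Y).
  exact: (HS_product_trace_class ip_norm resP fr (Pb_HS k) hD).
have bPb := Pb_bo resP k; have bY := HS_bo hY.
apply: (entry_inj resP (HS_bo hD) (bo_comp bPb (HS_bo hD))) => i j; apply/funext => x.
rewrite !entryE [in RHS]/comp /= (P_Pb resP); case: leqP => // hi.
rewrite sub_opE (boB (P_bo resP i)) !(Jt_entry ip_norm hA _ bY) /blk.
rewrite !leqn0 leqNgt hi /= absz_eq0.
have -> : (i == 0) = false by apply/negbTE; rewrite -absz_gt0; exact: leq_ltn_trans hi.
by rewrite subrr.
Qed.

Lemma Jt0_Jt m : Jt P 0 (Jt P m B) = Jt P 0 B.
Proof.
have bJ := JB_bo ip_norm hA hB fr m.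
apply: (entry_inj resP (Jt_bo ip_norm hA 0 bJ) (JB_bo ip_norm hA hB fr 0)) => i j.
apply/funext => x; rewrite !entryE (Jt_entry ip_norm hA 0 bJ).
rewrite !(JB_entry ip_norm hA hB fr); case: (boolP (blk 0 i j)) => // h.
suff -> : blk m i j by [].
case/orP: h => [/andP[hi hj]|/eqP ->]; last exact: blk_diag.
by rewrite /blk (leq_trans hi) ?(leq_trans hj).
Qed.

Variables (m k : nat) (mk : (m <= k)%N).
Local Notation G := (Gammat P lam m B).
Local Notation G0 := (Gammat P lam 0 B).
Local Notation J := (Jt P m B).
Local Notation BG := (bounded_extension DA (B \o G)).
Local Notation BG0 := (bounded_extension DA (B \o G0)).

Lemma BPb_HS N : HS e (B \o Pblock P N).
Proof.
rewrite (_ : B \o Pblock P N = \sum_(n <- irange N) (B \o P n)).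
  apply: HS_sum => n _; exact: (HS_P ip_norm resP fr (BP_bo ip_norm hA hB n)).
by apply/funext => x; rewrite /= (BPb hA hB) fct_sumE.
Qed.

Lemma BG_cut : BG = BG0 - ((B \o Pblock P m) \o (G0 \o Pblock P m)).
Proof.
have [h0 BG0E] := BG_spec ip_norm hA hB fr 0.
have [hG0 _] := GB_spec ip_norm hA hB fr 0.
have hF : HS e ((B \o Pblock P m) \o (G0 \o Pblock P m)).
  have [hF2 _] := HSM ip_norm resP fr hG0 (Pb_HS m).
  by have [] := HSM ip_norm resP fr (BPb_HS m) hF2.
have [hD _] := HSB h0 hF.
apply: (bounded_extensionE hA (HS_bo hD)) => x Dx.
have [DG0 _] := GB_intertwine ip_norm hA hB fr 0 Dx.
rewrite sub_opE (BG0E x Dx) /= (G_cut ip_norm hA hB fr m) sub_opE (onB linB)//.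
exact: (Pb_dom hA).
Qed.

Variables (B0 Q GX V : H -> H) (hB0 : HS e B0) (hGX : HS e GX).
Hypothesis B0E : forall x, B0 x = BG x - G (J x) - G (B0 x).
Hypothesis offGX : block_offdiagonal P k GX.

(** J_m B is block-diagonal and GX has vanishing diagonal blocks, so their product
    does not contribute to J_k. *)
Lemma V_formula : V = Jt P k (J + B0) + Jt P k ((J + B0) \o GX) ->
  V = J + Jt P k (B0 \o (idfun + GX)).
Proof.
have bJ := JB_bo ip_norm hA hB fr m; have bB0 := HS_bo hB0; have bX := HS_bo hGX.
have bb := B_block_bounded ip_norm hA hB fr.
have JJ : Jt P k J = J by exact: (Jt_Jt ip_norm hA mk bb).
have dJ : block_diagonal P k J.
  by rewrite -JJ; exact: (Jt_block_diagonal ip_norm hA (bo_block_bounded ip_norm resP bJ)).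
have bJX := bo_comp bJ bX; have bBX := bo_comp bB0 bX.
have J0 : Jt P k (J \o GX) = 0.
  by apply: (Jt_eq0 ip_norm hA bJX); exact: (diag_off_comp hA bX bJ offGX dJ).
move=> ->.
have -> : (J + B0) \o GX = (J \o GX) + (B0 \o GX) by [].
have -> : B0 \o (idfun + GX) = B0 + (B0 \o GX).
  by apply/funext => x; rewrite /= add_opE (boD bB0).
rewrite (JtD ip_norm hA k bJ bB0) (JtD ip_norm hA k bJX bBX) (JtD ip_norm hA k bB0 bBX).
by rewrite JJ J0 add0r; exact: (esym (addrA _ _ _)).
Qed.

(** Solving for B0 gives B0 (1 + GX) = BG0 + N1, where N1 is a sum of four products
    of Hilbert-Schmidt operators. *)
Lemma V_trace_class : V = J + Jt P k (B0 \o (idfun + GX)) ->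
  exists C, nuclear ip C /\ V = Jt P 0 B + Jt P 0 BG0 + C.
Proof.
move=> VE; have hJ := JB_HS ip_norm hA hB fr m; have bB0 := HS_bo hB0.
have [h0 _] := BG_spec ip_norm hA hB fr 0.
have [hG _] := GB_spec ip_norm hA hB fr m; have [hG0 _] := GB_spec ip_norm hA hB fr 0.
have [hF2 _] := HSM ip_norm resP fr hG0 (Pb_HS m).
pose F1 := - (B \o Pblock P m); have [hF1 _] := HSN (BPb_HS m).
pose G' := - G; have [hG' _] := HSN hG.
pose T1 := F1 \o (G0 \o Pblock P m); pose T2 := G' \o J; pose T3 := G' \o B0.
pose T4 := B0 \o GX.
have [hT1 _] := HSM ip_norm resP fr hF1 hF2; have [hT2 _] := HSM ip_norm resP fr hG' hJ.
have [hT3 _] := HSM ip_norm resP fr hG' hB0; have [hT4 _] := HSM ip_norm resP fr hB0 hGX.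
have [h12 _] := HSD hT1 hT2; have [h34 _] := HSD hT3 hT4.
have [hN _] := HSD h12 h34; have [hY _] := HSD h0 hN.
pose N1 := (T1 + T2) + (T3 + T4).
have YE : B0 \o (idfun + GX) = BG0 + N1.
  apply/funext => x; rewrite /= (boD bB0) /= [in LHS]B0E BG_cut.
  rewrite -[RHS]/(BG0 x + ((- B (Pblock P m (G0 (Pblock P m x))) + - G (J x)) + (- G (B0 x) + B0 (GX x)))).
  rewrite -[(_ - (_ \o _)) x]/(BG0 x - B (Pblock P m (G0 (Pblock P m x)))).
  by rewrite !addrA.
have JJ : Jt P m J = J by exact: (Jt_Jt ip_norm hA (leqnn m) (B_block_bounded ip_norm hA hB fr)).
have tJ : trace_class ip (J - Jt P 0 B).
  by have := central_trace_class m hJ; rewrite JJ Jt0_Jt.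
have tY := central_trace_class k hY.
have tN : trace_class ip (Jt P 0 N1).
  rewrite (JtD ip_norm hA 0 (HS_bo h12) (HS_bo h34)).
  rewrite (JtD ip_norm hA 0 (HS_bo hT1) (HS_bo hT2)) (JtD ip_norm hA 0 (HS_bo hT3) (HS_bo hT4)).
  by apply: trace_classD; apply: trace_classD; exact: diagonal_product_trace_class.
exists ((J - Jt P 0 B) + ((Jt P k (BG0 + N1) - Jt P 0 (BG0 + N1)) + Jt P 0 N1)); split.
  by apply: trace_class_nuclear; apply: trace_classD => //; exact: trace_classD.
rewrite VE YE (JtD ip_norm hA 0 (HS_bo h0) (HS_bo hN)) -/N1.
move: (Jt P k _) (Jt P 0 B) (Jt P 0 BG0) (Jt P 0 N1) J => a b c d f; apply/funext => x.
rewrite !opE.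
move: (a x) (b x) (c x) (d x) (f x) => a1 b1 c1 d1 f1; rewrite !opprD !addrA.
by rewrite [RHS](ACl (3*5*(1*4)*(2*6)*(8*7))%AC) /= !subrr !addr0.
Qed.

End DiagonalPart.

(** * Consequences for the blocks *)

Section Assembly.
Context {R : realType} {H : completeNormedModType R[i]}.
Variables (ip : {dot H for Num.conj}) (ip_norm : scalar_product_norm ip).
Variables (DA : set H) (A : H -> H) (lam : int -> R[i]) (mult : int -> nat).
Variables (P : int -> H -> H) (hA : unperturbed ip DA A lam mult P).
Variables (e : int * nat -> H) (fr : adapted_frame ip P mult e).
Variables (del : R) (del0 : 0 < del).
Hypothesis gapP : forall i j, i != j -> del <= nm (lam i - lam j).
Let resP := unp_resolution hA.

Lemma Phi_0 Q k : HS e Q -> Phi P lam Q k 0 = Q.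
Proof.
move=> hQ; have [h0 n0] := HS0 e.
have [hG nG _] := Gammat_spec ip_norm hA fr del0 gapP k h0.
have G0 : Gammat P lam k 0 = 0.
  apply: (hsn_eq0 ip_norm resP fr hG); apply/le_anti; rewrite hsn_ge0 andbT.
  by rewrite (le_trans nG)// n0 mulr0.
rewrite /Phi G0; apply/funext => x.
rewrite !(add_opE, opp_opE) /= (bo0 (HS_bo hQ)).
by rewrite -[LHS]/(0 - 0 - 0 + Q x) !subr0 add0r.
Qed.

Lemma hsnorm2_cvg0 (F : nat -> H -> H) (X : H -> H) (c : R) : HS e X ->
  (forall n, HS e (F n) /\ hsn e (F n - X) <= c * 2^-1 ^+ n) ->
  (fun n => hsnorm2 ip (F n - X)) @ \oo --> 0%E.
Proof.
move=> hX hF.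
have -> : (fun n => hsnorm2 ip (F n - X)) = (fun n => (hsn e (F n - X) * hsn e (F n - X))%:E).
  apply/funext => n; have [hFn _] := hF n; have [hD _] := HSB hFn hX.
  by rewrite (hsnorm2E ip_norm resP fr (HS_bo hD)) (hs2_hsn hD).
have h : (fun n => hsn e (F n - X)) @ \oo --> (0 : R).
  apply: (@squeeze_cvgr _ _ _ _ (fun=> 0) (geometric c 2^-1)).
  - by apply: nearW => n; rewrite hsn_ge0 /=; have [_] := hF n.
  - exact: cvg_cst.
  - by apply: cvg_geometric; rewrite gtr0_norm ?invf_lt1// ?ltr1n ?invr_gt0.
have := cvgM h h; rewrite mulr0 => h2.
by apply: cvg_EFin; [exact: nearW|exact: h2].
Qed.

Section Blocks.
Variables (k : nat) (V : H -> H) (bV : bounded_op V) (dV : block_diagonal P k V).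
Local Notation idx := (option {n : int | (k < `|n|)%N}).

Lemma co_V (o : idx) x : coarse P k o (V x) = V (coarse P k o x).
Proof.
case: o => [n|] /=; last exact: (Pb_V hA bV dV x (leqnn k)).
exact: (P_V hA bV dV x (valP n)).
Qed.

Lemma coarse_diagonal (o o' : idx) : o <> o' -> coarse P k o \o V \o coarse P k o' = 0.
Proof.
move=> ne; apply/funext => x /=.
by rewrite co_V (co_orth hA)// (bo0 bV).
Qed.

Variables (Q GX : H -> H) (hQ : HS e Q) (hGX : HS e GX).
Hypothesis G4 : forall x, nm (GX x) <= 4^-1 * nm x.
Hypothesis VE : V = Jt P k Q + Jt P k (Q \o GX).

(** V is block-diagonal, so V P_n is P_n Q (1 + GX) P_n, and GX is a contraction. *)
Lemma V_block_bound n y : (k < `|n|)%N ->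
  nm (P n (V y)) <= 2 * Num.sqrt (fine (normP2 P (P n \o Q))) * nm y.
Proof.
move=> kn; have bQ := HS_bo hQ; have bX := HS_bo hGX; have bQX := bo_comp bQ bX.
set s := Num.sqrt _; have s0 : 0 <= s by exact: sqrtr_ge0.
have -> : P n (V y) = P n (Q (P n y)) + P n (Q (GX (P n y))).
  have -> : P n (V y) = P n (V (P n y)) by rewrite -(P_V hA bV dV y kn) (P_idem resP).
  rewrite VE add_opE (boD (P_bo resP n)) (Jt_entry ip_norm hA k bQ).
  by rewrite (Jt_entry ip_norm hA k bQX) blk_diag.
have h1 := row_bound ip_norm resP fr hQ n (P n y).
have h2 := row_bound ip_norm resP fr hQ n (GX (P n y)).
apply: le_trans (nmD _ _) _; apply: le_trans (lerD h1 h2) _; rewrite -/s -mulrDr.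
rewrite -mulrA mulrCA ler_wpM2l//.
have := G4 (P n y); have := P_le ip_norm resP n y; have := nm_ge0 (P n y).
by move: (nm _) (nm (GX _)) (nm _) => u v w; lra.
Qed.

Variables (T1 W : H -> H) (cW : cont_invertible W).
Hypotheses (DW : forall x, DA (W x) <-> DA x).
Hypothesis TW : forall x, DA x -> T1 (W x) = W ((A - V) x).

Lemma shifts_summable : (forall l : nat, Q <> Pblock P l \o Q \o Pblock P l) ->
  (forall n, alpha P Q n <> 0) /\
  exists b : int -> nat -> R[i],
    spectrum DA T1 = [set lam ni.1 - b ni.1 ni.2
      | ni in [set ni : int * nat | (ni.2 < mult ni.1)%N]] /\
    (\esum_(n in [set: int])
       ((\big[Num.max/0]_(i < mult n) nm (b n i)) ^+ 2 * (alpha P Q n) ^- 2)%:E < +oo)%E.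
Proof.
move=> ne; have [N20 al0] := alpha_neq0 ip_norm resP fr hQ ne; split => //.
have /choice[ev hev] := block_eigenvalues ip_norm hA fr bV dV.
have [|b [bE hb]] := @enumerate_blocks R lam mult k ev.
  by move=> o; have [] := hev o.
exists b; split.
  rewrite -bE; apply/seteqP; split => z.
    move=> /(spectrum_eig ip_norm hA fr bV dV cW.1 (inv_opP cW) DW TW)[ o1 h].
    by exists o1; have [_ _ ho] := hev o1; exact/ho.
  move=> [ o1 h]; apply/(spectrum_eig ip_norm hA fr bV dV cW.1 (inv_opP cW) DW TW).
  by exists o1; have [_ _ ho] := hev o1; exact/ho.
apply: (@weighted_summable _ _ _ ip_norm _ resP _ _ fr _ hQ
  (fun n => (\big[Num.max/0]_(t < mult n) nm (b n t)) ^+ 2) 4 k) => // [n|n kn].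
  exact: sqr_ge0.
have r0 : 0 <= fine (normP2 P (P n \o Q)) by apply: fine_ge0; exact: normP2_ge0.
set r := fine _ in r0 *.
have -> : 4 * r = (2 * Num.sqrt r) ^+ 2.
  by rewrite exprMn sqr_sqrtr//; congr (_ * _); rewrite expr2 -natrM.
have s0 : 0 <= 2 * Num.sqrt r by rewrite mulr_ge0// sqrtr_ge0.
have le : \big[Num.max/0]_(t < mult n) nm (b n t) <= 2 * Num.sqrt r.
  apply: bigmax_le => // t _; pose m : {n : int | (k < `|n|)%N} := exist _ n kn.
  have [_ _ ho] := hev (Some m).
  have /ho := hb m t => h.
  have hc y : nm (P (val m) (V y)) <= 2 * Num.sqrt r * nm y by exact: V_block_bound.
  have := eig_block_near hA bV dV hc h.
  by rewrite /= subKr.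
rewrite ler_sqr ?nnegrE//.
by elim/big_ind : _ => // [x y x0 y0|t _]; rewrite ?le_max ?x0// nm_ge0.
Qed.

End Blocks.
End Assembly.

(** * The theorem *)

Theorem theorem4p8 (R : realType) (H : completeNormedModType R[i])
  (ip : {dot H for Num.conj}) (ip_norm : scalar_product_norm ip)
  (H_separable : separable_space H)
  (DA : set H) (A B : H -> H)
  (lam : int -> R[i]) (mult : int -> nat) (P : int -> H -> H)
  (hA : unperturbed ip DA A lam mult P)
  (hB : perturbation ip DA A B lam P) :
  exists m k : nat, (m <= k)%N /\
    let G := Gammat P lam m B in
    let J := Jt P m B in
    let BG := bounded_extension DA (B \o G) in
    let B0 := inv_op (idfun + G) \o (BG - (G \o J)) in
    let Q := J + B0 in
    (* the operators entering B0 and Q are well defined *)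
    [/\ hilbert_schmidt ip G,
        forall i j, entry P G i j =
          (if i == j then 0 else
           (lam i - lam j)^-1 *: entry P (B - J) i j),
        hilbert_schmidt ip J,
        (forall x, DA x -> DA (G x)) &
        [/\ hilbert_schmidt ip BG,
            forall x, DA x -> BG x = B (G x),
            cont_invertible (idfun + G) &
            hilbert_schmidt ip Q]] /\
    (forall X, hilbert_schmidt ip X -> hilbert_schmidt ip (Phi P lam Q k X)) /\
    exists Xs : H -> H,
      [/\ hilbert_schmidt ip Xs,
          Phi P lam Q k 0 = Q &
          (fun n => hsnorm2 ip (iter n (Phi P lam Q k) 0 - Xs))
             @ \oo --> 0%E] /\
    let GX := Gammat P lam k Xs in
    let U := G + GX + (G \o GX) in
    let V := Jt P k Xs in
    let W := idfun + U in
    (V = Jt P k Q + Jt P k (Q \o GX) /\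
     V = J + Jt P k (B0 \o (idfun + GX))) /\
    (* (1) *)
    [/\ hilbert_schmidt ip U, hilbert_schmidt ip V &
        similar_via DA (A - B) DA (A - V) W] /\
    (* (2) *)
    ((forall o o', o <> o' -> coarse P k o \o V \o coarse P k o' = 0) /\
     (forall o, spectral_projection DA (A - B)
                  (W \o coarse P k o \o inv_op W)) /\
     exists ip' : {dot H for Num.conj}, equivalent_scalar_products ip ip' /\
       resolution_of_identity ip'
         (fun o => W \o coarse P k o \o inv_op W)) /\
    (* (3) *)
    (let G0 := Gammat P lam 0 B in
     let BG0 := bounded_extension DA (B \o G0) in
     [/\ bounded_op BG0,
         forall x, DA x -> DA (G0 x) /\ BG0 x = B (G0 x) &
         exists C : H -> H,
           nuclear ip C /\ V = Jt P 0 B + Jt P 0 BG0 + C]) /\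
    (* (4): b n lists the shifts of the (at most mult n) eigenvalues near lam n;
       it is a single number b n 0 when lam n is simple *)
    ((forall l : nat, Q <> Pblock P l \o Q \o Pblock P l) ->
     (forall n, alpha P Q n <> 0) /\
     exists b : int -> nat -> R[i],
       spectrum DA (A - B) =
         [set lam ni.1 - b ni.1 ni.2
         | ni in [set ni : int * nat | (ni.2 < mult ni.1)%N]] /\
       (\esum_(n in [set: int])
          ((\big[Num.max/0]_(i < mult n) nm (b n i)) ^+ 2
           * (alpha P Q n) ^- 2)%:E < +oo)%E).
Proof.
have [e fr] := unperturbed_frame ip_norm hA.
have resP := unp_resolution hA.
have [del del0 gapP] := gap hA.
have q4 : 0 < (4^-1 : R) by rewrite invr_gt0.
have [m hm] := GB_small ip_norm hA hB fr q4.
have [hG eG] := GB_spec ip_norm hA hB fr m.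
have G4 x : nm (Gammat P lam m B x) <= 4^-1 * nm x.
  apply: le_trans (op_hs ip_norm resP fr x hG) _.
  by rewrite ler_wpM2r ?nm_ge0// hm.
have [inv1 D1] := first_domain ip_norm hA hB fr G4.
have [hBG BGE] := BG_spec ip_norm hA hB fr m.
have [hB0 B0E] := B0_spec ip_norm hA hB fr inv1.
have hJ := JB_HS ip_norm hA hB fr m.
have [hQ _] := HSD hJ hB0.
have sim1 := first_similarity ip_norm hA hB fr inv1.
have HSto X : HS e X -> hilbert_schmidt ip X by move=> /(HSP ip_norm resP fr).
have [eta eta0 [K disj]] := blocks_disjoint ip_norm hA fr del0 gapP hQ.
(* the fixed point must be near Q, and Gamma_k of it small enough for 1 + GX *)
have eta4 : 0 < Num.min eta 4^-1 by rewrite lt_min eta0.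
have [k0 hk0] := fixed_point ip_norm hA fr del0 gapP hQ eta4.
(* large enough for the fixed point, for disjoint block spectra, and for J_m B to
   be block-diagonal at level k *)
pose k := maxn m (maxn K k0).
have mk : (m <= k)%N by rewrite leq_maxl.
have Kk : (K <= k)%N by rewrite !leq_max leqnn orbT.
have kk : (k0 <= k)%N by rewrite !leq_max leqnn !orbT.
have [PhiHS [Xs [hX fixX [c hc] XQ GXn]]] := hk0 k kk.
have [hGX _ _] := Gammat_spec ip_norm hA fr del0 gapP k hX.
have GX4 x : nm (Gammat P lam k Xs x) <= 4^-1 * nm x.
  apply: le_trans (op_hs ip_norm resP fr x hGX) _.
  by rewrite ler_wpM2r ?nm_ge0// (le_trans GXn)// ge_min lexx orbT.
have [inv2 D2] := second_domain ip_norm hA hB fr del0 gapP hX GX4.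
have [VQ _] := second_fixed ip_norm hA fr del0 gapP hQ hX fixX.
have sim2 := second_similarity ip_norm hA fr del0 gapP hQ hX fixX.
have [invW DW TW] := composed_similarity (HS_bo hG) (HS_bo hGX) inv1 inv2 D1 D2 sim1 sim2.
have offX := Gammat_off ip_norm hA fr del0 gapP (k := k) hX.
have VJ := V_formula ip_norm hA hB fr mk hB0 hGX offX VQ.
have [hV _] := Jt_HS ip_norm hA fr k hX.
have dV := Jt_block_diagonal ip_norm hA (k := k) (HS_block_bounded ip_norm hA hX).
have [hGG _] := HSM ip_norm resP fr hG hGX; have [hU1 _] := HSD hG hGX.
have [hU _] := HSD hU1 hGG.
have dis : forall (o o' : option {n : int | (k < `|n|)%N}) z, o <> o' ->
    eig A P (Jt P k Xs) o z -> eig A P (Jt P k Xs) o' z -> False.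
  apply: (disj k (Jt P k Xs) Kk hV dV).
  have [hD _] := HSB hX hQ; have [_ hJD] := Jt_HS ip_norm hA fr k hD.
  rewrite -(JtB ip_norm hA k (HS_bo hX) (HS_bo hQ)).
  by apply: le_trans hJD _; apply: le_trans XQ _; rewrite ge_min lexx.
have iW := inv_opP invW.
exists m, k; split => // G J BG B0 Q.
split.
  split; [exact: (HSto _ hG)| |exact: (HSto _ hJ)|
         by move=> x /(GB_intertwine ip_norm hA hB fr m)[]|].
    exact: (GB_entries ip_norm hA hB fr m).
  by split; [exact: (HSto _ hBG)|exact: BGE|exact: inv1|exact: (HSto _ hQ)].
split; first by move=> X /(HSP ip_norm resP fr) h; apply: HSto; exact: PhiHS.
exists Xs; split.
  split; [exact: (HSto _ hX)|exact: (Phi_0 ip_norm hA fr del0 gapP k hQ)|].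
  exact: (hsnorm2_cvg0 ip_norm hA fr hX hc).
move=> GX U V W; split; first by split; [exact: VQ|exact: VJ].
split.
  split; [exact: (HSto _ hU)|exact: (HSto _ hV)|].
  split; [exact: invW| |exact: TW].
  apply/seteqP; split => [y [x Dx <-]|y Dy]; first exact/DW.
  have [_ _ KW] := iW; exists (inv_op W y); last exact: KW.
  by apply/DW; rewrite KW.
split.
  split; first exact: (coarse_diagonal hA (HS_bo hV) dV).
  split; last exact: (transported_resolution ip_norm hA k invW.1 iW).
  exact: (transported_spectral_projection ip_norm hA fr (HS_bo hV) dV dis
    (perturbed_linear hA hB) invW.1 iW DW TW).
split; last exact: (shifts_summable ip_norm hA fr (HS_bo hV) dV hQ hGX GX4 VQ invW DW TW).
move=> G0 BG0; have [hBG0 BG0E] := BG_spec ip_norm hA hB fr 0.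
split; first exact: (HS_bo hBG0).
  move=> x Dx; split; last exact: BG0E.
  by have [] := GB_intertwine ip_norm hA hB fr 0 Dx.
exact: (V_trace_class ip_norm hA hB fr hB0 hGX B0E VJ).
Qed.
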